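(* Let $\varphi:[0,1]\to\mathbb R^2$ be a nondegenerate curve. Then for Lebesgue-almost every $s\in[0,1]$, $\varphi(s)$ admits no improvement in Dirichlet's theorem.
   Context: A map $\varphi:[0,1]\to\mathbb R^n$ is nondegenerate if it is $n$ times continuously differentiable and for almost every $s$ the vectors $\varphi'(s),\varphi''(s),\dots,\varphi^{(n)}(s)$ are linearly independent in $\mathbb R^n$ (here $n=2$). $\|\cdot\|$ is the sup-norm. For $\sigma\in(0,1)$, $\mathbf v\in\mathbb R^n$ belongs to $\mathrm{DI}(\sigma)$ if for all sufficiently large $Q$ there exist $q\in\mathbb N$, $\mathbf p\in\mathbb Z^n$ with $\|q\mathbf v-\mathbf p\|<\sigma Q^{-1/n}$ and $q<\sigma Q$. $\mathbf v$ admits no improvement in Dirichlet's theorem if $\mathbf v\notin\bigcup_{0<\sigma<1}\mathrm{DI}(\sigma)$. *)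

(* Defs.v *)
From Stdlib Require Import Reals Lra ZArith.
Open Scope R_scope.

Definition I01 (x : R) : Prop := 0 <= x <= 1.

Definition has_deriv_on01 (f f' : R -> R) : Prop :=
  forall x, I01 x -> forall eps, 0 < eps -> exists delta, 0 < delta /\
    forall y, I01 y -> 0 < Rabs (y - x) < delta ->
      Rabs ((f y - f x) / (y - x) - f' x) < eps.

Definition continuous_on01 (f : R -> R) : Prop :=
  forall x, I01 x -> forall eps, 0 < eps -> exists delta, 0 < delta /\
    forall y, I01 y -> Rabs (y - x) < delta -> Rabs (f y - f x) < eps.

Definition null_set (E : R -> Prop) : Prop :=
  forall eps, 0 < eps -> exists a b : nat -> R,
    (forall n, a n <= b n) /\
    (forall x, E x -> exists n, a n < x < b n) /\
    (forall N, sum_f_R0 (fun n => b n - a n) N <= eps).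

Definition lin_indep2 (u1 u2 v1 v2 : R) : Prop :=
  forall a b, a * u1 + b * v1 = 0 -> a * u2 + b * v2 = 0 -> a = 0 /\ b = 0.

Definition nondegenerate (phi1 phi2 : R -> R) : Prop :=
  exists d1 d2 e1 e2 : R -> R,
    has_deriv_on01 phi1 d1 /\ has_deriv_on01 d1 e1 /\ continuous_on01 e1 /\
    has_deriv_on01 phi2 d2 /\ has_deriv_on01 d2 e2 /\ continuous_on01 e2 /\
    null_set (fun s => I01 s /\ ~ lin_indep2 (d1 s) (d2 s) (e1 s) (e2 s)).

Definition supnorm2 (x y : R) : R := Rmax (Rabs x) (Rabs y).

Definition DI (sigma v1 v2 : R) : Prop :=
  exists Q0 : R, forall Q : R, Q0 <= Q ->
    exists (q : nat) (p1 p2 : Z), (1 <= q)%nat /\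
      supnorm2 (INR q * v1 - IZR p1) (INR q * v2 - IZR p2)
        < sigma * Rpower Q (- (1 / 2)) /\
      INR q < sigma * Q.

Definition no_DI_improvement (v1 v2 : R) : Prop :=
  ~ (exists sigma, 0 < sigma < 1 /\ DI sigma v1 v2).

(* Main.v *)
(* On a short arc the curve is a uniformly convex graph t |-> (t, f t).
   A parameter t escapes DI(sigma) as soon as, for arbitrarily large Q, some rational point w = (q, p1, p2) and some rational
   line e through w satisfy: at t the point w is displaced by Q^(-1/2) in the
   vertical direction only, q is much smaller than Q, the first coefficient of e is
   nearly Q^(1/2), and t almost lies on e. Indeed, the cross product of w with a
   solution of the Dirichlet system would be a line through w of smaller height
   than e that is too close to t.

   Such flags are plentiful. Dirichlet's theorem in the box adapted to the tangent
   direction gives w near every t; moving to the foot of w on the curve makes the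
   displacement vertical; the lines through w contain an arithmetic progression, one
   of whose terms can serve as e unless w lies on a line of very small height. The
   exceptional t, those near a rational point or line whose adapted box has small
   volume, form a set of small measure: two different points (lines) that are small
   at the same place have as cross product a line (point) of much smaller volume,
   and one that is alone on a longer stretch is small only on a small part of it.
   So every interval J loses a fixed proportion of its length, independent of J, to
   parameters outside DI(sigma), and iterating shows that DI(sigma) is null. *)

Require Import Defs.
From Stdlib Require Import Reals.
From Stdlib Require Import Ranalysis5 Lra Lia Psatz ZArith List Classical ClassicalEpsilon Cantor.
Import ListNotations.
Open Scope R_scope.

(** * Finite covers by intervals *)

(** The balance of scales makes the lost proportion independent of the interval. At scale [S] the
    point [w] has [q] between [eta * eps * S^2] and [eps * S^2], and displacement [y] between
    [eta / (2 * S)] and [2 / S]. The flag spoils all parameters within a distance of order [y^3],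
    hence [S^(-3)], while it lies at a distance of order [y / q], again [S^(-3)], from the parameter
    at which [w] was sought. Without the lower bounds on [q] and [y] the gap could be far away or
    too short; parameters violating them are part of the exceptional set. [Q] is not prescribed: it
    is set to [y^(-2)] once [w] is known, which suffices because [DI] quantifies over all large [Q].
    The constants are chosen in the order [e1], [e2], [e3], [u], [kap1], [C1] (from [sigma] and the
    arc), then [N], which makes the exceptional proportion small, then [eps] and [eta]. Only [S]
    depends on the interval and on the threshold for [Q]. *)

Fixpoint total_length (l : list (R * R)) : R :=
  match l with
  | [] => 0
  | p :: l => snd p - fst p + total_length l
  end.

Definition covers (l : list (R * R)) (E : R -> Prop) : Prop :=
  forall x, E x -> exists p, In p l /\ fst p <= x <= snd p.

Definition intervals (l : list (R * R)) : Prop :=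
  forall p, In p l -> fst p <= snd p.

(** An outer length: no measurability is ever needed, and a finite cover is a list on which one can
    recurse. *)
Definition fcov (E : R -> Prop) (L : R) : Prop :=
  exists l, intervals l /\ covers l E /\ total_length l <= L.

Lemma total_length_app l1 l2 :
  total_length (l1 ++ l2) = total_length l1 + total_length l2.
Proof. induction l1; simpl; lra. Qed.

Lemma total_length_ge0 l : intervals l -> 0 <= total_length l.
Proof.
  induction l as [|p l IH]; simpl; intros H; [lra|].
  assert (fst p <= snd p) by (apply H; left; auto).
  assert (0 <= total_length l) by (apply IH; intros r Hr; apply H; right; auto).
  lra.
Qed.

Lemma fcov_mono (E E' : R -> Prop) L L' :
  fcov E L -> (forall x, E' x -> E x) -> L <= L' -> fcov E' L'.
Proof.
  intros (l & H1 & H2 & H3) HE HL; exists l; repeat split; auto; try lra.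
  intros x Hx; apply H2, HE, Hx.
Qed.

Lemma fcov_empty (E : R -> Prop) L : (forall x, ~ E x) -> 0 <= L -> fcov E L.
Proof.
  intros H HL; exists []; repeat split; simpl; auto.
  - intros p [].
  - intros x Hx; destruct (H x Hx).
Qed.

Lemma fcov_interval (E : R -> Prop) a b :
  a <= b -> (forall x, E x -> a <= x <= b) -> fcov E (b - a).
Proof.
  intros Hab H; exists [(a, b)]; repeat split; simpl.
  - intros p [<-|[]]; simpl; lra.
  - intros x Hx; exists (a, b); split; [left; auto|simpl; apply H, Hx].
  - lra.
Qed.

Lemma fcov_union (E1 E2 E : R -> Prop) L1 L2 :
  fcov E1 L1 -> fcov E2 L2 -> (forall x, E x -> E1 x \/ E2 x) -> fcov E (L1 + L2).
Proof.
  intros (l1 & H1 & C1 & T1) (l2 & H2 & C2 & T2) HE.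
  exists (l1 ++ l2); repeat split.
  - intros p Hp; apply in_app_or in Hp as [Hp|Hp]; auto.
  - intros x Hx; destruct (HE x Hx) as [Hx'|Hx'].
    + destruct (C1 x Hx') as (p & Hp & Hxp); exists p; split; auto; apply in_or_app; auto.
    + destruct (C2 x Hx') as (p & Hp & Hxp); exists p; split; auto; apply in_or_app; auto.
  - rewrite total_length_app; lra.
Qed.

Lemma fcov_excluded (E P J : R -> Prop) L1 L2 :
  fcov (fun x => (E x /\ ~ P x) /\ J x) L1 -> fcov (fun x => P x /\ J x) L2 ->
  fcov (fun x => E x /\ J x) (L1 + L2).
Proof.
  intros H1 H2; apply (fcov_union _ _ _ _ _ H1 H2).
  intros x (Ex & Jx); destruct (classic (P x)); auto.
Qed.

Lemma fcov_or (E1 E2 J : R -> Prop) L1 L2 :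
  fcov (fun x => E1 x /\ J x) L1 -> fcov (fun x => E2 x /\ J x) L2 ->
  fcov (fun x => (E1 x \/ E2 x) /\ J x) (L1 + L2).
Proof. intros H1 H2; apply (fcov_union _ _ _ _ _ H1 H2); tauto. Qed.

(** The factor 2 avoids infima and suprema: the interval of radius [d] about any one point of [E]
    contains [E]. *)
Lemma fcov_diam (E : R -> Prop) d :
  0 <= d -> (forall x y, E x -> E y -> x <= y -> y - x <= d) -> fcov E (2 * d).
Proof.
  intros Hd H; destruct (classic (exists x, E x)) as [(x & Hx)|N].
  - replace (2 * d) with ((x + d) - (x - d)) by ring.
    apply fcov_interval; [lra|]; intros y Hy.
    destruct (Rle_dec x y) as [Hxy|Hxy].
    + specialize (H x y Hx Hy Hxy); lra.
    + assert (y <= x) as Hyx by lra; specialize (H y x Hy Hx Hyx); lra.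
  - apply fcov_empty; [|lra]; intros x Hx; apply N; exists x; auto.
Qed.

Lemma fcov_pieces (l : list (R * R)) (E : R * R -> R -> Prop) c :
  (forall p, In p l -> fcov (E p) (c * (snd p - fst p))) ->
  fcov (fun x => exists p, In p l /\ E p x) (c * total_length l).
Proof.
  induction l as [|p l IH]; intros H; simpl.
  - apply fcov_empty; [|lra]; intros x (p & [] & _).
  - rewrite Rmult_plus_distr_l.
    apply (fcov_union (E p) (fun x => exists r, In r l /\ E r x)).
    + apply H; left; auto.
    + apply IH; intros r Hr; apply H; right; auto.
    + intros x (r & [<-|Hr] & Hx); [left; auto|right; exists r; auto].
Qed.

(** Greedy sweep from left to right: at a point [s] of [E] the stretch up to [s + h] is covered at
    proportion [eta], and the sweep resumes at [s + h]. The last stretch may pass [b], whence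
    [hmax]. *)
Lemma fcov_sweep (E : R -> Prop) hmin hmax eta :
  0 < hmin -> 0 < eta <= 1 ->
  forall a b, a <= b -> 0 <= hmax ->
  (forall s, E s -> a <= s <= b -> exists h, hmin <= h <= hmax /\
     fcov (fun x => E x /\ s <= x <= s + h) (eta * h)) ->
  fcov (fun x => E x /\ a <= x <= b) (2 * eta * (b - a + hmax)).
Proof.
  intros Hmin Heta a b Hab Hmax.
  (* A leftmost point of [E] need not exist, so any point within [g] of the left end is accepted;
     the skipped piece costs at most [eta * h], which the factor 2 absorbs. Every step advances by
     at least [g], so the number of steps is bounded. *)
  set (g := eta * hmin).
  assert (Hg : 0 < g) by (unfold g; nra).
  destruct (INR_unbounded ((b - a) / g)) as (n & Hn).
  assert (Hn' : b - a <= INR n * g).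
  { apply Rmult_lt_compat_r with (r := g) in Hn; auto.
    unfold Rdiv in Hn; rewrite Rmult_assoc, Rinv_l in Hn; lra. }
  clear Hn; revert a Hab Hn'.
  induction n as [|n IH]; intros a Hab Hn H.
  - simpl in Hn; replace (2 * eta * (b - a + hmax)) with (2 * (eta * (b - a + hmax))) by ring.
    apply fcov_diam; [nra|]; intros x y Hx Hy Hxy; nra.
  - rewrite S_INR in Hn.
    destruct (classic (exists s, E s /\ a <= s <= b /\ s <= a + g)) as [(s & Es & Hs & Hsg)|N].
    + destruct (H s Es Hs) as (h & Hh & Ch).
      assert (Hgh : g <= eta * h) by (unfold g; nra).
      assert (C1 : fcov (fun x => E x /\ a <= x <= s + h) (2 * (eta * h))).
      { replace (2 * (eta * h)) with (eta * h + eta * h) by ring.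
        apply (fcov_union (fun x => a <= x <= s) (fun x => E x /\ s <= x <= s + h)).
        - apply fcov_mono with (E := fun x => a <= x <= s) (L := s - a); [|auto|lra].
          apply fcov_interval; auto; lra.
        - exact Ch.
        - intros x (Ex & Hx); destruct (Rle_dec x s); [left|right]; split; auto; lra. }
      destruct (Rle_dec (s + h) b) as [Hsb|Hsb].
      * assert (C2 : fcov (fun x => E x /\ s + h <= x <= b) (2 * eta * (b - (s + h) + hmax))).
        { apply IH; auto.
          - assert (g <= hmin) by (unfold g; nra); lra.
          - intros s' Es' Hs'; apply H; auto; lra. }
        eapply fcov_mono; [apply (fcov_union _ _ (fun x => E x /\ a <= x <= b) _ _ C1 C2)| |].
        -- intros x (Ex & Hx); destruct (Rle_dec x (s + h)); [left|right]; split; auto; lra.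
        -- auto.
        -- nra.
      * eapply fcov_mono; [apply C1| |].
        -- intros x (Ex & Hx); split; auto; lra.
        -- nra.
    + assert (NE : forall x, E x /\ a <= x <= b -> a + g < x).
      { intros x (Ex & Hx); destruct (Rle_dec x (a + g)); [|lra].
        exfalso; apply N; exists x; auto. }
      destruct (Rle_dec (a + g) b) as [Hb|Hb].
      * eapply fcov_mono; [apply (IH (a + g)); auto; [lra|]| |].
        -- intros s' Es' Hs'; apply H; auto; lra.
        -- intros x Hx; specialize (NE x Hx); split; [apply Hx|lra].
        -- nra.
      * apply fcov_empty; [intros x Hx; specialize (NE x Hx); lra|nra].
Qed.

Fixpoint clipped_length (l : list (R * R)) (a b : R) : R :=
  match l with
  | [] => 0
  | p :: l => Rmax 0 (Rmin (snd p) b - Rmax (fst p) a) + clipped_length l a b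
  end.

Lemma clipped_length_ge0 l a b : 0 <= clipped_length l a b.
Proof.
  induction l as [|p l IH]; simpl; [lra|].
  pose proof (Rmax_l 0 (Rmin (snd p) b - Rmax (fst p) a)); lra.
Qed.

Lemma clipped_length_total l a b : intervals l -> clipped_length l a b <= total_length l.
Proof.
  induction l as [|p l IH]; simpl; intros H; [lra|].
  assert (fst p <= snd p) by (apply H; left; auto).
  assert (clipped_length l a b <= total_length l) by (apply IH; intros r Hr; apply H; right; auto).
  unfold Rmax, Rmin; repeat destruct Rle_dec; lra.
Qed.

Lemma clipped_length_split l a m m' b :
  a <= m -> m <= m' -> m' <= b ->
  clipped_length l a m + clipped_length l m' b <= clipped_length l a b.
Proof.
  intros H1 H2 H3; induction l as [|p l IH]; simpl; [lra|].
  unfold Rmax, Rmin in *; repeat destruct Rle_dec; lra.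
Qed.

(** Clamping the first interval to [[a, b]] gives [[m, m']]; the rest of the list must cover
    [(a, m)] and [(m', b)]. Only interior points are required to be covered, since [m] and [m'] may
    lie in the first interval alone. *)
Lemma clipped_length_cover l a b :
  a <= b -> (forall x, a < x < b -> exists p, In p l /\ fst p <= x <= snd p) ->
  b - a <= clipped_length l a b.
Proof.
  revert a b; induction l as [|[c d] l IH]; intros a b Hab H.
  - simpl; destruct (Req_dec a b) as [->|N]; [lra|].
    destruct (H ((a + b) / 2)) as (p & [] & _); lra.
  - simpl.
    set (m := Rmax a (Rmin b c)); set (m' := Rmin b (Rmax m d)).
    assert (Hm : a <= m <= b) by (unfold m, Rmax, Rmin; repeat destruct Rle_dec; lra).
    assert (Hm' : m <= m' <= b) by (unfold m', Rmax, Rmin; repeat destruct Rle_dec; lra).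
    assert (L1 : m - a <= clipped_length l a m).
    { apply IH; [lra|]; intros x Hx; destruct (H x) as (p & [<-|Hp] & Hxp); [lra| |exists p; auto].
      exfalso; simpl in Hxp; unfold m, Rmax, Rmin in Hx; repeat destruct Rle_dec; lra. }
    assert (L2 : b - m' <= clipped_length l m' b).
    { apply IH; [lra|]; intros x Hx; destruct (H x) as (p & [<-|Hp] & Hxp); [lra| |exists p; auto].
      exfalso; simpl in Hxp; unfold m', Rmax, Rmin in Hx; repeat destruct Rle_dec; lra. }
    pose proof (clipped_length_split l a m m' b ltac:(lra) ltac:(lra) ltac:(lra)).
    assert (m' - m <= Rmax 0 (Rmin d b - Rmax c a)).
    { unfold m', m, Rmax, Rmin in *; repeat destruct Rle_dec; lra. }
    lra.
Qed.

(* Where the exceptional set [Exc] has small trace the middle third of the cell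
   contains a point outside it, so the cell loses [rho]; the other cells are
   few because each of them uses up a third of its length in the cover of [Exc]. *)
Lemma fcov_cells (B Exc : R -> Prop) L a lam rho n :
  0 < lam -> 0 <= rho <= lam -> fcov Exc L ->
  (forall x s, a <= x -> x + lam <= a + INR n * lam ->
     x + lam / 3 < s < x + 2 * lam / 3 -> ~ Exc s ->
     fcov (fun t => B t /\ x <= t <= x + lam) (lam - rho)) ->
  fcov (fun t => B t /\ a <= t <= a + INR n * lam) (INR n * (lam - rho) + 3 * rho / lam * L).
Proof.
  intros Hlam Hrho (l & W & C & T) H.
  (* The induction charges each cell only with the part of the cover of [Exc] inside it; the total
     length enters at the end. *)
  assert (Main : fcov (fun t => B t /\ a <= t <= a + INR n * lam)
            (INR n * (lam - rho) + 3 * rho / lam * clipped_length l a (a + INR n * lam))).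
  { clear T L; induction n as [|n IH].
    - simpl INR; pose proof (clipped_length_ge0 l a (a + 0 * lam)).
      assert (0 <= 3 * rho / lam) by (apply Rle_mult_inv_pos; lra).
      eapply fcov_mono; [apply (fcov_diam (fun t => a <= t <= a) 0); [lra|intros; lra]| |nra].
      intros t (_ & Ht); lra.
    - rewrite S_INR in *.
      pose proof (IH (fun x s h1 h2 h3 h4 => H x s h1 ltac:(lra) h3 h4)) as IH'; clear IH.
      set (x := a + INR n * lam) in *.
      pose proof (pos_INR n) as Hn.
      assert (Hx : a <= x) by (unfold x; nra).
      assert (Cell : fcov (fun t => B t /\ x <= t <= x + lam)
         (lam - rho + 3 * rho / lam * clipped_length l x (x + lam))).
      { pose proof (clipped_length_ge0 l x (x + lam)) as Hc.
        assert (Hr : 0 <= 3 * rho / lam) by (apply Rle_mult_inv_pos; lra).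
        destruct (classic (exists s, x + lam / 3 < s < x + 2 * lam / 3 /\ ~ Exc s)) as [(s & Hs & Ns)|N].
        - eapply fcov_mono; [apply (H x s); auto; unfold x; lra|auto|nra].
        - assert (Hl : lam / 3 <= clipped_length l x (x + lam)).
          { assert (x + 2 * lam / 3 - (x + lam / 3) <= clipped_length l (x + lam / 3) (x + 2 * lam / 3)).
            { apply clipped_length_cover; [lra|]; intros t Ht; apply C.
              apply NNPP; intros Nt; apply N; exists t; auto. }
            pose proof (clipped_length_split l x x (x + lam / 3) (x + lam) ltac:(lra) ltac:(lra) ltac:(lra)).
            pose proof (clipped_length_split l (x + lam / 3) (x + 2 * lam / 3) (x + lam) (x + lam) ltac:(lra) ltac:(lra) ltac:(lra)).
            pose proof (clipped_length_ge0 l x x); pose proof (clipped_length_ge0 l (x + lam) (x + lam)); lra. }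
          apply fcov_mono with (E := fun t => x <= t <= x + lam) (L := x + lam - x).
          + apply fcov_interval; auto; lra.
          + intros t (_ & Ht); auto.
          + assert (3 * rho / lam * (lam / 3) = rho) by (field; lra).
            assert (3 * rho / lam * (lam / 3) <= 3 * rho / lam * clipped_length l x (x + lam))
              by (apply Rmult_le_compat_l; auto).
            lra. }
      assert (Hr : 0 <= 3 * rho / lam) by (apply Rle_mult_inv_pos; lra).
      replace (a + (INR n + 1) * lam) with (x + lam) by (unfold x; ring).
      pose proof (clipped_length_split l a x x (x + lam) ltac:(lra) ltac:(lra) ltac:(lra)).
      eapply fcov_mono; [apply (fcov_union _ _ (fun t => B t /\ a <= t <= x + lam) _ _ IH' Cell)|auto|nra].
      intros t (Bt & Ht); destruct (Rle_dec t x); [left|right]; split; auto; lra. }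
  eapply fcov_mono; [apply Main|auto|].
  pose proof (clipped_length_total l a (a + INR n * lam) W).
  assert (Hr : 0 <= 3 * rho / lam) by (apply Rle_mult_inv_pos; lra).
  nra.
Qed.

(** Takes the place of a density theorem. Replacing every interval of a cover by a cover of its
    trace shrinks the total length by the factor [c], and this repeats because [c] is the same for
    all subintervals, however short. *)
Lemma fcov_contract (B : R -> Prop) l r c :
  l <= r -> 0 <= c < 1 ->
  (forall a b, l <= a -> a < b -> b <= r -> fcov (fun t => B t /\ a <= t <= b) (c * (b - a))) ->
  forall eps, 0 < eps -> fcov (fun t => B t /\ l <= t <= r) eps.
Proof.
  intros Hlr Hc H eps Heps.
  assert (P : forall n, fcov (fun t => B t /\ l <= t <= r) (c ^ n * (r - l))).
  { induction n as [|n (L & W & C & T)].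
    - simpl; replace (1 * (r - l)) with (r - l) by ring; apply fcov_interval; auto; intros x Hx; apply Hx.
    - eapply fcov_mono.
      + apply (fcov_pieces L (fun p t => B t /\ Rmax l (fst p) <= t <= Rmin r (snd p)) c).
        intros p Hp; specialize (W p Hp).
        (* Intervals of the cover may leave [[l, r]], where the hypothesis says nothing; a clipped
           interval may be empty or a point. *)
        set (a := Rmax l (fst p)); set (b := Rmin r (snd p)).
        assert (l <= a /\ fst p <= a /\ b <= r /\ b <= snd p).
        { unfold a, b; repeat split; auto using Rmax_l, Rmax_r, Rmin_l, Rmin_r. }
        destruct (Rlt_le_dec a b) as [Hab|Hab].
        * eapply fcov_mono; [apply (H a b); lra|auto|].
          apply Rmult_le_compat_l; lra.
        * eapply fcov_mono; [apply (fcov_diam (fun t => a <= t <= b) 0)|intros x (_ & Hx); exact Hx|].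
          -- lra.
          -- intros x y Hx Hy Hxy; lra.
          -- assert (0 <= c * (snd p - fst p)) by (apply Rmult_le_pos; lra); lra.
      + intros t (Bt & Ht); destruct (C t) as (p & Hp & Htp); [auto|].
        exists p; repeat split; auto; [apply Rmax_lub; lra|apply Rmin_glb; lra].
      + simpl; rewrite Rmult_assoc; apply Rmult_le_compat_l; [lra|exact T]. }
  destruct (pow_lt_1_zero c ltac:(rewrite Rabs_pos_eq; lra) (eps / (r - l + 1))) as (n & Hn).
  { apply Rdiv_lt_0_compat; lra. }
  specialize (Hn n ltac:(lia)).
  eapply fcov_mono; [apply (P n)|auto|].
  rewrite Rabs_pos_eq in Hn; [|apply pow_le; lra].
  apply Rmult_lt_compat_r with (r := r - l + 1) in Hn; [|lra].
  unfold Rdiv in Hn; rewrite Rmult_assoc, Rinv_l, Rmult_1_r in Hn; [|lra].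
  assert (0 <= c ^ n) by (apply pow_le; lra); nra.
Qed.

(** * Integer vectors *)

(* A [zvec] encodes either the rational point (p1/q, p2/q), as (q, p1, p2), or the
   line c0 + c1 x + c2 y = 0, as (c0, c1, c2); incidence is [zdot c w = 0]. *)
Record zvec := ZVec { co0 : Z; co1 : Z; co2 : Z }.

Definition zzero : zvec := ZVec 0 0 0.

Definition zdot (u v : zvec) : Z :=
  (co0 u * co0 v + co1 u * co1 v + co2 u * co2 v)%Z.

Definition zcross (u v : zvec) : zvec :=
  ZVec (co1 u * co2 v - co2 u * co1 v)
       (co2 u * co0 v - co0 u * co2 v)
       (co0 u * co1 v - co1 u * co0 v).

Definition zscale (k : Z) (u : zvec) : zvec :=
  ZVec (k * co0 u) (k * co1 u) (k * co2 u).

Definition zadd (u v : zvec) : zvec :=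
  ZVec (co0 u + co0 v) (co1 u + co1 v) (co2 u + co2 v).

(** Coprime coordinates, stated by a Bezout witness so that ring identities can use it directly. *)
Definition zprimitive (u : zvec) : Prop := exists v, zdot u v = 1%Z.

Lemma zvec_eq u v : co0 u = co0 v -> co1 u = co1 v -> co2 u = co2 v -> u = v.
Proof. destruct u, v; simpl; intros -> -> ->; reflexivity. Qed.

Lemma primitive_neq0 u : zprimitive u -> u <> zzero.
Proof. intros (v & H) ->; unfold zdot in H; simpl in H; lia. Qed.

(** The triple product identity [(u.v) z - (v.z) u = v x (z x u)] gives the multiple [v.z]. *)
Lemma primitive_parallel u z : zprimitive u -> zcross u z = zzero -> exists k, z = zscale k u.
Proof.
  intros (v & H) E; exists (zdot v z).
  unfold zcross, zzero in E; injection E as E0 E1 E2; unfold zdot in *.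
  destruct u as [u0 u1 u2], v as [v0 v1 v2], z as [z0 z1 z2]; simpl in *.
  apply zvec_eq; simpl.
  - assert (X : (z0 - (v0 * z0 + v1 * z1 + v2 * z2) * u0 =
      z0 * (1 - (u0 * v0 + u1 * v1 + u2 * v2)) - v1 * (u0 * z1 - u1 * z0) + v2 * (u2 * z0 - u0 * z2))%Z) by ring.
    rewrite H, E1, E2 in X; lia.
  - assert (X : (z1 - (v0 * z0 + v1 * z1 + v2 * z2) * u1 =
      z1 * (1 - (u0 * v0 + u1 * v1 + u2 * v2)) + v0 * (u0 * z1 - u1 * z0) - v2 * (u1 * z2 - u2 * z1))%Z) by ring.
    rewrite H, E0, E2 in X; lia.
  - assert (X : (z2 - (v0 * z0 + v1 * z1 + v2 * z2) * u2 =
      z2 * (1 - (u0 * v0 + u1 * v1 + u2 * v2)) - v0 * (u2 * z0 - u0 * z2) + v1 * (u1 * z2 - u2 * z1))%Z) by ring.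
    rewrite H, E0, E1 in X; lia.
Qed.

Lemma exists_primitive u : u <> zzero ->
  exists k u', (1 <= k)%Z /\ zprimitive u' /\ u = zscale k u'.
Proof.
  intros N; destruct u as [a b c].
  set (g := Z.gcd a b); set (h := Z.gcd g c).
  assert (Hh : (0 < h)%Z).
  { assert (0 <= h)%Z by apply Z.gcd_nonneg.
    assert (h <> 0)%Z; [|lia].
    intros E; apply Z.gcd_eq_0 in E as (E1 & E2); apply Z.gcd_eq_0 in E1 as (E1 & E3).
    apply N; subst; reflexivity. }
  assert (Dg : (h | g)%Z) by apply Z.gcd_divide_l.
  destruct (Z.divide_trans _ _ _ Dg (Z.gcd_divide_l a b)) as (a' & Ea).
  destruct (Z.divide_trans _ _ _ Dg (Z.gcd_divide_r a b)) as (b' & Eb).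
  destruct (Z.gcd_divide_r g c : (h | c)%Z) as (c' & Ec).
  exists h, (ZVec a' b' c'); split; [lia|split].
  - destruct (Z.gcd_bezout a b g eq_refl) as (x & y & E1).
    destruct (Z.gcd_bezout g c h eq_refl) as (z & t & E2).
    exists (ZVec (z * x) (z * y) t); unfold zdot; simpl.
    rewrite <- E1, Ea, Eb, Ec in E2.
    apply Z.mul_reg_l with h; [lia|]; nia.
  - unfold zscale; simpl; f_equal; lia.
Qed.

(** * Points and lines near a convex arc *)

(** Here [f1] plays the part of the derivative of [f], and [k], [K] bound its growth. Everything is
    stated by differences, so the inverse of a coordinate may enter a chart without being
    differentiated. The bounds [1 <= K] and [1 <= m] are normalisations. *)
Record convex_arc (f f1 : R -> R) (l r k K m : R) : Prop := ConvexArc {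
  arc_consts : 0 < k <= K /\ 1 <= K /\ 1 <= m;
  arc_tangent : forall s t, l <= s -> s <= t -> t <= r ->
    f1 s * (t - s) <= f t - f s <= f1 t * (t - s);
  arc_curv : forall s t, l <= s -> s <= t -> t <= r ->
    k * (t - s) <= f1 t - f1 s <= K * (t - s);
  arc_slope : forall t, l <= t <= r -> Rabs (f1 t) <= m }.

(* [devx], [devy] are the deviations q t - p1, q f(t) - p2 of a point, and [devn] is
   its deviation transversally to the tangent; [lform], [dform] are the value of a
   line's equation on the curve and its derivative in t. Cross products exchange
   the triples (q, devx, devn) and (dform, co2, lform). *)
Definition devx (w : zvec) (t : R) : R := IZR (co0 w) * t - IZR (co1 w).

Definition devy (f : R -> R) (w : zvec) (t : R) : R := IZR (co0 w) * f t - IZR (co2 w).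

Definition devn (f f1 : R -> R) (w : zvec) (t : R) : R := devy f w t - f1 t * devx w t.

Definition lform (f : R -> R) (c : zvec) (t : R) : R :=
  IZR (co0 c) + IZR (co1 c) * t + IZR (co2 c) * f t.

Definition dform (f1 : R -> R) (c : zvec) (t : R) : R := IZR (co1 c) + IZR (co2 c) * f1 t.

(** The map from [w] to its triple is unimodular, so this is an integer point in a box of volume
    [8 * a * b * c], sheared along the tangent; the same holds for [near_line]. *)
Definition near_point (f f1 : R -> R) (a b c t : R) : Prop :=
  exists w, w <> zzero /\ Rabs (IZR (co0 w)) <= a /\
    Rabs (devx w t) <= b /\ Rabs (devn f f1 w t) <= c.

Definition near_line (f f1 : R -> R) (A B G t : R) : Prop :=
  exists c, c <> zzero /\ Rabs (dform f1 c t) <= A /\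
    Rabs (IZR (co2 c)) <= B /\ Rabs (lform f c t) <= G.

Lemma lform_cross f w w' t :
  lform f (zcross w w') t = devx w t * devy f w' t - devx w' t * devy f w t.
Proof. unfold lform, devx, devy; simpl; rewrite !minus_IZR, !mult_IZR; ring. Qed.

Lemma dform_cross f f1 w w' t :
  dform f1 (zcross w w') t = IZR (co0 w) * devn f f1 w' t - IZR (co0 w') * devn f f1 w t.
Proof. unfold dform, devn, devx, devy; simpl; rewrite !minus_IZR, !mult_IZR; ring. Qed.

Lemma co2_cross w w' t :
  IZR (co2 (zcross w w')) = IZR (co0 w') * devx w t - IZR (co0 w) * devx w' t.
Proof. unfold devx; simpl; rewrite !minus_IZR, !mult_IZR; ring. Qed.

Lemma devx_cross f c c' t :
  devx (zcross c c') t = IZR (co2 c') * lform f c t - IZR (co2 c) * lform f c' t.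
Proof. unfold lform, devx; simpl; rewrite !minus_IZR, !mult_IZR; ring. Qed.

Lemma devn_cross f f1 c c' t :
  devn f f1 (zcross c c') t = dform f1 c t * lform f c' t - dform f1 c' t * lform f c t.
Proof. unfold lform, dform, devn, devy, devx; simpl; rewrite !minus_IZR, !mult_IZR; ring. Qed.

Lemma co0_cross f1 c c' t :
  IZR (co0 (zcross c c')) = dform f1 c t * IZR (co2 c') - dform f1 c' t * IZR (co2 c).
Proof. unfold dform; simpl; rewrite !minus_IZR, !mult_IZR; ring. Qed.

Lemma Rabs_bound x a : Rabs x <= a -> - a <= x <= a.
Proof. intros H; split; [pose proof (Rle_abs (- x)); rewrite Rabs_Ropp in *|pose proof (Rle_abs x)]; lra. Qed.

Lemma Rabs_mult_le x y a b : Rabs x <= a -> Rabs y <= b -> Rabs (x * y) <= a * b.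
Proof. intros; rewrite Rabs_mult; apply Rmult_le_compat; auto using Rabs_pos. Qed.

Lemma Rabs_cross_le x y x' y' a b a' b' :
  Rabs x <= a -> Rabs y <= b -> Rabs x' <= a' -> Rabs y' <= b' ->
  Rabs (x * y - x' * y') <= a * b + a' * b'.
Proof.
  intros; pose proof (Rabs_mult_le x y a b ltac:(auto) ltac:(auto)).
  pose proof (Rabs_mult_le x' y' a' b' ltac:(auto) ltac:(auto)).
  unfold Rminus; eapply Rle_trans; [apply Rabs_triang|rewrite Rabs_Ropp; lra].
Qed.

Lemma IZR_ge1 z : z <> 0%Z -> 1 <= Rabs (IZR z).
Proof. intros; rewrite <- abs_IZR; apply IZR_le; lia. Qed.

Lemma IZR_lt1 z a : Rabs (IZR z) <= a -> a < 1 -> z = 0%Z.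
Proof. intros H Ha; destruct (Z.eq_dec z 0); auto; apply IZR_ge1 in n; lra. Qed.

Lemma near_point_primitive f f1 a b c t : near_point f f1 a b c t ->
  exists w, zprimitive w /\ Rabs (IZR (co0 w)) <= a /\ Rabs (devx w t) <= b /\ Rabs (devn f f1 w t) <= c.
Proof.
  intros (w & N & Ha & Hb & Hc); destruct (exists_primitive w N) as (k & u & Hk & P & ->).
  exists u; split; auto.
  assert (Hk' : 1 <= Rabs (IZR k)) by (apply IZR_ge1; lia).
  assert (S : forall x, Rabs x <= Rabs (IZR k * x)).
  { intros x; rewrite Rabs_mult; pose proof (Rabs_pos x); nra. }
  repeat split; eapply Rle_trans; try apply S.
  - eapply Rle_trans; [|apply Ha]; apply Req_le; simpl; rewrite mult_IZR; reflexivity.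
  - eapply Rle_trans; [|apply Hb]; apply Req_le; unfold devx; simpl; rewrite !mult_IZR; f_equal; ring.
  - eapply Rle_trans; [|apply Hc]; apply Req_le; unfold devn, devx, devy; simpl; rewrite !mult_IZR; f_equal; ring.
Qed.

Lemma near_line_primitive f f1 A B G t : near_line f f1 A B G t ->
  exists c, zprimitive c /\ Rabs (dform f1 c t) <= A /\ Rabs (IZR (co2 c)) <= B /\ Rabs (lform f c t) <= G.
Proof.
  intros (w & N & Ha & Hb & Hc); destruct (exists_primitive w N) as (k & u & Hk & P & ->).
  exists u; split; auto.
  assert (Hk' : 1 <= Rabs (IZR k)) by (apply IZR_ge1; lia).
  assert (S : forall x, Rabs x <= Rabs (IZR k * x)).
  { intros x; rewrite Rabs_mult; pose proof (Rabs_pos x); nra. }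
  repeat split; eapply Rle_trans; try apply S.
  - eapply Rle_trans; [|apply Ha]; apply Req_le; unfold dform; simpl; rewrite !mult_IZR; f_equal; ring.
  - eapply Rle_trans; [|apply Hb]; apply Req_le; simpl; rewrite !mult_IZR; f_equal; ring.
  - eapply Rle_trans; [|apply Hc]; apply Req_le; unfold lform; simpl; rewrite !mult_IZR; f_equal; ring.
Qed.

(** The triple is triangular: [q] vanishes first, after which [p1] and then [p2] are integers of
    absolute value below 1. *)
Lemma near_point_empty f f1 a b c t : a < 1 -> b < 1 -> c < 1 -> ~ near_point f f1 a b c t.
Proof.
  intros Ha Hb Hc (w & N & H0 & H1 & H2); apply N.
  apply IZR_lt1 in H0; auto; unfold devx in *; unfold devn, devy, devx in H2; rewrite H0 in *.
  replace (0 * t - IZR (co1 w)) with (- IZR (co1 w)) in * by ring; rewrite Rabs_Ropp in H1.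
  apply IZR_lt1 in H1; auto; rewrite H1 in H2.
  replace (0 * f t - IZR (co2 w) - f1 t * - 0) with (- IZR (co2 w)) in H2 by ring.
  rewrite Rabs_Ropp in H2; apply IZR_lt1 in H2; auto.
  apply zvec_eq; simpl; auto.
Qed.

Lemma devx_shift w s t : devx w t = devx w s + IZR (co0 w) * (t - s).
Proof. unfold devx; ring. Qed.

Lemma devx_scale k w t : devx (zscale k w) t = IZR k * devx w t.
Proof. unfold devx; simpl; rewrite !mult_IZR; ring. Qed.

Lemma lform_scale f k w t : lform f (zscale k w) t = IZR k * lform f w t.
Proof. unfold lform; simpl; rewrite !mult_IZR; ring. Qed.

Lemma zscale_neq0 k u : zscale k u <> zzero -> k <> 0%Z.
Proof. intros N ->; apply N; unfold zscale, zzero; simpl; reflexivity. Qed.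

Lemma Rabs_scale_ge k x : k <> 0%Z -> Rabs x <= Rabs (IZR k * x).
Proof.
  intros H; apply IZR_ge1 in H; rewrite Rabs_mult; pose proof (Rabs_pos x); nra.
Qed.

(** To first order the terms in [q] cancel along the tangent: [devn] has derivative [- f1' * devx],
    and [R'] bounds [devx] between [s] and [t]. *)
Lemma devn_shift f f1 l r k K m w s t b R' : convex_arc f f1 l r k K m ->
  l <= s -> s <= t -> t <= r -> Rabs (devx w s) <= b -> b + Rabs (IZR (co0 w)) * (t - s) <= R' ->
  Rabs (devn f f1 w t - devn f f1 w s) <= K * (t - s) * R'.
Proof.
  intros H Hs Hst Ht Hb HR.
  destruct (arc_tangent _ _ _ _ _ _ _ H s t Hs Hst Ht) as (T1 & T2).
  destruct (arc_curv _ _ _ _ _ _ _ H s t Hs Hst Ht) as (C1 & C2).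
  destruct (arc_consts _ _ _ _ _ _ _ H) as (Hk & HK & _).
  replace (devn f f1 w t - devn f f1 w s) with
    (IZR (co0 w) * (f t - f s - f1 t * (t - s)) - (f1 t - f1 s) * devx w s)
    by (unfold devn, devy, devx; ring).
  assert (D1 : Rabs (f t - f s - f1 t * (t - s)) <= K * (t - s) * (t - s)).
  { apply Rabs_le; split; nra. }
  assert (D2 : Rabs (f1 t - f1 s) <= K * (t - s)).
  { apply Rabs_le; split; nra. }
  eapply Rle_trans; [apply (Rabs_cross_le _ _ _ _ _ _ _ _ (Rle_refl _) D1 D2 Hb)|].
  pose proof (Rabs_pos (IZR (co0 w))).
  replace (Rabs (IZR (co0 w)) * (K * (t - s) * (t - s)) + K * (t - s) * b) with
    (K * (t - s) * (b + Rabs (IZR (co0 w)) * (t - s))) by ring.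
  apply Rmult_le_compat_l; auto; nra.
Qed.

(** Let [w] serve at [s]. On the following stretch its [devx] stays below [2 * N * b] and its [devn]
    below [2 * c], so a point serving at [t] that is not a multiple of [w] yields, as cross product
    with [w], a line in the excluded box. Of a stretch [N * b / q] only the first [2 * b / q]
    survives; the sweep and its overshoot turn [2 / N] into [8 / N]. *)
Lemma near_point_step f f1 l r k K m a b c N j0 j1 :
  convex_arc f f1 l r k K m -> l <= j0 -> j0 <= j1 ->
  2 <= N -> 1 <= a -> 0 < b < 1 -> 0 < c < 1 -> 4 * K * N ^ 2 * b ^ 2 <= c ->
  N * b <= j1 - j0 -> j1 + N * b <= r ->
  fcov (fun t => (near_point f f1 a b c t /\ ~ near_line f f1 (3 * a * c) (4 * N * a * b) (6 * N * b * c) t)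
                 /\ j0 <= t <= j1) (8 / N * (j1 - j0)).
Proof.
  intros H Hj0 Hj HN Ha Hb Hc HS HJ Hr.
  destruct (arc_consts _ _ _ _ _ _ _ H) as (Hk & HK & _).
  assert (HNb : 0 < N * b) by nra.
  set (E := fun t => near_point f f1 a b c t /\
    ~ near_line f f1 (3 * a * c) (4 * N * a * b) (6 * N * b * c) t).
  eapply (fcov_mono (fun t => E t /\ j0 <= t <= j1));
    [apply (fcov_sweep E (N * b / a) (N * b) (2 / N)); [| |exact Hj|lra|]|auto|].
  - apply Rdiv_lt_0_compat; lra.
  - split; [apply Rdiv_lt_0_compat; lra|].
    apply Rmult_le_reg_r with N; [lra|]; unfold Rdiv; rewrite Rmult_assoc, Rinv_l; lra.
  - intros s (Vs & Fs) Hs.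
    destruct (near_point_primitive _ _ _ _ _ _ Vs) as (w & P & Hq & Hx & Hn).
    assert (Hq1 : 1 <= Rabs (IZR (co0 w))).
    { destruct (Rlt_le_dec (Rabs (IZR (co0 w))) 1) as [L|L]; auto; exfalso.
      apply (near_point_empty f f1 (Rabs (IZR (co0 w))) b c s); try lra.
      exists w; repeat split; auto using primitive_neq0; lra. }
    set (q := Rabs (IZR (co0 w))) in *.
    (* Since [1 <= q <= a], this lies between [N * b / a] and [N * b], as the sweep demands. *)
    exists (N * b / q); repeat split.
    + apply Rmult_le_compat_l; [lra|]; apply Rinv_le_contravar; lra.
    + apply Rmult_le_reg_r with q; [lra|]; unfold Rdiv; rewrite Rmult_assoc, Rinv_l; nra.
    + apply fcov_mono with (E := fun t => s <= t <= s + 2 * b / q) (L := s + 2 * b / q - s).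
      * apply fcov_interval; auto.
        assert (0 < 2 * b / q) by (apply Rdiv_lt_0_compat; lra); lra.
      * intros t ((Vt & Ft) & Ht); split; [lra|].
        assert (Hqh : q * (t - s) <= N * b).
        { apply Rle_trans with (q * (N * b / q)); [apply Rmult_le_compat_l; lra|apply Req_le; field; lra]. }
        assert (Hts : t - s <= N * b) by nra.
        assert (Dn : Rabs (devn f f1 w t - devn f f1 w s) <= c).
        { eapply Rle_trans; [apply (devn_shift f f1 l r k K m w s t b (b + N * b) H); try lra; fold q; lra|].
          assert (K * (t - s) * (b + N * b) <= K * (N * b) * (2 * N * b)).
          { apply Rmult_le_compat; try nra. }
          nra. }
        assert (Hxt : Rabs (devx w t) <= 2 * N * b).
        { rewrite (devx_shift w s t); eapply Rle_trans; [apply Rabs_triang|].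
          rewrite Rabs_mult; fold q; rewrite (Rabs_pos_eq (t - s)); nra. }
        assert (Hnt : Rabs (devn f f1 w t) <= 2 * c).
        { replace (devn f f1 w t) with (devn f f1 w s + (devn f f1 w t - devn f f1 w s)) by ring.
          eapply Rle_trans; [apply Rabs_triang|lra]. }
        destruct Vt as (w' & N' & Hq' & Hx' & Hn').
        (* If a multiple of [w] serves at [t], so does the bound [b] on [devx w t]; as [devx w]
           moves at speed [q], the time elapsed is at most [2 * b / q]. *)
        destruct (classic (zcross w w' = zzero)) as [Z|Z].
        -- destruct (primitive_parallel w w' P Z) as (z & ->).
           assert (Hz : z <> 0%Z) by (apply (zscale_neq0 z w), N').
           rewrite devx_scale in Hx'.
           pose proof (Rabs_scale_ge z (devx w t) Hz) as Hxt'.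
           rewrite (devx_shift w s t) in Hxt', Hx'.
           assert (Hb2 : Rabs (IZR (co0 w) * (t - s)) <= 2 * b).
           { replace (IZR (co0 w) * (t - s)) with
               ((devx w s + IZR (co0 w) * (t - s)) + - devx w s) by ring.
             eapply Rle_trans; [apply Rabs_triang|]; rewrite Rabs_Ropp; lra. }
           rewrite Rabs_mult, (Rabs_pos_eq (t - s)) in Hb2 by lra; fold q in Hb2.
           assert (t - s <= 2 * b / q); [|lra].
           apply Rmult_le_reg_l with q; [lra|]; replace (q * (2 * b / q)) with (2 * b) by (field; lra); lra.
        -- exfalso; apply Ft; exists (zcross w w'); repeat split; auto.
           ++ rewrite (dform_cross f); eapply Rle_trans;
                [apply (Rabs_cross_le _ _ _ _ a c a (2 * c)); auto|]; nra.
           ++ rewrite (co2_cross w w' t); eapply Rle_trans;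
                [apply (Rabs_cross_le _ _ _ _ a (2 * N * b) a b); auto|].
              assert (0 < a * b) by nra; nra.
           ++ rewrite lform_cross.
              replace (devx w t * devy f w' t - devx w' t * devy f w t) with
                (devx w t * devn f f1 w' t - devx w' t * devn f f1 w t) by (unfold devn; ring).
              eapply Rle_trans; [apply (Rabs_cross_le _ _ _ _ (2 * N * b) c b (2 * c)); auto|].
              assert (0 < b * c) by nra; nra.
      * apply Req_le; field; lra.
  - apply Rle_trans with (2 * (2 / N) * (2 * (j1 - j0))); [|apply Req_le; field; lra].
    apply Rmult_le_compat_l; [|lra].
    assert (0 < 2 / N) by (apply Rdiv_lt_0_compat; lra); lra.
Qed.

(** Along the arc [lform] is convex or concave with derivative [dform]; the sign of [co2 c] selects
    the alternative. *)
Lemma lform_between f f1 l r k K m c s t : convex_arc f f1 l r k K m ->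
  l <= s -> s <= t -> t <= r ->
  dform f1 c s * (t - s) <= lform f c t - lform f c s <= dform f1 c t * (t - s) \/
  dform f1 c t * (t - s) <= lform f c t - lform f c s <= dform f1 c s * (t - s).
Proof.
  intros H Hs Hst Ht; destruct (arc_tangent _ _ _ _ _ _ _ H s t Hs Hst Ht) as (T1 & T2).
  unfold lform, dform; destruct (Rle_dec 0 (IZR (co2 c))); [left|right]; nra.
Qed.

Lemma dform_shift f f1 l r k K m c s t : convex_arc f f1 l r k K m ->
  l <= s -> s <= t -> t <= r ->
  k * Rabs (IZR (co2 c)) * (t - s) <= Rabs (dform f1 c t - dform f1 c s)
    <= K * Rabs (IZR (co2 c)) * (t - s).
Proof.
  intros H Hs Hst Ht; destruct (arc_curv _ _ _ _ _ _ _ H s t Hs Hst Ht) as (C1 & C2).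
  destruct (arc_consts _ _ _ _ _ _ _ H) as (Hk & HK & _).
  replace (dform f1 c t - dform f1 c s) with (IZR (co2 c) * (f1 t - f1 s)) by (unfold dform; ring).
  rewrite Rabs_mult, (Rabs_pos_eq (f1 t - f1 s)) by nra.
  pose proof (Rabs_pos (IZR (co2 c))); split; nra.
Qed.

Lemma lform_shift f f1 l r k K m c s t : convex_arc f f1 l r k K m ->
  l <= s -> s <= t -> t <= r ->
  Rabs (lform f c t - lform f c s - dform f1 c s * (t - s)) <= K * Rabs (IZR (co2 c)) * (t - s) ^ 2.
Proof.
  intros H Hs Hst Ht.
  pose proof (lform_between _ _ _ _ _ _ _ c s t H Hs Hst Ht) as B.
  destruct (dform_shift _ _ _ _ _ _ _ c s t H Hs Hst Ht) as (_ & D); apply Rabs_bound in D.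
  apply Rabs_le; simpl; nra.
Qed.

(** A sublevel estimate for a function with curvature. Where the slope is at most [mu] in absolute
    value, its growth rate [k * |co2 c|] bounds the diameter. Where it is at least [mu], or at most
    [- mu], at two points, [lform] changes by at least [mu] times their distance, yet by at most
    [2 * g]. *)
Lemma lform_small_cover f f1 l r k K m c s h g mu : convex_arc f f1 l r k K m ->
  l <= s -> 0 <= h -> s + h <= r -> 0 <= g -> 0 < mu -> IZR (co2 c) <> 0 ->
  fcov (fun t => s <= t <= s + h /\ Rabs (lform f c t) <= g)
    (4 * mu / (k * Rabs (IZR (co2 c))) + 8 * g / mu).
Proof.
  intros H Hs Hh Hr Hg Hmu Hc.
  destruct (arc_consts _ _ _ _ _ _ _ H) as (Hk & HK & _).
  assert (Hc' : 0 < Rabs (IZR (co2 c))) by (apply Rabs_pos_lt; auto).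
  replace (4 * mu / (k * Rabs (IZR (co2 c))) + 8 * g / mu) with
    (2 * (2 * mu / (k * Rabs (IZR (co2 c)))) + (2 * (2 * g / mu) + 2 * (2 * g / mu))) by (field; lra).
  set (S := fun t => s <= t <= s + h /\ Rabs (lform f c t) <= g).
  apply (fcov_union (fun t => S t /\ Rabs (dform f1 c t) <= mu)
                    (fun t => S t /\ mu <= Rabs (dform f1 c t))).
  - apply fcov_diam.
    + apply Rlt_le, Rdiv_lt_0_compat; nra.
    + intros x y ((Hx & _) & Dx) ((Hy & _) & Dy) Hxy.
      destruct (dform_shift _ _ _ _ _ _ _ c x y H ltac:(lra) Hxy ltac:(lra)) as (D & _).
      assert (Rabs (dform f1 c y - dform f1 c x) <= 2 * mu).
      { unfold Rminus; eapply Rle_trans; [apply Rabs_triang|rewrite Rabs_Ropp; lra]. }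
      apply Rmult_le_reg_l with (k * Rabs (IZR (co2 c))); [nra|].
      replace (k * Rabs (IZR (co2 c)) * (2 * mu / (k * Rabs (IZR (co2 c))))) with (2 * mu) by (field; lra).
      lra.
  - assert (X : forall z, 0 <= z -> mu * z <= 2 * g -> z <= 2 * g / mu).
    { intros z Hz Hm; apply Rmult_le_reg_l with mu; auto.
      replace (mu * (2 * g / mu)) with (2 * g) by (field; lra); auto. }
    apply (fcov_union (fun t => S t /\ mu <= dform f1 c t) (fun t => S t /\ dform f1 c t <= - mu)).
    + apply fcov_diam; [apply Rle_mult_inv_pos; lra|].
      intros x y ((Hx & Gx) & Dx) ((Hy & Gy) & Dy) Hxy; apply X; [lra|].
      apply Rabs_bound in Gx, Gy.
      destruct (lform_between _ _ _ _ _ _ _ c x y H ltac:(lra) Hxy ltac:(lra)); nra.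
    + apply fcov_diam; [apply Rle_mult_inv_pos; lra|].
      intros x y ((Hx & Gx) & Dx) ((Hy & Gy) & Dy) Hxy; apply X; [lra|].
      apply Rabs_bound in Gx, Gy.
      destruct (lform_between _ _ _ _ _ _ _ c x y H ltac:(lra) Hxy ltac:(lra)); nra.
    + intros x (Sx & Hx); destruct (Rcase_abs (dform f1 c x)) as [D|D].
      * rewrite Rabs_left in Hx; auto; right; split; auto; lra.
      * rewrite Rabs_right in Hx; auto.
  - intros x Sx; destruct (Rle_dec (Rabs (dform f1 c x)) mu); [left|right]; split; auto; lra.
Qed.

(** Dual to [near_point_step], except that [lform] is quadratic in [t]: near a tangency a line keeps
    the tolerance [g ^ 2] for a time proportional to [g]. On each stretch [dform] stays below
    [2 * A], by the hypothesis [N ^ 2 * K * B * g ^ 2 <= A ^ 2], and [lform] below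
    [8 * N ^ 2 * g ^ 2]; these give the constants 3 and 16. *)
Lemma near_line_step f f1 l r k K m A B g N j0 j1 :
  convex_arc f f1 l r k K m -> l <= j0 -> j0 <= j1 ->
  2 <= N -> 0 < A -> 0 < B -> 0 < g < 1 -> N ^ 2 * K * B * g ^ 2 <= A ^ 2 ->
  N * g <= j1 - j0 -> j1 + N * g <= r -> 12 * (K / k) <= N ->
  fcov (fun t => (near_line f f1 A B (g ^ 2) t /\
                  ~ near_point f f1 (3 * A * B) (16 * N ^ 2 * B * g ^ 2) (16 * N ^ 2 * A * g ^ 2) t)
                 /\ j0 <= t <= j1) (48 * (K / k) / N * (j1 - j0)).
Proof.
  intros H Hj0 Hj HN HA HB Hg HS HJ Hr HNk.
  destruct (arc_consts _ _ _ _ _ _ _ H) as (Hk & HK & _).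
  set (E := fun t => near_line f f1 A B (g ^ 2) t /\
    ~ near_point f f1 (3 * A * B) (16 * N ^ 2 * B * g ^ 2) (16 * N ^ 2 * A * g ^ 2) t).
  set (kap := K / k) in *.
  assert (Hkap : 1 <= kap).
  { unfold kap; apply Rmult_le_reg_r with k; [lra|]; unfold Rdiv; rewrite Rmult_assoc, Rinv_l; lra. }
  set (s0 := sqrt (K * (B + 1))).
  assert (Hs0 : 0 < s0) by (apply sqrt_lt_R0; nra).
  set (hmin := Rmin (N * g ^ 2 / A) (N * g / s0)).
  assert (Hhmin : 0 < hmin).
  { unfold hmin; apply Rmin_glb_lt; apply Rdiv_lt_0_compat; try lra; nra. }
  eapply (fcov_mono (fun t => E t /\ j0 <= t <= j1));
    [apply (fcov_sweep E hmin (N * g) (12 * kap / N)); [exact Hhmin| |exact Hj|nra|]|auto|].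
  - split; [apply Rdiv_lt_0_compat; lra|].
    apply Rmult_le_reg_r with N; [lra|]; unfold Rdiv; rewrite Rmult_assoc, Rinv_l; lra.
  - intros t0 (Vs & Fs) Ht0.
    destruct (near_line_primitive _ _ _ _ _ _ Vs) as (c & P & Ha & Hb & Hl).
    set (al := Rabs (dform f1 c t0)) in *; set (be := Rabs (IZR (co2 c))) in *.
    assert (Hbe0 : 0 <= be) by apply Rabs_pos.
    assert (Hal0 : 0 <= al) by apply Rabs_pos.
    (* [s * s] bounds the second derivative of [lform], so [g / s] is a time in which the curvature
       contributes at most [g ^ 2]. *)
    set (s := sqrt (K * be)).
    assert (Hs2 : s * s = K * be) by (apply sqrt_sqrt; nra).
    assert (Hsp : 0 <= s) by apply sqrt_pos.
    assert (Hss0 : s <= s0) by (apply sqrt_le_1; nra).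
    assert (HsA : N * (s * g) <= A).
    { apply Rsqr_incr_0_var; [|lra]; unfold Rsqr.
      replace (N * (s * g) * (N * (s * g))) with (N ^ 2 * (s * s) * g ^ 2) by ring.
      rewrite Hs2; apply Rle_trans with (N ^ 2 * K * B * g ^ 2); [|nra].
      assert (0 <= N ^ 2 * K * g ^ 2) by (apply Rmult_le_pos; nra); nra. }
    (* on a stretch [t0, t0 + h] on which [c] stays small, every other line
       responsible for [E] is a multiple of [c] *)
    assert (Uniq : forall h L, 0 <= h <= N * g -> 
      al * h + s * s * h ^ 2 <= (8 * N ^ 2 - 1) * g ^ 2 -> s * s * h <= A ->
      fcov (fun t => t0 <= t <= t0 + h /\ Rabs (lform f c t) <= g ^ 2) L ->
      fcov (fun t => E t /\ t0 <= t <= t0 + h) L).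
    { intros h L Hh Hl8 Hd8 CL; eapply fcov_mono; [exact CL| |lra].
      intros t ((Vt & Ft) & Ht); split; auto.
      destruct (dform_shift _ _ _ _ _ _ _ c t0 t H ltac:(lra) ltac:(lra) ltac:(lra)) as (_ & D).
      fold be in D; rewrite <- Hs2 in D.
      pose proof (lform_shift _ _ _ _ _ _ _ c t0 t H ltac:(lra) ltac:(lra) ltac:(lra)) as D2.
      fold be in D2; rewrite <- Hs2 in D2.
      assert (Dt : Rabs (dform f1 c t) <= 2 * A).
      { replace (dform f1 c t) with (dform f1 c t0 + (dform f1 c t - dform f1 c t0)) by ring.
        eapply Rle_trans; [apply Rabs_triang|]; fold al; nra. }
      assert (Lt : Rabs (lform f c t) <= 8 * N ^ 2 * g ^ 2).
      { replace (lform f c t) with (lform f c t0 + (dform f1 c t0 * (t - t0) +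
          (lform f c t - lform f c t0 - dform f1 c t0 * (t - t0)))) by ring.
        eapply Rle_trans; [apply Rabs_triang|].
        assert (Rabs (dform f1 c t0 * (t - t0)) <= al * h).
        { rewrite Rabs_mult, (Rabs_pos_eq (t - t0)) by lra; fold al; nra. }
        assert (s * s * (t - t0) ^ 2 <= s * s * h ^ 2).
        { apply Rmult_le_compat_l; [nra|]; apply pow_incr; lra. }
        eapply Rle_trans; [apply Rplus_le_compat_l, Rabs_triang|]; lra. }
      destruct Vt as (c' & N' & Ha' & Hb' & Hl').
      destruct (classic (zcross c c' = zzero)) as [Z|Z].
      - destruct (primitive_parallel c c' P Z) as (z & ->).
        rewrite lform_scale in Hl'.
        eapply Rle_trans; [apply (Rabs_scale_ge z)|exact Hl']; apply (zscale_neq0 z c), N'.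
      - exfalso; apply Ft; exists (zcross c c').
        assert (0 < g ^ 2) by (apply pow_lt; lra).
        assert (0 < A * g ^ 2) by nra; assert (0 < B * g ^ 2) by nra.
        assert (4 <= N ^ 2) by nra.
        repeat split; auto.
        + rewrite (co0_cross f1 _ _ t); eapply Rle_trans;
            [apply (Rabs_cross_le _ _ _ _ (2 * A) B A B); auto|]; nra.
        + rewrite (devx_cross f); eapply Rle_trans;
            [apply (Rabs_cross_le _ _ _ _ B (8 * N ^ 2 * g ^ 2) B (g ^ 2)); auto|]; nra.
        + rewrite devn_cross; eapply Rle_trans;
            [apply (Rabs_cross_le _ _ _ _ (2 * A) (g ^ 2) A (8 * N ^ 2 * g ^ 2)); auto|]; nra. }
    (* If [co2 c = 0], then [dform] is the integer [co1 c], nonzero because otherwise [co0 c] would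
       be an integer below [g ^ 2 < 1] and [c] would vanish. This keeps the stretches below
       [N * g]. *)
    assert (Hbe1 : be = 0 /\ 1 <= al \/ 1 <= be /\ 1 <= s).
    { destruct (Z.eq_dec (co2 c) 0) as [Z|Z].
      - left; split; [unfold be; rewrite Z; apply Rabs_R0|].
        unfold al, dform; rewrite Z, Rmult_0_l, Rplus_0_r; apply IZR_ge1; intros Z1.
        apply (primitive_neq0 c P), zvec_eq; auto.
        apply (IZR_lt1 (co0 c) (g ^ 2)); [|nra].
        unfold lform in Hl; rewrite Z, Z1, !Rmult_0_l, !Rplus_0_r in Hl; exact Hl.
      - right; assert (1 <= be) by (apply IZR_ge1; auto); split; auto; nra. }
    (* Transversal case: the linear term dominates, and [3 * g ^ 2 / al] survives of
       [N * g ^ 2 / al]. Otherwise the line is nearly tangent, and [lform_small_cover] is applied on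
       a stretch [N * g / s]. *)
    destruct (Rle_dec (4 * N * (s * g)) al) as [Reg|Reg].
    + assert (Hal : 0 < al).
      { destruct Hbe1 as [|(_ & ?)]; [lra|]; assert (0 < s * g) by nra; nra. }
      assert (HNg : N * g ^ 2 <= al * (N * g)).
      { assert (g <= al).
        { destruct Hbe1 as [(_ & ?)|(_ & ?)]; [lra|].
          assert (g <= s * g) by nra; assert (s * g <= N * (s * g)) by nra; lra. }
        assert (0 < N * g) by nra; simpl; nra. }
      assert (Hh1 : 0 < N * g ^ 2 / al) by (apply Rdiv_lt_0_compat; nra).
      assert (Hh2 : al * (N * g ^ 2 / al) = N * g ^ 2) by (field; lra).
      assert (Hh3 : s * (N * g ^ 2 / al) <= g / 4).
      { apply Rmult_le_reg_l with al; auto.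
        replace (al * (s * (N * g ^ 2 / al))) with (s * (N * g ^ 2)) by (field; lra); nra. }
      exists (N * g ^ 2 / al); split; [split|].
      * eapply Rle_trans; [apply Rmin_l|]; apply Rmult_le_compat_l; [nra|].
        apply Rinv_le_contravar; lra.
      * nra.
      * apply Uniq.
        -- split; [lra|nra].
        -- assert (s * s * (N * g ^ 2 / al) ^ 2 <= g ^ 2 / 16).
           { replace (s * s * (N * g ^ 2 / al) ^ 2) with ((s * (N * g ^ 2 / al)) ^ 2) by ring.
             replace (g ^ 2 / 16) with ((g / 4) ^ 2) by field.
             apply pow_incr; split; [apply Rmult_le_pos; lra|auto]. }
           assert (0 < g ^ 2) by nra; nra.
        -- assert (0 <= s * g) by nra; nra.
        -- apply fcov_mono with (E := fun t => t0 <= t <= t0 + 3 * g ^ 2 / al)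
             (L := t0 + 3 * g ^ 2 / al - t0).
           ++ apply fcov_interval; auto.
              assert (0 < 3 * g ^ 2 / al) by (apply Rdiv_lt_0_compat; nra); lra.
           ++ intros t (Ht & Hlt); split; [lra|].
              pose proof (lform_shift _ _ _ _ _ _ _ c t0 t H ltac:(lra) ltac:(lra) ltac:(nra)) as D2.
              fold be in D2; rewrite <- Hs2 in D2.
              assert (Hq : s * s * (t - t0) ^ 2 <= g ^ 2 / 16).
              { replace (s * s * (t - t0) ^ 2) with ((s * (t - t0)) ^ 2) by ring.
                replace (g ^ 2 / 16) with ((g / 4) ^ 2) by field.
                apply pow_incr; split; nra. }
              assert (Hd : Rabs (dform f1 c t0 * (t - t0)) <= 3 * g ^ 2).
              { replace (dform f1 c t0 * (t - t0)) with (lform f c t + (- lform f c t0 +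
                  - (lform f c t - lform f c t0 - dform f1 c t0 * (t - t0)))) by ring.
                eapply Rle_trans; [apply Rabs_triang|].
                eapply Rle_trans; [apply Rplus_le_compat_l, Rabs_triang|].
                rewrite !Rabs_Ropp; nra. }
              rewrite Rabs_mult, (Rabs_pos_eq (t - t0)) in Hd by lra; fold al in Hd.
              assert (t - t0 <= 3 * g ^ 2 / al); [|lra].
              apply Rmult_le_reg_l with al; auto.
              replace (al * (3 * g ^ 2 / al)) with (3 * g ^ 2) by (field; lra); auto.
           ++ replace (12 * kap / N * (N * g ^ 2 / al)) with (12 * kap * (g ^ 2 / al)) by (field; lra).
              replace (t0 + 3 * g ^ 2 / al - t0) with (3 * (g ^ 2 / al)) by (field; lra).
              assert (0 < g ^ 2 / al) by (apply Rdiv_lt_0_compat; nra); nra.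
    + assert (Hs1 : 1 <= s /\ 1 <= be).
      { destruct Hbe1 as [(Z & ?)|(? & ?)]; auto.
        exfalso; apply Reg; rewrite Z in Hs2; assert (s = 0) by nra; nra. }
      destruct Hs1 as (Hs1 & Hbe2).
      assert (Hh1 : 0 < N * g / s) by (apply Rdiv_lt_0_compat; nra).
      assert (Hh2 : s * (N * g / s) = N * g) by (field; lra).
      assert (Hh3 : N * g / s <= N * g).
      { rewrite <- Hh2 at 2; rewrite <- (Rmult_1_l (N * g / s)) at 1.
        apply Rmult_le_compat_r; lra. }
      exists (N * g / s); split; [split|].
      * eapply Rle_trans; [apply Rmin_r|]; apply Rmult_le_compat_l; [nra|].
        apply Rinv_le_contravar; lra.
      * lra.
      * apply Uniq.
        -- split; lra.
        -- replace (s * s * (N * g / s) ^ 2) with (N ^ 2 * g ^ 2) by (field; lra).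
           assert (al * (N * g / s) <= 4 * N ^ 2 * g ^ 2).
           { replace (4 * N ^ 2 * g ^ 2) with (4 * N * (s * g) * (N * g / s)) by (field; lra).
             apply Rmult_le_compat_r; lra. }
           assert (g ^ 2 <= N ^ 2 * g ^ 2).
           { rewrite <- (Rmult_1_l (g ^ 2)) at 1; apply Rmult_le_compat_r; [apply pow2_ge_0|nra]. }
           assert (0 < g ^ 2) by (apply pow_lt; lra); lra.
        -- replace (s * s * (N * g / s)) with (N * (s * g)) by (field; lra); auto.
        -- assert (Hc0 : IZR (co2 c) <> 0).
           { intros Z; unfold be in Hbe2; rewrite Z, Rabs_R0 in Hbe2; lra. }
           (* The choice [mu = s * g] makes both terms multiples of [g / s]. The ratio [kap] enters
              because [s] comes from the upper curvature bound while the cover uses the lower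
              one. *)
           eapply fcov_mono; [apply (lform_small_cover f f1 l r k K m c t0 (N * g / s) (g ^ 2) (s * g) H); auto; first [lra|apply pow2_ge_0|apply Rmult_lt_0_compat; lra]|auto|].
           fold be.
           replace (4 * (s * g) / (k * be)) with (4 * kap * (g / s)).
           2:{ unfold kap; replace be with (s * s / K) by (rewrite Hs2; field; lra); field; lra. }
           replace (8 * g ^ 2 / (s * g)) with (8 * (g / s)) by (field; lra).
           replace (12 * kap / N * (N * g / s)) with (12 * kap * (g / s)) by (field; lra).
           assert (0 < g / s) by (apply Rdiv_lt_0_compat; lra).
           assert (g / s <= kap * (g / s)) by (rewrite <- (Rmult_1_l (g / s)) at 1; apply Rmult_le_compat_r; lra).
           lra.
  - apply Rle_trans with (2 * (12 * kap / N) * (2 * (j1 - j0))); [|apply Req_le; field; lra].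
    assert (0 < 12 * kap / N) by (apply Rdiv_lt_0_compat; lra).
    apply Rmult_le_compat_l; lra.
Qed.

(* Points near [w] that are not near a line, and points near a line that are not
   near a further point, are rare by the two step lemmas; what remains is near a
   point again, with volume [a * b * c] raised to a power above 1. The height [a]
   at least halves in each round, and no point has height below 1. *)
Lemma near_point_measure f f1 l r k K m j0 j1 d :
  convex_arc f f1 l r k K m -> l <= j0 -> j1 + d <= r -> d <= j1 - j0 -> 0 < d <= 1 ->
  forall n a b c N, 100 <= N -> 12 * (K / k) <= N ->
  a < 2 ^ n -> 0 < a -> 0 < b -> 0 < c < 1 ->
  a * b * c * N ^ 8 <= 1 -> 4 * K * N ^ 4 * b ^ 2 <= c ->
  N * b <= d -> 6 * N ^ 3 * b * c <= d ^ 2 ->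
  fcov (fun t => near_point f f1 a b c t /\ j0 <= t <= j1) (112 * (K / k) / N * (j1 - j0)).
Proof.
  intros H Hj0 Hr Hd Hd1.
  destruct (arc_consts _ _ _ _ _ _ _ H) as (Hk & HK & _).
  set (kap := K / k).
  assert (Hkap : 1 <= kap).
  { unfold kap; apply Rmult_le_reg_r with k; [lra|]; unfold Rdiv; rewrite Rmult_assoc, Rinv_l; lra. }
  induction n as [|n IH]; intros a b c N HN HNk Han Ha Hb Hc C1 C2 C3 C4.
  all: assert (Hb1 : b < 1) by (assert (100 * b <= N * b) by (apply Rmult_le_compat_r; lra); lra).
  - apply fcov_empty.
    + intros t (V & _); apply (near_point_empty f f1 a b c t); auto; simpl in Han; lra.
    + assert (0 < 112 * kap / N) by (apply Rdiv_lt_0_compat; lra); nra.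
  - assert (Hkn : 0 < kap / N) by (apply Rdiv_lt_0_compat; lra).
    destruct (Rlt_le_dec a 1) as [Ha1|Ha1].
    { apply fcov_empty.
      - intros t (V & _); apply (near_point_empty f f1 a b c t); auto; lra.
      - replace (112 * kap / N) with (112 * (kap / N)) by (field; lra); nra. }
    set (v := a * b * c) in *.
    assert (Hv : 0 < v) by (unfold v; apply Rmult_lt_0_compat; [apply Rmult_lt_0_compat|]; lra).
    (* The exponent 8 leaves three spare factors [N >= 100], which pay for the numerical constants
       below. *)
    assert (Hv5 : v * N ^ 5 <= / 1000000).
    { assert (1000000 <= N ^ 3) by (replace 1000000 with (100 ^ 3) by ring; apply pow_incr; lra).
      assert (0 < v * N ^ 5) by (apply Rmult_lt_0_compat; auto; apply pow_lt; lra).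
      apply Rmult_le_reg_l with 1000000; [lra|].
      rewrite Rinv_r by lra; apply Rle_trans with (v * N ^ 5 * N ^ 3); [nra|].
      replace (v * N ^ 5 * N ^ 3) with (v * N ^ 8) by ring; auto. }
    assert (S : forall x, 0 <= x -> x * 100 <= x * N) by (intros; nra).
    assert (Hv4 : 0 < v * N ^ 4) by (apply Rmult_lt_0_compat; auto; apply pow_lt; lra).
    assert (Hv3 : 0 < v * N ^ 3) by (apply Rmult_lt_0_compat; auto; apply pow_lt; lra).
    assert (Hv2 : 0 < v * N ^ 2) by (apply Rmult_lt_0_compat; auto; apply pow_lt; lra).
    assert (Hv1 : 0 < v * N) by (apply Rmult_lt_0_compat; lra).
    assert (T4 : v * N ^ 4 * 100 <= v * N ^ 5) by (replace (v * N ^ 5) with (v * N ^ 4 * N) by ring; apply S; lra).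
    assert (T3 : v * N ^ 3 * 100 <= v * N ^ 4) by (replace (v * N ^ 4) with (v * N ^ 3 * N) by ring; apply S; lra).
    assert (T2 : v * N ^ 2 * 100 <= v * N ^ 3) by (replace (v * N ^ 3) with (v * N ^ 2 * N) by ring; apply S; lra).
    assert (T1 : v * N * 100 <= v * N ^ 2) by (replace (v * N ^ 2) with (v * N * N) by ring; apply S; lra).
    assert (Hbc : 0 < b * c) by (apply Rmult_lt_0_compat; lra).
    assert (Hac : 0 < a * c) by (apply Rmult_lt_0_compat; lra).
    assert (HNb : 0 < N * b) by (apply Rmult_lt_0_compat; lra).
    assert (HNbc : 0 < 6 * N * b * c) by (replace (6 * N * b * c) with (6 * N * (b * c)) by ring; apply Rmult_lt_0_compat; lra).
    set (g := sqrt (6 * N * b * c)).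
    assert (Hg2 : g ^ 2 = 6 * N * b * c).
    { unfold g; simpl; rewrite Rmult_1_r; apply sqrt_sqrt; lra. }
    assert (Hg : 0 < g) by (apply sqrt_lt_R0; lra).
    assert (HNg : N * g <= d).
    { apply Rsqr_incr_0_var; [|lra]; unfold Rsqr.
      replace (N * g * (N * g)) with (N ^ 2 * g ^ 2) by ring; rewrite Hg2; lra. }
    assert (Hg1 : g < 1) by (assert (100 * g <= N * g) by (apply Rmult_le_compat_r; lra); lra).
    assert (S1 : fcov (fun t => (near_point f f1 a b c t /\
        ~ near_line f f1 (3 * a * c) (4 * N * a * b) (6 * N * b * c) t) /\ j0 <= t <= j1)
        (8 / N * (j1 - j0))).
    { apply (near_point_step f f1 l r k K m); auto; try lra.
      apply Rle_trans with (4 * K * N ^ 4 * b ^ 2); auto.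
      assert (N ^ 2 <= N ^ 4) by (apply Rle_pow; [lra|lia]).
      apply Rmult_le_compat_r; [apply pow2_ge_0|]; apply Rmult_le_compat_l; lra. }
    assert (S2 : fcov (fun t => (near_line f f1 (3 * a * c) (4 * N * a * b) (g ^ 2) t /\
        ~ near_point f f1 (3 * (3 * a * c) * (4 * N * a * b)) (16 * N ^ 2 * (4 * N * a * b) * g ^ 2)
            (16 * N ^ 2 * (3 * a * c) * g ^ 2) t) /\ j0 <= t <= j1)
        (48 * kap / N * (j1 - j0))).
    { apply (near_line_step f f1 l r k K m); auto; try lra.
      1: replace (4 * N * a * b) with (4 * a * (N * b)) by ring; apply Rmult_lt_0_compat; lra.
      rewrite Hg2.
      replace (N ^ 2 * K * (4 * N * a * b) * (6 * N * b * c)) with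
        (6 * (a * c) * (4 * K * N ^ 4 * b ^ 2)) by ring.
      apply Rle_trans with (6 * (a * c) * c); [apply Rmult_le_compat_l; lra|].
      replace ((3 * a * c) ^ 2) with (9 * (a * c) * (c * a)) by ring.
      assert (c * 1 <= c * a) by (apply Rmult_le_compat_l; lra).
      assert (a * c * c <= a * c * (c * a)) by (apply Rmult_le_compat_l; lra).
      assert (0 < a * c * c) by (apply Rmult_lt_0_compat; lra); lra. }
    (* Two steps multiply the box by [36 * v * N], [384 * v * N ^ 4] and [288 * v * N ^ 3], the
       first at most 1/2. Doubling [N] makes the losses geometric: 112 solves
       [x = 8 + 48 + x / 2]. *)
    assert (S3 : fcov (fun t => near_point f f1 (3 * (3 * a * c) * (4 * N * a * b))
         (16 * N ^ 2 * (4 * N * a * b) * g ^ 2) (16 * N ^ 2 * (3 * a * c) * g ^ 2) t /\ j0 <= t <= j1)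
         (112 * kap / (2 * N) * (j1 - j0))).
    { rewrite Hg2.
      replace (3 * (3 * a * c) * (4 * N * a * b)) with (36 * (v * N) * a) by (unfold v; ring).
      replace (16 * N ^ 2 * (4 * N * a * b) * (6 * N * b * c)) with (384 * (v * N ^ 4) * b) by (unfold v; ring).
      replace (16 * N ^ 2 * (3 * a * c) * (6 * N * b * c)) with (288 * (v * N ^ 3) * c) by (unfold v; ring).
      assert (Eb : 0 < 384 * (v * N ^ 4) * b) by (apply Rmult_lt_0_compat; lra).
      assert (Ec : 0 < 288 * (v * N ^ 3) * c) by (apply Rmult_lt_0_compat; lra).
      apply IH; auto; try lra.
      - simpl in Han; assert (36 * (v * N) <= / 2) by lra; nra.
      - apply Rmult_lt_0_compat; lra.
      - split; auto; assert (288 * (v * N ^ 3) <= 1) by lra; nra.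
      - replace (36 * (v * N) * a * (384 * (v * N ^ 4) * b) * (288 * (v * N ^ 3) * c) * (2 * N) ^ 8)
          with (1019215872 * ((v * N) * ((v * N ^ 5) * ((v * N ^ 5) * (v * N ^ 5))))) by (unfold v; ring).
        assert (0 < v * N ^ 5) by lra.
        assert ((v * N ^ 5) * (v * N ^ 5) <= / 1000000 * / 1000000) by (apply Rmult_le_compat; lra).
        assert ((v * N ^ 5) * ((v * N ^ 5) * (v * N ^ 5)) <= / 1000000 * (/ 1000000 * / 1000000))
          by (apply Rmult_le_compat; try lra; nra).
        assert (0 < v * N ^ 5 * (v * N ^ 5 * (v * N ^ 5))) by (repeat apply Rmult_lt_0_compat; lra).
        assert (v * N * ((v * N ^ 5) * ((v * N ^ 5) * (v * N ^ 5))) <= 1 * (/ 1000000 * (/ 1000000 * / 1000000)))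
          by (apply Rmult_le_compat; lra).
        lra.
      - replace (4 * K * (2 * N) ^ 4 * (384 * (v * N ^ 4) * b) ^ 2) with
          (4 * K * N ^ 4 * b ^ 2 * (2359296 * (v * N ^ 3) * (v * N ^ 5))) by ring.
        assert (0 < v * N ^ 3 * (v * N ^ 5)) by (apply Rmult_lt_0_compat; lra).
        apply Rle_trans with (c * (2359296 * (v * N ^ 3) * (v * N ^ 5))); [apply Rmult_le_compat_r; lra|].
        replace (c * (2359296 * (v * N ^ 3) * (v * N ^ 5))) with ((v * N ^ 3 * c) * (2359296 * (v * N ^ 5))) by ring.
        replace (288 * (v * N ^ 3) * c) with ((v * N ^ 3 * c) * 288) by ring.
        assert (0 < v * N ^ 3 * c) by (apply Rmult_lt_0_compat; lra).
        apply Rmult_le_compat_l; lra.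
      - replace (2 * N * (384 * (v * N ^ 4) * b)) with (768 * (v * N ^ 4) * (N * b)) by ring.
        apply Rle_trans with (1 * (N * b)); [apply Rmult_le_compat_r; lra|lra].
      - replace (6 * (2 * N) ^ 3 * (384 * (v * N ^ 4) * b) * (288 * (v * N ^ 3) * c)) with
          (884736 * (v * N ^ 2) * (v * N ^ 5) * (6 * N ^ 3 * b * c)) by ring.
        assert (0 < N ^ 3) by (apply pow_lt; lra).
        assert (0 < 6 * N ^ 3 * b * c) by (replace (6 * N ^ 3 * b * c) with (6 * N ^ 3 * (b * c)) by ring; nra).
        apply Rle_trans with (1 * (6 * N ^ 3 * b * c)); [|lra].
        apply Rmult_le_compat_r; [lra|].
        assert (v * N ^ 2 * (v * N ^ 5) <= 1 * / 1000000) by (apply Rmult_le_compat; lra).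
        lra. }
    rewrite Hg2 in S2, S3.
    eapply fcov_mono; [apply (fcov_excluded _ _ _ _ _ S1 (fcov_excluded _ _ _ _ _ S2 S3))|auto|].
    replace (8 / N) with (8 * (1 / N)) by (field; lra).
    replace (48 * kap / N) with (48 * (kap / N)) by (field; lra).
    replace (112 * kap / (2 * N)) with (56 * (kap / N)) by (field; lra).
    replace (112 * kap / N) with (112 * (kap / N)) by (field; lra).
    assert (1 / N <= kap / N) by (apply Rmult_le_compat_r; [|lra]; apply Rlt_le, Rinv_0_lt_compat; lra).
    nra.
Qed.

(** One line step leads to a point box, for which the later hypotheses are those of
    [near_point_measure]; 160 is 48 + 112. *)
Lemma near_line_measure f f1 l r k K m j0 j1 d A B G N :
  convex_arc f f1 l r k K m -> l <= j0 -> j1 + d <= r -> d <= j1 - j0 -> 0 < d <= 1 ->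
  100 <= N -> 12 * (K / k) <= N -> 0 < A -> 0 < B -> 0 < G ->
  N ^ 2 * K * B * G <= A ^ 2 -> N ^ 2 * G <= d ^ 2 -> 16 * N ^ 2 * A * G < 1 ->
  3 * A * B * (16 * N ^ 2 * B * G) * (16 * N ^ 2 * A * G) * N ^ 8 <= 1 ->
  4 * K * N ^ 4 * (16 * N ^ 2 * B * G) ^ 2 <= 16 * N ^ 2 * A * G ->
  N * (16 * N ^ 2 * B * G) <= d ->
  6 * N ^ 3 * (16 * N ^ 2 * B * G) * (16 * N ^ 2 * A * G) <= d ^ 2 ->
  fcov (fun t => near_line f f1 A B G t /\ j0 <= t <= j1) (160 * (K / k) / N * (j1 - j0)).
Proof.
  intros H Hj0 Hr Hd Hd1 HN HNk HA HB HG C1 C2 C3 C4 C5 C6 C7.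
  destruct (arc_consts _ _ _ _ _ _ _ H) as (Hk & HK & _).
  assert (HN2 : 0 < 16 * N ^ 2) by nra.
  set (g := sqrt G).
  assert (Hg2 : g ^ 2 = G) by (unfold g; simpl; rewrite Rmult_1_r; apply sqrt_sqrt; lra).
  assert (Hg : 0 < g) by (apply sqrt_lt_R0; lra).
  assert (HNg : N * g <= d).
  { apply Rsqr_incr_0_var; [|lra]; unfold Rsqr.
    replace (N * g * (N * g)) with (N ^ 2 * g ^ 2) by ring; rewrite Hg2; nra. }
  assert (0 < 16 * N ^ 2 * B * G) by (repeat apply Rmult_lt_0_compat; lra).
  assert (0 < 16 * N ^ 2 * A * G) by (repeat apply Rmult_lt_0_compat; lra).
  assert (0 < 3 * A * B) by nra.
  pose proof (near_line_step f f1 l r k K m A B g N j0 j1 H) as S1.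
  rewrite Hg2 in S1.
  specialize (S1 ltac:(lra) ltac:(lra) ltac:(lra) HA HB ltac:(nra) C1 ltac:(lra) ltac:(lra) HNk).
  destruct (Pow_x_infinity 2 ltac:(rewrite Rabs_pos_eq; lra) (3 * A * B + 1)) as (n & Hn).
  specialize (Hn n ltac:(lia)); rewrite Rabs_pos_eq in Hn by (apply pow_le; lra).
  pose proof (near_point_measure f f1 l r k K m j0 j1 d H Hj0 Hr Hd Hd1 n
    (3 * A * B) (16 * N ^ 2 * B * G) (16 * N ^ 2 * A * G) N
    ltac:(auto) ltac:(auto) ltac:(lra) ltac:(auto) ltac:(auto) ltac:(auto) C4 C5 C6 C7) as S2.
  eapply fcov_mono; [apply (fcov_excluded _ _ _ _ _ S1 S2)|auto|].
  apply Req_le; field; lra.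
Qed.

(** * Pigeonhole arguments and critical flags *)

Lemma pigeonhole (g : nat -> nat) n m : (m < n)%nat -> (forall i, (i < n)%nat -> (g i < m)%nat) ->
  exists i j, (i < j < n)%nat /\ g i = g j.
Proof.
  intros Hm H; apply NNPP; intros N.
  assert (ND : NoDup (map g (seq 0 n))).
  { apply NoDup_map_NoDup_ForallPairs; [|apply seq_NoDup].
    intros a b Ha Hb E; apply in_seq in Ha, Hb.
    destruct (lt_eq_lt_dec a b) as [[L|L]|L]; auto; exfalso; apply N.
    - exists a, b; split; [lia|auto].
    - exists b, a; split; [lia|auto]. }
  pose proof (NoDup_incl_length (l' := seq 0 m) ND) as I.
  rewrite length_map, !length_seq in I.
  assert (n <= m)%nat; [|lia].
  apply I; intros y Hy; apply in_map_iff in Hy as (i & <- & Hi).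
  apply in_seq in Hi; apply in_seq; specialize (H i ltac:(lia)); lia.
Qed.

Definition nfloor (x : R) : nat := Z.to_nat (Int_part x).

Lemma nfloor_spec x : 0 <= x -> INR (nfloor x) <= x < INR (nfloor x) + 1.
Proof.
  intros H; destruct (base_Int_part x) as (H1 & H2).
  assert (0 <= Int_part x)%Z.
  { assert (-1 < Int_part x)%Z; [|lia]; apply lt_IZR; lra. }
  unfold nfloor; rewrite INR_IZR_INZ, Z2Nat.id by auto; lra.
Qed.

Lemma nat_pair_eq B i j : (i / S B = j / S B)%nat -> (i mod S B = j mod S B)%nat -> i = j.
Proof.
  intros H1 H2; rewrite (Nat.div_mod_eq i (S B)), (Nat.div_mod_eq j (S B)), H1, H2; reflexivity.
Qed.

(** Thue's pigeonhole argument: the pairs below the integer parts of [x1] and [x2], both bounds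
    included, outnumber the residues of [p1 * c1 + p2 * c2] modulo [q], so two of them agree. *)
Lemma thue (q p1 p2 : Z) (x1 x2 : R) :
  (0 < q)%Z -> 0 < x1 -> 0 < x2 -> IZR q <= x1 * x2 ->
  exists c1 c2, ~ (c1 = 0 /\ c2 = 0)%Z /\ Rabs (IZR c1) <= x1 /\ Rabs (IZR c2) <= x2 /\
    (q | p1 * c1 + p2 * c2)%Z.
Proof.
  intros Hq Hx1 Hx2 Hx.
  destruct (nfloor_spec x1 ltac:(lra)) as (A1 & A2).
  destruct (nfloor_spec x2 ltac:(lra)) as (B1 & B2).
  set (A := nfloor x1) in *; set (B := nfloor x2) in *.
  (* The index [i] encodes the pair of quotient and remainder by [S B]. *)
  set (g := fun i => Z.to_nat ((p1 * Z.of_nat (i / S B) + p2 * Z.of_nat (i mod S B)) mod q)).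
  destruct (pigeonhole g (S A * S B) (Z.to_nat q)) as (i & j & Hij & E).
  - apply INR_lt; rewrite mult_INR, !S_INR, INR_IZR_INZ, Z2Nat.id by lia.
    pose proof (pos_INR A); pose proof (pos_INR B); nra.
  - intros i Hi; unfold g; apply Z2Nat.inj_lt; try apply Z.mod_pos_bound; lia.
  - assert (Hdiv : forall i, (i < S A * S B)%nat -> (i / S B <= A)%nat).
    { intros i0 Hi0; assert (i0 / S B < S A)%nat; [|lia].
      apply Nat.Div0.div_lt_upper_bound; lia. }
    assert (Hmod : forall i, (i mod S B <= B)%nat).
    { intros i0; assert (i0 mod S B < S B)%nat; [|lia]; apply Nat.mod_upper_bound; lia. }
    assert (Hd : forall a b n, (a <= n)%nat -> (b <= n)%nat ->
      Rabs (IZR (Z.of_nat a - Z.of_nat b)) <= INR n).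
    { intros a b n Ha Hb; rewrite <- abs_IZR, INR_IZR_INZ; apply IZR_le; lia. }
    exists (Z.of_nat (i / S B) - Z.of_nat (j / S B))%Z, (Z.of_nat (i mod S B) - Z.of_nat (j mod S B))%Z.
    repeat split.
    + intros (Z1 & Z2); assert (i = j); [apply (nat_pair_eq B); lia|lia].
    + eapply Rle_trans; [apply (Hd _ _ A); apply Hdiv; lia|lra].
    + eapply Rle_trans; [apply (Hd _ _ B); apply Hmod|lra].
    + unfold g in E.
      apply Z2Nat.inj in E; [|apply Z.mod_pos_bound; lia|apply Z.mod_pos_bound; lia].
      apply Z.cong_iff_0 in E; apply Z.mod_divide in E; [|lia].
      destruct E as (z & E); exists z; lia.
Qed.

(** Dirichlet's pigeonhole in the sheared box. There are at most [(2 / b) * (2 / c) <= a] cells for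
    more than [a] multiples; rounding up the cell counts costs the factor 4. *)
Lemma exists_near_point f f1 a b c t : 0 < b <= 1 -> 0 < c <= 1 -> 4 <= a * b * c ->
  near_point f f1 a b c t.
Proof.
  intros Hb Hc Ha.
  set (p1 := fun i : nat => Int_part (INR i * t)).
  set (x := fun i : nat => INR i * t - IZR (p1 i)).
  set (p2 := fun i : nat => Int_part (INR i * f t - f1 t * x i)).
  set (y := fun i : nat => INR i * f t - f1 t * x i - IZR (p2 i)).
  assert (Hx : forall i, 0 <= x i < 1).
  { intros i; unfold x, p1; destruct (base_Int_part (INR i * t)); lra. }
  assert (Hy : forall i, 0 <= y i < 1).
  { intros i; unfold y, p2; destruct (base_Int_part (INR i * f t - f1 t * x i)); lra. }
  assert (D : forall z d, 0 <= z < 1 -> 0 < d -> 0 <= z / d < / d).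
  { intros z d Hz Hd; split; [apply Rle_mult_inv_pos; lra|].
    rewrite <- (Rmult_1_l (/ d)); apply Rmult_lt_compat_r; [apply Rinv_0_lt_compat|]; lra. }
  assert (Bd : forall d, 0 < d <= 1 -> INR (nfloor (/ d)) + 1 <= 2 / d).
  { intros d Hd; destruct (nfloor_spec (/ d)); [apply Rlt_le, Rinv_0_lt_compat; lra|].
    assert (1 <= / d) by (rewrite <- Rinv_1 at 1; apply Rinv_le_contravar; lra).
    unfold Rdiv; lra. }
  assert (Fd : forall z d, 0 <= z < 1 -> 0 < d -> (nfloor (z / d) <= nfloor (/ d))%nat).
  { intros z d Hz Hd; destruct (D z d Hz Hd).
    destruct (nfloor_spec (z / d)); [lra|]; destruct (nfloor_spec (/ d)); [lra|].
    assert (nfloor (z / d) < S (nfloor (/ d)))%nat; [|lia].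
    apply INR_lt; rewrite S_INR; lra. }
  set (M := nfloor (/ c)); set (L := nfloor (/ b)).
  assert (Ha0 : 0 < a).
  { assert (0 < b * c) by nra; nra. }
  destruct (nfloor_spec a ltac:(lra)) as (A1 & A2).
  destruct (pigeonhole (fun i => nfloor (x i / b) * S M + nfloor (y i / c))%nat (S (nfloor a)) (S L * S M))
    as (i & j & Hij & E).
  - apply INR_lt; rewrite mult_INR, !S_INR.
    apply Rle_lt_trans with (2 / b * (2 / c)).
    + pose proof (pos_INR L); pose proof (pos_INR M); apply Rmult_le_compat; try lra; apply Bd; lra.
    + apply Rle_lt_trans with a; [|lra].
      apply Rmult_le_reg_r with (b * c); [nra|].
      replace (2 / b * (2 / c) * (b * c)) with 4 by (field; lra); lra.
  - intros i _; pose proof (Fd (x i) b (Hx i) ltac:(lra)); pose proof (Fd (y i) c (Hy i) ltac:(lra)).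
    fold L in H; fold M in H0; nia.
  - assert (Hyi := Fd (y i) c (Hy i) ltac:(lra)); assert (Hyj := Fd (y j) c (Hy j) ltac:(lra)).
    fold M in Hyi, Hyj.
    assert (E1 : nfloor (x i / b) = nfloor (x j / b)) by nia.
    assert (E2 : nfloor (y i / c) = nfloor (y j / c)) by nia.
    assert (Cl : forall z z' d, 0 <= z -> 0 <= z' -> 0 < d -> nfloor (z / d) = nfloor (z' / d) -> Rabs (z' - z) <= d).
    { intros z z' d Hz Hz' Hd En.
      assert (0 <= z / d) by (apply Rle_mult_inv_pos; lra).
      assert (0 <= z' / d) by (apply Rle_mult_inv_pos; lra).
      destruct (nfloor_spec (z / d)); auto; destruct (nfloor_spec (z' / d)); auto; rewrite En in *.
      replace (z' - z) with (d * (z' / d - z / d)) by (field; lra).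
      rewrite Rabs_mult, Rabs_pos_eq by lra.
      assert (Rabs (z' / d - z / d) <= 1) by (apply Rabs_le; lra); nra. }
    exists (ZVec (Z.of_nat j - Z.of_nat i) (p1 j - p1 i) (p2 j - p2 i)); repeat split.
    + intros N; injection N; intros; lia.
    + simpl; rewrite <- abs_IZR; apply Rle_trans with (INR (nfloor a)); [|lra].
      rewrite INR_IZR_INZ; apply IZR_le; lia.
    + replace (devx _ t) with (x j - x i).
      * apply Cl; auto; try apply Hx; lra.
      * unfold devx, x; simpl; rewrite !minus_IZR, <- !INR_IZR_INZ; ring.
    + replace (devn f f1 _ t) with (y j - y i).
      * apply Cl; auto; try apply Hy; lra.
      * unfold devn, devy, devx, y, x; simpl; rewrite !minus_IZR, <- !INR_IZR_INZ; ring.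
Qed.

(** A pair [(c1, c2)] extends to a line through [w] exactly when [q] divides [p1 * c1 + p2 * c2];
    removing the content only shrinks it. *)
Lemma exists_line_through w x1 x2 : (0 < co0 w)%Z -> 0 < x1 -> 0 < x2 -> IZR (co0 w) <= x1 * x2 ->
  exists c, zprimitive c /\ zdot c w = 0%Z /\ Rabs (IZR (co1 c)) <= x1 /\ Rabs (IZR (co2 c)) <= x2.
Proof.
  intros Hq Hx1 Hx2 Hx.
  destruct (thue (co0 w) (co1 w) (co2 w) x1 x2 Hq Hx1 Hx2 Hx) as (c1 & c2 & N & H1 & H2 & (z & E)).
  destruct (exists_primitive (ZVec (- z) c1 c2)) as (k & c & Hk & P & Ec).
  { intros E0; injection E0; intros; apply N; auto. }
  injection Ec as E0 E1 E2; exists c; split; auto; split; [|split].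
  - unfold zdot; apply Z.mul_reg_l with k; [lia|].
    rewrite E1, E2 in E; nia.
  - eapply Rle_trans; [apply (Rabs_scale_ge k); lia|rewrite <- mult_IZR, <- E1; auto].
  - eapply Rle_trans; [apply (Rabs_scale_ge k); lia|rewrite <- mult_IZR, <- E2; auto].
Qed.

(** With [v.c = 1], the line [c' = v x w] satisfies [c x c' = - w] by the triple product identity.
    Adding multiples of [c] does not change this, and a Bezout witness for [w] then produces one for
    [e]. *)
Lemma line_complement w c : zprimitive w -> zprimitive c -> zdot c w = 0%Z ->
  exists c', forall k, let e := zadd c' (zscale k c) in
    zdot e w = 0%Z /\ zcross c e = zscale (-1) w /\ zprimitive e.
Proof.
  intros (vw & Hw) (v & Hc) H0.
  exists (zcross v w); intros k e.
  assert (He : zcross c e = zscale (-1) w).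
  { unfold e, zdot in *; destruct w as [w0 w1 w2], v as [v0 v1 v2], c as [c0 c1 c2].
    unfold zcross, zadd, zscale in *; cbn [co0 co1 co2] in *.
    apply zvec_eq; cbn [co0 co1 co2].
    - assert (X : (c1 * (v0 * w1 - v1 * w0 + k * c2) - c2 * (v2 * w0 - v0 * w2 + k * c1) =
        v0 * (c0 * w0 + c1 * w1 + c2 * w2) - w0 * (c0 * v0 + c1 * v1 + c2 * v2))%Z) by ring.
      rewrite X, H0, Hc; ring.
    - assert (X : (c2 * (v1 * w2 - v2 * w1 + k * c0) - c0 * (v0 * w1 - v1 * w0 + k * c2) =
        v1 * (c0 * w0 + c1 * w1 + c2 * w2) - w1 * (c0 * v0 + c1 * v1 + c2 * v2))%Z) by ring.
      rewrite X, H0, Hc; ring.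
    - assert (X : (c0 * (v2 * w0 - v0 * w2 + k * c1) - c1 * (v1 * w2 - v2 * w1 + k * c0) =
        v2 * (c0 * w0 + c1 * w1 + c2 * w2) - w2 * (c0 * v0 + c1 * v1 + c2 * v2))%Z) by ring.
      rewrite X, H0, Hc; ring. }
  split; [|split; auto].
  - unfold e, zdot in *; simpl in *.
    transitivity (k * (co0 c * co0 w + co1 c * co1 w + co2 c * co2 w))%Z; [ring|rewrite H0; ring].
  - exists (zscale (-1) (zcross vw c)).
    transitivity (- zdot vw (zcross c e))%Z.
    + clearbody e; unfold zdot, zcross, zscale; cbn [co0 co1 co2]; ring.
    + rewrite He, <- Hw; unfold zdot, zscale; cbn [co0 co1 co2]; ring.
Qed.

Lemma exists_translate a d lo hi : d <> 0 -> Rabs d <= hi - lo ->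
  exists k : Z, lo < a + IZR k * d <= hi.
Proof.
  intros Hd Hl.
  assert (P : forall d, 0 < d -> d <= hi - lo -> exists k : Z, lo < a + IZR k * d <= hi).
  { clear d Hd Hl; intros d Hd Hl; exists (Int_part ((hi - a) / d)).
    destruct (base_Int_part ((hi - a) / d)) as (H1 & H2).
    assert (E : (hi - a) / d * d = hi - a) by (field; lra).
    split; nra. }
  destruct (Rlt_le_dec 0 d) as [H|H].
  - rewrite Rabs_pos_eq in Hl by lra; auto.
  - rewrite Rabs_left in Hl by lra.
    destruct (P (- d) ltac:(lra) ltac:(lra)) as (k & Hk).
    exists (- k)%Z; rewrite opp_IZR; lra.
Qed.

(** Incidence eliminates the constant coefficient, so the deviations of [w] alone determine the
    value. *)
Lemma lform_incident f e w t : zdot e w = 0%Z ->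
  IZR (co0 w) * lform f e t = IZR (co1 e) * devx w t + IZR (co2 e) * devy f w t.
Proof.
  intros H; apply IZR_eq in H; unfold zdot in H; rewrite !plus_IZR, !mult_IZR in H.
  unfold lform, devx, devy; nra.
Qed.

Lemma devy_cross f c c' t :
  devy f (zcross c c') t = IZR (co1 c) * lform f c' t - IZR (co1 c') * lform f c t.
Proof. unfold lform, devy; simpl; rewrite !minus_IZR, !mult_IZR; ring. Qed.

Lemma co1_cross f w w' t :
  IZR (co1 (zcross w w')) = IZR (co0 w) * devy f w' t - IZR (co0 w') * devy f w t.
Proof. unfold devy; simpl; rewrite !minus_IZR, !mult_IZR; ring. Qed.

Lemma devy_scale f k w t : devy f (zscale k w) t = IZR k * devy f w t.
Proof. unfold devy; simpl; rewrite !mult_IZR; ring. Qed.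

Lemma Rpower_inv_sqr y : 0 < y -> Rpower (/ y ^ 2) (- (1 / 2)) = y.
Proof.
  intros H; unfold Rpower; rewrite ln_Rinv by (apply pow_lt; auto).
  replace (y ^ 2) with (y * y) by ring; rewrite ln_mult by auto.
  replace (- (1 / 2) * - (ln y + ln y)) with (ln y) by field; apply exp_ln; auto.
Qed.

(** The condition of [DI] at a single [Q], since the construction refutes it only at specially
    chosen [Q]. *)
Definition DI_solvable (sigma Q v1 v2 : R) : Prop :=
  exists (q : nat) (p1 p2 : Z), (1 <= q)%nat /\
    supnorm2 (INR q * v1 - IZR p1) (INR q * v2 - IZR p2) < sigma * Rpower Q (- (1 / 2)) /\
    INR q < sigma * Q.

(* After rescaling, [w] is close to the second basis vector and [e] is close to
   the form reading off the first coordinate, which makes the lattice of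
   approximation vectors nearly critical for the unit cube. *)
Lemma critical_flag_unsolvable f t sigma e1 y w e :
  0 < sigma < 1 -> e1 = (1 - sigma) / 10 -> 0 < y ->
  zprimitive w -> zprimitive e -> zdot e w = 0%Z ->
  Rabs (IZR (co0 w)) * y ^ 2 <= e1 -> Rabs (devx w t) <= e1 * y ->
  (1 - e1) * y <= Rabs (devy f w t) <= (1 + e1) * y ->
  sigma * (1 + 2 * e1) < Rabs (IZR (co1 e)) * y <= 1 ->
  Rabs (lform f e t) <= e1 * y ^ 2 ->
  ~ DI_solvable sigma (/ y ^ 2) t (f t).
Proof.
  intros Hs He1 Hy Pw Pe Hew Hq Hx HY Hc1 HF (q' & p1 & p2 & Hq' & Hn & Hqs).
  rewrite (Rpower_inv_sqr y Hy) in Hn; unfold supnorm2 in Hn.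
  assert (Hy2 : 0 < y ^ 2) by (apply pow_lt; auto).
  set (w' := ZVec (Z.of_nat q') p1 p2).
  assert (Hx' : Rabs (devx w' t) <= sigma * y).
  { unfold devx, w'; simpl; rewrite <- INR_IZR_INZ.
    eapply Rle_trans; [apply Rmax_l|apply Rlt_le, Hn]. }
  assert (HY' : Rabs (devy f w' t) < sigma * y).
  { unfold devy, w'; simpl; rewrite <- INR_IZR_INZ.
    eapply Rle_lt_trans; [apply Rmax_r|apply Hn]. }
  assert (Hq1 : Rabs (IZR (co0 w')) * y <= sigma * / y).
  { simpl; rewrite <- INR_IZR_INZ, Rabs_pos_eq by apply pos_INR.
    apply Rlt_le, Rmult_lt_reg_r with (/ y); [apply Rinv_0_lt_compat; auto|].
    replace (INR q' * y * / y) with (INR q') by (field; lra).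
    replace (sigma * / y * / y) with (sigma * / y ^ 2) by (field; lra); auto. }
  (* A nonzero multiple of [w] has vertical deviation at least [(1 - e1) * y], more than
     [sigma * y]. *)
  destruct (classic (zcross w w' = zzero)) as [Z|Z].
  { destruct (primitive_parallel w w' Pw Z) as (z & Ez).
    assert (Hz : z <> 0%Z).
    { apply (zscale_neq0 z w); rewrite <- Ez; intros N; injection N; intros; lia. }
    rewrite Ez, devy_scale in HY'; pose proof (Rabs_scale_ge z (devy f w t) Hz); nra. }
  set (c := zcross w w') in *.
  assert (Hcw : zdot c w = 0%Z) by (unfold c, zdot; simpl; ring).
  (* The product with [q] contributes [sigma * e1], the product with the denominator of the solution
     at most [sigma * (1 + e1)]. The window for [co1 e] starts just above the sum, so [c] is no
     multiple of [e]. *)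
  assert (C1 : Rabs (IZR (co1 c)) * y <= sigma * (1 + 2 * e1)).
  { unfold c; rewrite (co1_cross f w w' t).
    assert (Rabs (IZR (co0 w) * devy f w' t - IZR (co0 w') * devy f w t) <=
      Rabs (IZR (co0 w)) * (sigma * y) + Rabs (IZR (co0 w')) * ((1 + e1) * y)).
    { apply Rabs_cross_le; lra. }
    assert (Rabs (IZR (co0 w')) * y * y <= sigma).
    { apply Rle_trans with (sigma * / y * y); [apply Rmult_le_compat_r; lra|].
      apply Req_le; field; lra. }
    apply Rle_trans with ((Rabs (IZR (co0 w)) * (sigma * y) + Rabs (IZR (co0 w')) * ((1 + e1) * y)) * y).
    - apply Rmult_le_compat_r; lra.
    - replace ((Rabs (IZR (co0 w)) * (sigma * y) + Rabs (IZR (co0 w')) * ((1 + e1) * y)) * y) with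
        (sigma * (Rabs (IZR (co0 w)) * y ^ 2) + (1 + e1) * (Rabs (IZR (co0 w')) * y * y)) by ring.
      nra. }
  assert (CF : Rabs (lform f c t) <= sigma * (1 + 2 * e1) * y ^ 2).
  { unfold c; rewrite lform_cross.
    eapply Rle_trans; [apply (Rabs_cross_le _ _ _ _ (e1 * y) (sigma * y) (sigma * y) ((1 + e1) * y)); lra|].
    apply Req_le; ring. }
  destruct (classic (zcross e c = zzero)) as [Z'|Z'].
  { destruct (primitive_parallel e c Pe Z') as (z & Ez).
    assert (Hz : z <> 0%Z) by (apply (zscale_neq0 z e); rewrite <- Ez; auto).
    rewrite Ez in C1; simpl in C1; rewrite mult_IZR in C1.
    pose proof (Rabs_scale_ge z (IZR (co1 e)) Hz); nra. }
  (* Both lines pass through [w], so their cross product is a nonzero multiple of [w]; its vertical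
     deviation is bounded below by that of [w] and above through [devy_cross]. *)
  assert (Pz : zcross w (zcross e c) = zzero).
  { unfold zdot in *; destruct w as [w0 w1 w2], e as [a0 a1 a2], c as [c0 c1 c2]; simpl in *.
    apply zvec_eq; simpl.
    - transitivity (a0 * (c0 * w0 + c1 * w1 + c2 * w2) - c0 * (a0 * w0 + a1 * w1 + a2 * w2))%Z; [ring|rewrite Hew, Hcw; ring].
    - transitivity (a1 * (c0 * w0 + c1 * w1 + c2 * w2) - c1 * (a0 * w0 + a1 * w1 + a2 * w2))%Z; [ring|rewrite Hew, Hcw; ring].
    - transitivity (a2 * (c0 * w0 + c1 * w1 + c2 * w2) - c2 * (a0 * w0 + a1 * w1 + a2 * w2))%Z; [ring|rewrite Hew, Hcw; ring]. }
  destruct (primitive_parallel w _ Pw Pz) as (z & Ez).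
  assert (Hz : z <> 0%Z) by (apply (zscale_neq0 z w); rewrite <- Ez; auto).
  pose proof (Rabs_scale_ge z (devy f w t) Hz) as HYz.
  rewrite <- devy_scale, <- Ez, devy_cross in HYz.
  assert (X : Rabs (IZR (co1 e) * lform f c t - IZR (co1 c) * lform f e t) * y <=
     sigma * (1 + 2 * e1) * y ^ 2 + sigma * (1 + 2 * e1) * (e1 * y ^ 2)).
  { apply Rle_trans with ((Rabs (IZR (co1 e)) * (sigma * (1 + 2 * e1) * y ^ 2) +
      Rabs (IZR (co1 c)) * (e1 * y ^ 2)) * y).
    - apply Rmult_le_compat_r; [lra|]; apply Rabs_cross_le; lra.
    - replace ((Rabs (IZR (co1 e)) * (sigma * (1 + 2 * e1) * y ^ 2) + Rabs (IZR (co1 c)) * (e1 * y ^ 2)) * y)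
        with (Rabs (IZR (co1 e)) * y * (sigma * (1 + 2 * e1) * y ^ 2) + Rabs (IZR (co1 c)) * y * (e1 * y ^ 2)) by ring.
      assert (0 < sigma * (1 + 2 * e1) * y ^ 2) by (apply Rmult_lt_0_compat; nra).
      apply Rplus_le_compat; [|apply Rmult_le_compat_r; nra].
      rewrite <- (Rmult_1_l (sigma * (1 + 2 * e1) * y ^ 2)) at 2; apply Rmult_le_compat_r; lra. }
  assert (Y : (1 - e1) * y ^ 2 <= sigma * (1 + 2 * e1) * (1 + e1) * y ^ 2).
  { replace ((1 - e1) * y ^ 2) with ((1 - e1) * y * y) by ring; nra. }
  apply Rmult_le_reg_r in Y; auto.
  (* The tenth in [e1] is room enough: [(1 - 10 * e1) * (1 + 2 * e1) * (1 + e1) < 1 - e1]. *)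
  replace sigma with (1 - 10 * e1) in Y by lra; nra.
Qed.

(** * Gaps near rational points *)

Lemma arc_lipschitz f f1 l r k K m s t : convex_arc f f1 l r k K m ->
  l <= s <= r -> l <= t <= r -> Rabs (f t - f s) <= m * Rabs (t - s).
Proof.
  intros H.
  assert (P : forall s t, l <= s -> s <= t -> t <= r -> Rabs (f t - f s) <= m * (t - s)).
  { intros u v Hu Huv Hv.
    destruct (arc_tangent _ _ _ _ _ _ _ H u v Hu Huv Hv) as (T1 & T2).
    pose proof (arc_slope _ _ _ _ _ _ _ H u ltac:(lra)) as S1; apply Rabs_bound in S1.
    pose proof (arc_slope _ _ _ _ _ _ _ H v ltac:(lra)) as S2; apply Rabs_bound in S2.
    apply Rabs_le; nra. }
  intros Hs Ht; destruct (Rle_dec s t).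
  - rewrite (Rabs_pos_eq (t - s)) by lra; apply P; lra.
  - rewrite Rabs_minus_sym, (Rabs_minus_sym t s), (Rabs_pos_eq (s - t)) by lra; apply P; lra.
Qed.

Lemma arc_continuity f f1 l r k K m t : convex_arc f f1 l r k K m -> l < t < r -> continuity_pt f t.
Proof.
  intros H Ht; destruct (arc_consts _ _ _ _ _ _ _ H) as (_ & _ & Hm).
  intros eps Heps.
  exists (Rmin (Rmin (t - l) (r - t)) (eps / (2 * m))); split.
  - repeat apply Rmin_glb_lt; try lra; apply Rdiv_lt_0_compat; lra.
  - intros x (_ & Hx); simpl in *; unfold Rdist in *.
    assert (H1 : Rabs (x - t) < Rmin (t - l) (r - t)) by (eapply Rlt_le_trans; [apply Hx|apply Rmin_l]).
    assert (H2 : Rabs (x - t) < eps / (2 * m)) by (eapply Rlt_le_trans; [apply Hx|apply Rmin_r]).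
    assert (H3 : Rabs (x - t) <= t - l) by (eapply Rle_trans; [apply Rlt_le, H1|apply Rmin_l]).
    assert (H4 : Rabs (x - t) <= r - t) by (eapply Rle_trans; [apply Rlt_le, H1|apply Rmin_r]).
    apply Rabs_bound in H3, H4.
    eapply Rle_lt_trans; [apply (arc_lipschitz f f1 l r k K m t x H); lra|].
    apply Rle_lt_trans with (m * (eps / (2 * m))); [apply Rmult_le_compat_l; lra|].
    replace (m * (eps / (2 * m))) with (eps / 2) by (field; lra); lra.
Qed.

(** Intermediate value theorem: [A * (t - t0)] dominates the perturbation at both ends. The proof
    multiplies the equation by [A], so that the signs at the ends do not depend on that of [A]. *)
Lemma arc_zero f f1 l r k K m A B C t0 d : convex_arc f f1 l r k K m ->
  l < t0 - d -> t0 + d < r -> 0 < d -> A <> 0 ->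
  (forall t, t0 - d <= t <= t0 + d -> Rabs (C + B * f t) < Rabs A * d) ->
  exists t, Rabs (t - t0) <= d /\ A * (t - t0) + (C + B * f t) = 0.
Proof.
  intros H Hl Hr Hd HA Hb.
  set (g := fun t => A * (A * (t - t0) + (C + B * f t))).
  assert (HA2 : 0 < Rabs A) by (apply Rabs_pos_lt; auto).
  assert (HAA : Rabs A * Rabs A = A * A) by (rewrite <- Rabs_mult; apply Rabs_pos_eq; nra).
  assert (Bd : forall t, t0 - d <= t <= t0 + d -> Rabs (A * (C + B * f t)) < A * A * d).
  { intros t Ht; specialize (Hb t Ht); rewrite Rabs_mult, <- HAA; nra. }
  destruct (IVT_interv g (t0 - d) (t0 + d)) as (t & Ht & Et).
  - intros a Ha; unfold g.
    assert (Cf : continuity_pt f a) by (apply (arc_continuity f f1 l r k K m); auto; lra).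
    assert (Ci : continuity_pt id a) by apply derivable_continuous_pt, derivable_pt_id.
    assert (Cc : forall z, continuity_pt (fct_cte z) a) by (intros z; apply continuity_pt_const; intros ? ?; auto).
    apply (continuity_pt_mult (fct_cte A) (fun t => A * (t - t0) + (C + B * f t))); [apply Cc|].
    apply (continuity_pt_plus (fun t => A * (t - t0)) (fun t => C + B * f t)).
    + apply (continuity_pt_mult (fct_cte A) (fun t => t - t0)); [apply Cc|].
      apply (continuity_pt_minus id (fct_cte t0)); [apply Ci|apply Cc].
    + apply (continuity_pt_plus (fct_cte C) (fun t => B * f t)); [apply Cc|].
      apply (continuity_pt_mult (fct_cte B) f); [apply Cc|apply Cf].
  - lra.
  - unfold g; pose proof (Bd (t0 - d) ltac:(lra)) as X.
    pose proof (Rle_abs (A * (C + B * f (t0 - d)))); nra.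
  - unfold g; pose proof (Bd (t0 + d) ltac:(lra)) as X.
    pose proof (Rle_abs (- (A * (C + B * f (t0 + d))))) as Y; rewrite Rabs_Ropp in Y; nra.
  - exists t; split; [apply Rabs_le; lra|].
    unfold g in Et; apply Rmult_integral in Et as [Et|Et]; [contradiction|exact Et].
Qed.

Lemma devy_lipschitz f f1 l r k K m w s t : convex_arc f f1 l r k K m ->
  l <= s <= r -> l <= t <= r ->
  Rabs (devy f w t - devy f w s) <= Rabs (IZR (co0 w)) * (m * Rabs (t - s)).
Proof.
  intros H Hs Ht; replace (devy f w t - devy f w s) with (IZR (co0 w) * (f t - f s)) by (unfold devy; ring).
  rewrite Rabs_mult; apply Rmult_le_compat_l; [apply Rabs_pos|].
  apply (arc_lipschitz f f1 l r k K m); auto.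
Qed.

Lemma lform_lipschitz f f1 l r k K m c s t : convex_arc f f1 l r k K m ->
  l <= s <= r -> l <= t <= r ->
  Rabs (lform f c t - lform f c s) <= (Rabs (IZR (co1 c)) + Rabs (IZR (co2 c)) * m) * Rabs (t - s).
Proof.
  intros H Hs Ht; replace (lform f c t - lform f c s) with
    (IZR (co1 c) * (t - s) + IZR (co2 c) * (f t - f s)) by (unfold lform; ring).
  eapply Rle_trans; [apply Rabs_triang|]; rewrite !Rabs_mult.
  pose proof (arc_lipschitz f f1 l r k K m s t H Hs Ht).
  pose proof (Rabs_pos (IZR (co2 c))); nra.
Qed.

(* The complementary lines [c' + k c] through [w] have first coefficients in an
   arithmetic progression of step [co1 c], one of which lands in the window
   required of [e]; the lower bound on [co1 c] keeps [e] nearly vertical, so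
   that it crosses the arc next to the foot of [w]. *)
Lemma gap_at_foot f f1 l r k K m sigma e1 e2 e3 u kap1 w y t0 :
  convex_arc f f1 l r k K m ->
  0 < sigma < 1 -> e1 = (1 - sigma) / 10 -> e2 = e1 / m -> e3 = e2 / 8 -> u = (1 - sigma) / 2 ->
  kap1 = (1 + 1 / u) / (sigma * (1 + 2 * e1) * e3) ->
  zprimitive w -> (0 < co0 w)%Z -> devx w t0 = 0 -> 0 < y -> Rabs (devy f w t0) = y ->
  IZR (co0 w) * y ^ 2 <= e2 -> l < t0 - y / IZR (co0 w) -> t0 + y / IZR (co0 w) < r ->
  (forall c, c <> zzero -> zdot c w = 0%Z -> Rabs (IZR (co1 c)) <= kap1 * IZR (co0 w) * y ->
     Rabs (IZR (co2 c)) <= IZR (co0 w) * y / u -> False) ->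
  exists t1, Rabs (t1 - t0) <= e2 * y / (2 * IZR (co0 w)) /\
    forall t, Rabs (t - t1) <= e1 * y ^ 3 / 2 -> ~ DI_solvable sigma (/ y ^ 2) t (f t).
Proof.
  intros H Hs He1 He2 He3 Hu Hkap Pw Hq0 Hx0 Hy HY Hqy Hl Hr NB.
  destruct (arc_consts _ _ _ _ _ _ _ H) as (_ & _ & Hm).
  set (q := IZR (co0 w)) in *.
  assert (Hq : 1 <= q) by (apply IZR_le; lia).
  assert (Hqa : Rabs q = q) by (apply Rabs_pos_eq; lra).
  assert (P1 : 0 < e1 <= 1 / 10) by lra.
  assert (E2 : e2 * m = e1) by (rewrite He2; field; lra).
  assert (P2 : 0 < e2 <= e1) by (split; [rewrite He2; apply Rdiv_lt_0_compat; lra|nra]).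
  assert (Pu : 0 < u) by lra.
  assert (He2y : 0 < e2 * y <= y / 10).
  { split; [apply Rmult_lt_0_compat; lra|].
    replace (y / 10) with (/ 10 * y) by field; apply Rmult_le_compat_r; lra. }
  set (s2 := sigma * (1 + 2 * e1)) in *.
  assert (Ps2 : 0 < s2) by (unfold s2; apply Rmult_lt_0_compat; lra).
  (* The step [co1 c] will be at most [u / y], and the window from [s2 / y] to [1 / y] has at least
     this length. *)
  assert (Hwin : u <= 1 - s2) by (unfold s2; rewrite Hu, He1; nra).
  assert (P3 : 0 < e3) by lra.
  assert (Pk : 0 < kap1).
  { rewrite Hkap; apply Rdiv_lt_0_compat; [|apply Rmult_lt_0_compat; lra].
    assert (0 < 1 / u) by (apply Rdiv_lt_0_compat; lra); lra. }
  assert (Hqy0 : 0 < q * y) by (apply Rmult_lt_0_compat; lra).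
  destruct (exists_line_through w (u / y) (q * y / u)) as (c & Pc & Hcw & Hc1 & Hc2); auto.
  { apply Rdiv_lt_0_compat; lra. }
  { apply Rdiv_lt_0_compat; lra. }
  { fold q; apply Req_le; field; lra. }
  assert (Hc1' : kap1 * q * y < Rabs (IZR (co1 c))).
  { destruct (Rlt_le_dec (kap1 * q * y) (Rabs (IZR (co1 c)))); auto.
    exfalso; apply (NB c); auto using primitive_neq0. }
  assert (Hc10 : IZR (co1 c) <> 0).
  { intros Z; rewrite Z, Rabs_R0 in Hc1'; assert (0 < kap1 * (q * y)) by (apply Rmult_lt_0_compat; lra); lra. }
  destruct (line_complement w c Pw Pc Hcw) as (c' & He).
  destruct (exists_translate (IZR (co1 c')) (IZR (co1 c)) (s2 / y) (1 / y) Hc10) as (z & Hz).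
  { replace (1 / y - s2 / y) with ((1 - s2) / y) by (field; lra).
    eapply Rle_trans; [apply Hc1|]; apply Rmult_le_compat_r; [apply Rlt_le, Rinv_0_lt_compat|]; lra. }
  destruct (He z) as (Hew & Hce & Pe); set (e := zadd c' (zscale z c)) in *; clear He.
  assert (He1c : IZR (co1 e) = IZR (co1 c') + IZR z * IZR (co1 c)).
  { unfold e; simpl; rewrite plus_IZR, mult_IZR; reflexivity. }
  rewrite <- He1c in Hz.
  set (a := IZR (co1 e)) in *.
  assert (Ha0 : 0 < s2 / y) by (apply Rdiv_lt_0_compat; lra).
  assert (Haa : Rabs a = a) by (apply Rabs_pos_eq; lra).
  assert (Hay : s2 < a * y <= 1).
  { destruct Hz as (Z1 & Z2); split.
    - apply Rmult_lt_compat_r with (r := y) in Z1; auto.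
      replace (s2 / y * y) with s2 in Z1 by (field; lra); lra.
    - apply Rmult_le_compat_r with (r := y) in Z2; [|lra].
      replace (1 / y * y) with 1 in Z2 by (field; lra); lra. }
  (* The first coordinate of [c x e = - w] bounds [|co1 c| * |co2 e|] by [q * (1 + 1 / u)]; [kap1]
     is made so that the lower bound on [co1 c] then yields [e3 * a]. *)
  assert (Hb : Rabs (IZR (co2 e)) <= e3 * a).
  { apply (f_equal co0) in Hce; apply IZR_eq in Hce.
    unfold zcross, zscale in Hce; cbn [co0 co1 co2] in Hce.
    rewrite minus_IZR, !mult_IZR in Hce; fold q a in Hce.
    assert (X : Rabs (IZR (co1 c)) * Rabs (IZR (co2 e)) <= q * (1 + 1 / u)).
    { rewrite <- Rabs_mult.
      replace (IZR (co1 c) * IZR (co2 e)) with (IZR (co2 c) * a + - q) by lra.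
      eapply Rle_trans; [apply Rabs_triang|]; rewrite Rabs_Ropp, Hqa, Rabs_mult, Haa.
      assert (Rabs (IZR (co2 c)) * a <= q * y / u * a) by (apply Rmult_le_compat_r; lra).
      replace (q * y / u * a) with (q * (1 / u) * (a * y)) in H0 by (field; lra).
      assert (0 < q * (1 / u)) by (apply Rmult_lt_0_compat; [lra|apply Rdiv_lt_0_compat; lra]).
      assert (q * (1 / u) * (a * y) <= q * (1 / u) * 1) by (apply Rmult_le_compat_l; lra).
      lra. }
    assert (Y : kap1 * q * y * Rabs (IZR (co2 e)) <= kap1 * q * y * (e3 * a)).
    { apply Rle_trans with (q * (1 + 1 / u)).
      - eapply Rle_trans; [|apply X]; apply Rmult_le_compat_r; [apply Rabs_pos|lra].
      - replace (q * (1 + 1 / u)) with (kap1 * e3 * q * s2).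
        + replace (kap1 * q * y * (e3 * a)) with (kap1 * e3 * q * (a * y)) by ring.
          apply Rmult_le_compat_l; [|lra].
          apply Rmult_le_pos; [apply Rmult_le_pos|]; lra.
        + rewrite Hkap; field; split; [lra|split; lra]. }
    apply Rmult_le_reg_l in Y; auto.
    rewrite Rmult_assoc; apply Rmult_lt_0_compat; lra. }
  set (b := IZR (co2 e)) in *.
  set (d := e2 * y / (2 * q)).
  assert (Hd : 0 < d) by (unfold d; apply Rdiv_lt_0_compat; lra).
  assert (Hqd : q * d = e2 * y / 2) by (unfold d; field; lra).
  assert (Hdy : d <= y / q / 20).
  { apply Rmult_le_reg_l with q; [lra|].
    replace (q * (y / q / 20)) with (y / 20) by (field; lra); lra. }
  assert (Hyq : 0 < y / q) by (apply Rdiv_lt_0_compat; lra).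
  assert (DY : forall t, Rabs (t - t0) <= e2 * y / q -> l <= t <= r /\
      (1 - e1) * y <= Rabs (devy f w t) <= (1 + e1) * y).
  { intros t Ht.
    assert (Hty : e2 * y / q <= y / q).
    { unfold Rdiv; apply Rmult_le_compat_r; [apply Rlt_le, Rinv_0_lt_compat; lra|lra]. }
    assert (Htlr : l <= t <= r) by (apply Rabs_bound in Ht; lra).
    split; auto.
    assert (Htlr0 : l <= t0 <= r) by lra.
    pose proof (devy_lipschitz f f1 l r k K m w t0 t H Htlr0 Htlr) as D; fold q in D; rewrite Hqa in D.
    assert (Rabs (devy f w t - devy f w t0) <= e1 * y).
    { eapply Rle_trans; [apply D|].
      apply Rle_trans with (q * (m * (e2 * y / q))).
      - apply Rmult_le_compat_l; [lra|]; apply Rmult_le_compat_l; lra.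
      - replace (q * (m * (e2 * y / q))) with (e2 * m * y) by (field; lra); rewrite E2; lra. }
    pose proof (Rabs_triang_inv (devy f w t) (devy f w t0)) as T1.
    pose proof (Rabs_triang_inv (devy f w t0) (devy f w t)) as T2.
    rewrite (Rabs_minus_sym (devy f w t0)) in T2; rewrite HY in *; lra. }
  assert (Hdd : d <= e2 * y / q).
  { replace (e2 * y / q) with (2 * d) by (unfold d; field; lra); lra. }
  (* The equation is [q * lform f e t = 0], that is [a * q * (t - t0) + b * devy f w t = 0]. The
     perturbation is at most [e3 * a * (1 + e1) * y], below [a * q * d = a * e2 * y / 2] as
     [e3 = e2 / 8]. *)
  destruct (arc_zero f f1 l r k K m (a * q) (b * q) (- b * IZR (co2 w)) t0 d H) as (t1 & Ht1 & E1); try lra.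
  { apply Rgt_not_eq, Rmult_lt_0_compat; lra. }
  { intros t Ht; replace (- b * IZR (co2 w) + b * q * f t) with (b * devy f w t) by (unfold devy; fold q; ring).
    destruct (DY t) as (_ & _ & DYt); [apply Rabs_le; lra|].
    rewrite !Rabs_mult, Hqa, Haa, Rmult_assoc, Hqd.
    apply Rle_lt_trans with (e3 * a * ((1 + e1) * y)).
    - apply Rmult_le_compat; auto using Rabs_pos.
    - replace (e3 * a * ((1 + e1) * y)) with (a * (e2 * y) * ((1 + e1) / 8)) by (rewrite He3; field).
      replace (a * (e2 * y / 2)) with (a * (e2 * y) * (/ 2)) by field.
      apply Rmult_lt_compat_l; [apply Rmult_lt_0_compat|]; lra. }
  assert (F1 : lform f e t1 = 0).
  { apply Rmult_eq_reg_l with q; [|lra]; rewrite Rmult_0_r.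
    unfold q; rewrite (lform_incident f e w t1 Hew).
    rewrite (devx_shift w t0 t1), Hx0; fold q a b; unfold devy; fold q; lra. }
  exists t1; split; [exact Ht1|].
  intros t Ht.
  assert (Hq2 : q * (e1 * y ^ 3 / 2) <= e2 * y / 20).
  { replace (q * (e1 * y ^ 3 / 2)) with (q * y ^ 2 * (e1 * y / 2)) by field.
    assert (0 < e1 * y <= y / 10).
    { split; [apply Rmult_lt_0_compat; lra|].
      replace (y / 10) with (/ 10 * y) by field; apply Rmult_le_compat_r; lra. }
    apply Rle_trans with (e2 * (y / 20)); [|lra].
    apply Rmult_le_compat; try lra; apply Rmult_le_pos; [lra|apply pow2_ge_0]. }
  assert (Htt : q * Rabs (t - t0) <= e2 * y * (11 / 20)).
  { replace (t - t0) with ((t - t1) + (t1 - t0)) by ring.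
    pose proof (Rabs_triang (t - t1) (t1 - t0)).
    apply Rle_trans with (q * (e1 * y ^ 3 / 2 + d)); [apply Rmult_le_compat_l; lra|lra]. }
  assert (Ht2 : Rabs (t - t0) <= e2 * y / q).
  { apply Rmult_le_reg_l with q; [lra|]; replace (q * (e2 * y / q)) with (e2 * y) by (field; lra).
    lra. }
  destruct (DY t Ht2) as (Htlr & DYt).
  destruct (DY t1 ltac:(lra)) as (Ht1lr & _).
  apply (critical_flag_unsolvable f t sigma e1 y w e); auto.
  - fold q; rewrite Hqa; lra.
  - rewrite (devx_shift w t0 t), Hx0, Rplus_0_l; fold q; rewrite Rabs_mult, Hqa.
    assert (e2 * y <= e1 * y) by (apply Rmult_le_compat_r; lra); lra.
  - fold a; rewrite Haa; exact Hay.
  - pose proof (lform_lipschitz f f1 l r k K m e t1 t H Ht1lr Htlr) as L.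
    rewrite F1, Rminus_0_r in L; fold a b in L; rewrite Haa in L.
    eapply Rle_trans; [apply L|].
    assert (Hbm : Rabs b * m <= a).
    { apply Rle_trans with (e3 * a * m); [apply Rmult_le_compat_r; lra|].
      replace (e3 * a * m) with (e2 * m / 8 * a) by (rewrite He3; field); rewrite E2.
      rewrite <- (Rmult_1_l a) at 2; apply Rmult_le_compat_r; lra. }
    apply Rle_trans with (2 * a * (e1 * y ^ 3 / 2)).
    + apply Rmult_le_compat; try lra; [|apply Rabs_pos].
      apply Rplus_le_le_0_compat; [lra|apply Rmult_le_pos; [apply Rabs_pos|lra]].
    + replace (2 * a * (e1 * y ^ 3 / 2)) with (a * y * (e1 * y ^ 2)) by field.
      rewrite <- (Rmult_1_l (e1 * y ^ 2)) at 2; apply Rmult_le_compat_r; [|lra].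
      apply Rmult_le_pos; [lra|apply pow2_ge_0].
Qed.

Lemma devn_variation f f1 l r k K m w s t b : convex_arc f f1 l r k K m ->
  l <= s <= r -> l <= t <= r -> Rabs (IZR (co0 w)) * Rabs (t - s) <= b ->
  Rabs (devx w s) <= b -> Rabs (devx w t) <= b ->
  Rabs (devn f f1 w t - devn f f1 w s) <= K * Rabs (t - s) * (2 * b).
Proof.
  intros H Hs Ht Hq Hx Hx'; destruct (Rle_dec s t).
  - rewrite (Rabs_pos_eq (t - s)) in * by lra.
    apply (devn_shift f f1 l r k K m w s t b); auto; lra.
  - rewrite Rabs_minus_sym, (Rabs_minus_sym t s) in *.
    rewrite (Rabs_pos_eq (s - t)) in * by lra.
    apply (devn_shift f f1 l r k K m w t s b); auto; lra.
Qed.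

Lemma near_point_positive f f1 a b c t : b < 1 -> c < 1 -> near_point f f1 a b c t ->
  exists w, zprimitive w /\ (0 < co0 w)%Z /\ IZR (co0 w) <= a /\
    Rabs (devx w t) <= b /\ Rabs (devn f f1 w t) <= c.
Proof.
  intros Hb Hc Hn; destruct (near_point_primitive _ _ _ _ _ _ Hn) as (w & P & Ha & Hx & Hd).
  destruct (Z.lt_trichotomy (co0 w) 0) as [L|[E|L]].
  - exists (zscale (-1) w); destruct P as (v & Hv); split; [|split; [|split; [|split]]].
    + exists (zscale (-1) v); rewrite <- Hv; unfold zdot, zscale; cbn [co0 co1 co2]; ring.
    + unfold zscale; cbn [co0]; lia.
    + unfold zscale; cbn [co0]; rewrite mult_IZR.
      rewrite Rabs_left in Ha by (apply IZR_lt; auto); lra.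
    + rewrite devx_scale; replace (-1 * devx w t) with (- devx w t) by ring; rewrite Rabs_Ropp; auto.
    + replace (devn f f1 (zscale (-1) w) t) with (- devn f f1 w t).
      * rewrite Rabs_Ropp; auto.
      * unfold devn; rewrite devx_scale, devy_scale; ring.
  - exfalso; apply (near_point_empty f f1 0 b c t); try lra.
    exists w; rewrite E, Rabs_R0; repeat split; auto using primitive_neq0; lra.
  - exists w; rewrite Rabs_pos_eq in Ha by (apply IZR_le; lia); auto.
Qed.

(** The box [eps * S ^ 2], [4 / (eps * S)], [1 / S] has product 4, so it contains a point [w]. The
    first two exclusions bound its displacement and [q] from below, the third serves the last
    hypothesis of [gap_at_foot], and [eps <= e2 / 4] gives [q * y ^ 2 <= e2]. The way from [s] to
    [t1] is at most [b / q] to the foot plus [1 / (S * q)]. *)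
Lemma gap_near f f1 l r k K m sigma e1 e2 e3 u kap1 C1 eps eta S s :
  convex_arc f f1 l r k K m ->
  0 < sigma < 1 -> e1 = (1 - sigma) / 10 -> e2 = e1 / m -> e3 = e2 / 8 -> u = (1 - sigma) / 2 ->
  kap1 = (1 + 1 / u) / (sigma * (1 + 2 * e1) * e3) -> C1 = kap1 + 2 * m / u ->
  0 < eps <= e2 / 4 -> 0 < eta <= 1 -> 4 / eps < S -> 64 * K / (eps ^ 2 * eta) <= S ->
  l + (4 / eps + 2) / S < s -> s + (4 / eps + 2) / S < r ->
  ~ near_point f f1 (eps * S ^ 2) (4 / (eps * S)) (eta / S) s ->
  ~ near_point f f1 (eta * eps * S ^ 2) (4 / (eps * S)) (1 / S) s ->
  ~ near_line f f1 (2 * C1 * eps * S) (2 * C1 * eps * S) (8 * C1 / (eps * S ^ 2)) s ->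
  exists t1 y, eta / (2 * S) <= y <= 2 / S /\
    Rabs (t1 - s) <= 5 / (eta * eps ^ 2 * S ^ 3) /\
    forall t, Rabs (t - t1) <= e1 * y ^ 3 / 2 -> ~ DI_solvable sigma (/ y ^ 2) t (f t).
Proof.
  intros H Hs He1 He2 He3 Hu Hkap HC1 Heps Heta HS HSK Hl Hr NV1 NV2 NF.
  destruct (arc_consts _ _ _ _ _ _ _ H) as (Hk & HK & Hm).
  assert (P1 : 0 < e1 <= 1 / 10) by lra.
  assert (E2 : e2 * m = e1) by (rewrite He2; field; lra).
  assert (P2 : 0 < e2 <= e1) by (split; [rewrite He2; apply Rdiv_lt_0_compat; lra|nra]).
  assert (Pu : 0 < u) by lra.
  assert (Pk : 0 < kap1).
  { rewrite Hkap; apply Rdiv_lt_0_compat.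
    - assert (0 < 1 / u) by (apply Rdiv_lt_0_compat; lra); lra.
    - repeat apply Rmult_lt_0_compat; lra. }
  assert (He4 : 4 <= 4 / eps).
  { apply Rmult_le_reg_r with eps; [lra|]; replace (4 / eps * eps) with 4 by (field; lra); lra. }
  set (b := 4 / (eps * S)).
  assert (HeS : 4 < eps * S).
  { apply Rmult_lt_compat_l with (r := eps) in HS; [|lra].
    replace (eps * (4 / eps)) with 4 in HS by (field; lra); lra. }
  assert (Hb0 : 0 < b) by (apply Rdiv_lt_0_compat; lra).
  assert (Hb1 : b < 1).
  { apply Rmult_lt_reg_r with (eps * S); [lra|].
    unfold b; replace (4 / (eps * S) * (eps * S)) with 4 by (field; lra); lra. }
  assert (HS1 : 0 < 1 / S) by (apply Rdiv_lt_0_compat; lra).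
  assert (HSb : 1 / S <= b).
  { unfold b; replace (4 / (eps * S)) with (4 / eps * (1 / S)) by (field; lra).
    rewrite <- (Rmult_1_l (1 / S)) at 1; apply Rmult_le_compat_r; lra. }
  destruct (near_point_positive f f1 (eps * S ^ 2) b (1 / S) s) as (w & Pw & Hq0 & Hq & Hx & Hn); try lra.
  { apply exists_near_point; try lra; apply Req_le; unfold b; field; lra. }
  set (q := IZR (co0 w)) in *.
  assert (Hq1 : 1 <= q) by (apply IZR_le; lia).
  assert (Hqa : Rabs q = q) by (apply Rabs_pos_eq; lra).
  assert (Hn' : eta / S < Rabs (devn f f1 w s)).
  { destruct (Rlt_le_dec (eta / S) (Rabs (devn f f1 w s))); auto; exfalso; apply NV1.
    exists w; fold q b; rewrite Hqa; auto using primitive_neq0. }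
  assert (Hq' : eta * eps * S ^ 2 < q).
  { destruct (Rlt_le_dec (eta * eps * S ^ 2) q); auto; exfalso; apply NV2.
    exists w; fold q b; rewrite Hqa; auto using primitive_neq0. }
  set (t0 := IZR (co1 w) / q).
  assert (Hx0 : devx w t0 = 0) by (unfold devx, t0; fold q; field; lra).
  assert (Hts : q * Rabs (t0 - s) = Rabs (devx w s)).
  { rewrite (devx_shift w t0 s), Hx0, Rplus_0_l; fold q; rewrite Rabs_mult, Hqa, (Rabs_minus_sym s); auto. }
  assert (Htsb : Rabs (t0 - s) <= b) by (pose proof (Rabs_pos (t0 - s)); nra).
  assert (HM : (4 / eps + 2) / S = b + 2 / S) by (unfold b; field; lra).
  assert (H2S : 0 < 2 / S) by (apply Rdiv_lt_0_compat; lra).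
  assert (Ht0 : l + 2 / S < t0 /\ t0 + 2 / S < r) by (apply Rabs_bound in Htsb; lra).
  set (y := Rabs (devy f w t0)).
  (* At the foot [devx] vanishes, so the vertical and the transversal deviation agree and the bounds
     on [devn] at [s] carry over to [y]. *)
  assert (Hyn : y = Rabs (devn f f1 w t0)) by (unfold devn; rewrite Hx0; unfold y; f_equal; ring).
  assert (Hvar : Rabs (devn f f1 w t0 - devn f f1 w s) <= eta / (2 * S)).
  { eapply Rle_trans; [apply (devn_variation f f1 l r k K m w s t0 b H); try lra|].
    - fold q; rewrite Hqa; lra.
    - rewrite Hx0, Rabs_R0; lra.
    - apply Rle_trans with (K * b * (2 * b)).
      + apply Rmult_le_compat_r; [lra|]; apply Rmult_le_compat_l; lra.
      + replace (eta / (2 * S)) with (S * (eta / (2 * S ^ 2))) by (field; lra).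
        replace (K * b * (2 * b)) with (64 * K / (eps ^ 2 * eta) * (eta / (2 * S ^ 2))) by (unfold b; field; lra).
        apply Rmult_le_compat_r; auto; apply Rlt_le, Rdiv_lt_0_compat; [lra|].
        apply Rmult_lt_0_compat; [lra|apply pow_lt; lra]. }
  assert (HetaS : 0 < eta / (2 * S) <= / 2 * (1 / S)).
  { split; [apply Rdiv_lt_0_compat; lra|].
    replace (/ 2 * (1 / S)) with (1 / (2 * S)) by (field; lra).
    apply Rmult_le_compat_r; [apply Rlt_le, Rinv_0_lt_compat|]; lra. }
  assert (Hy : eta / (2 * S) <= y <= 2 / S).
  { rewrite Hyn; pose proof (Rabs_triang_inv (devn f f1 w s) (devn f f1 w t0)) as T1.
    pose proof (Rabs_triang_inv (devn f f1 w t0) (devn f f1 w s)) as T2.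
    rewrite (Rabs_minus_sym (devn f f1 w s)) in T1.
    replace (eta / S) with (2 * (eta / (2 * S))) in Hn' by (field; lra).
    replace (2 / S) with (2 * (1 / S)) by (field; lra); lra. }
  assert (Hqy : q * y <= 2 * eps * S).
  { replace (2 * eps * S) with (eps * S ^ 2 * (2 / S)) by (field; lra).
    apply Rmult_le_compat; lra. }
  assert (Hqy0 : 0 < q * y) by (apply Rmult_lt_0_compat; lra).
  assert (Hyq : y / q <= 2 / S).
  { apply Rmult_le_reg_r with q; [lra|]; replace (y / q * q) with y by (field; lra).
    apply Rle_trans with (2 / S * 1); [lra|apply Rmult_le_compat_l; lra]. }
  assert (Hmu : 1 / u <= m / u) by (apply Rmult_le_compat_r; [apply Rlt_le, Rinv_0_lt_compat|]; lra).
  assert (Hu1 : 0 < 1 / u) by (apply Rdiv_lt_0_compat; lra).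
  destruct (gap_at_foot f f1 l r k K m sigma e1 e2 e3 u kap1 w y t0 H) as (t1 & Ht1 & Gap); auto; fold q; try lra.
  { replace (q * y ^ 2) with (q * y * y) by ring.
    apply Rle_trans with (2 * eps * S * (2 / S)); [apply Rmult_le_compat; lra|].
    replace (2 * eps * S * (2 / S)) with (4 * eps) by (field; lra); lra. }
  (* A line through [w] of small height is small at [s] too, since its value there comes from the
     deviations of [w]. The sum [C1 = kap1 + 2 * m / u] collects both terms, with [2 * m * b]
     bounding [devy f w s]. *)
  { intros c Nc Hcw Hc1 Hc2; apply NF; exists c; fold q in Hc1, Hc2.
    replace (q * y / u) with (1 / u * (q * y)) in Hc2 by (field; lra).
    replace (2 * m / u) with (2 * (m / u)) in HC1 by (field; lra).
    assert (0 <= Rabs (IZR (co2 c))) by apply Rabs_pos.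
    assert (Hc2m : m * Rabs (IZR (co2 c)) <= m / u * (q * y)).
    { replace (m / u * (q * y)) with (m * (1 / u * (q * y))) by (field; lra); apply Rmult_le_compat_l; lra. }
    assert (Q1 : 0 < m / u * (q * y)) by (apply Rmult_lt_0_compat; lra).
    assert (Q2 : 0 < kap1 * (q * y)) by (apply Rmult_lt_0_compat; lra).
    assert (Q3 : C1 * (q * y) <= 2 * C1 * eps * S).
    { replace (2 * C1 * eps * S) with (C1 * (2 * eps * S)) by ring; apply Rmult_le_compat_l; lra. }
    assert (Hf1 : Rabs (f1 s) <= m) by (apply (arc_slope _ _ _ _ _ _ _ H); lra).
    split; [auto|split; [|split]].
    - unfold dform; eapply Rle_trans; [apply Rabs_triang|]; rewrite Rabs_mult.
      assert (Rabs (IZR (co2 c)) * Rabs (f1 s) <= Rabs (IZR (co2 c)) * m) by (apply Rmult_le_compat_l; lra).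
      rewrite HC1 in Q3 at 1; lra.
    - assert (1 / u * (q * y) <= m / u * (q * y)) by (apply Rmult_le_compat_r; lra).
      rewrite HC1 in Q3 at 1; lra.
    - assert (Hdy : Rabs (devy f w s) <= 2 * m * b).
      { replace (devy f w s) with (devn f f1 w s + f1 s * devx w s) by (unfold devn; ring).
        eapply Rle_trans; [apply Rabs_triang|].
        pose proof (Rabs_mult_le (f1 s) (devx w s) m b Hf1 Hx).
        assert (1 * b <= m * b) by (apply Rmult_le_compat_r; lra); lra. }
      assert (L : Rabs (IZR (co1 c) * devx w s + IZR (co2 c) * devy f w s) <= C1 * (q * y) * b).
      { eapply Rle_trans; [apply Rabs_triang|].
        assert (Rabs (IZR (co1 c) * devx w s) <= kap1 * (q * y) * b).
        { apply Rabs_mult_le; lra. }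
        assert (Rabs (IZR (co2 c) * devy f w s) <= 1 / u * (q * y) * (2 * m * b)).
        { apply Rabs_mult_le; lra. }
        rewrite HC1.
        replace ((kap1 + 2 * (m / u)) * (q * y) * b) with
          (kap1 * (q * y) * b + 1 / u * (q * y) * (2 * m * b)) by (field; lra); lra. }
      rewrite <- (lform_incident f c w s Hcw) in L; fold q in L; rewrite Rabs_mult, Hqa in L.
      apply Rmult_le_reg_l with q; [lra|]; eapply Rle_trans; [apply L|].
      replace (q * (8 * C1 / (eps * S ^ 2))) with (C1 * q * b * (2 / S)) by (unfold b; field; lra).
      replace (C1 * (q * y) * b) with (C1 * q * b * y) by ring.
      apply Rmult_le_compat_l; [|lra].
      apply Rmult_le_pos; [apply Rmult_le_pos|]; lra. }
  exists t1, y; split; [auto|split; auto].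
  replace (t1 - s) with ((t1 - t0) + (t0 - s)) by ring.
  eapply Rle_trans; [apply Rabs_triang|].
  assert (A1 : Rabs (t0 - s) <= b / q).
  { apply Rmult_le_reg_l with q; [lra|]; replace (q * (b / q)) with b by (field; lra); lra. }
  assert (A2 : e2 * y / (2 * q) <= 1 / S / q).
  { replace (e2 * y / (2 * q)) with (e2 * y / 2 / q) by (field; lra).
    apply Rmult_le_compat_r; [apply Rlt_le, Rinv_0_lt_compat; lra|].
    assert (e2 * y <= 1 * (2 / S)) by (apply Rmult_le_compat; lra).
    replace (2 / S) with (2 * (1 / S)) in H0 by (field; lra); lra. }
  assert (A3 : b / q + 1 / S / q <= (5 / (eps * S)) / (eta * eps * S ^ 2)).
  { replace (b / q + 1 / S / q) with ((b + 1 / S) / q) by (field; lra).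
    assert (HE : 0 < eta * eps * S ^ 2) by (repeat apply Rmult_lt_0_compat; try lra; apply pow_lt; lra).
    apply Rmult_le_compat.
    - lra.
    - apply Rlt_le, Rinv_0_lt_compat; lra.
    - replace (5 / (eps * S)) with (b + 1 / (eps * S)) by (unfold b; field; lra).
      apply Rplus_le_compat_l; replace (1 / (eps * S)) with (1 / eps * (1 / S)) by (field; lra).
      replace (4 / eps) with (4 * (1 / eps)) in He4 by (field; lra).
      rewrite <- (Rmult_1_l (1 / S)) at 1; apply Rmult_le_compat_r; lra.
    - apply Rinv_le_contravar; lra. }
  replace (5 / (eta * eps ^ 2 * S ^ 3)) with (5 / (eps * S) / (eta * eps * S ^ 2)) by (field; lra).
  fold q in Ht1; lra.
Qed.

(** * Measure of the exceptional set and contraction on an arc *)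

Lemma list_bounded (L : list R) : exists M, forall c, In c L -> c <= M.
Proof.
  induction L as [|x L (M & H)]; [exists 0; intros c []|].
  exists (Rmax x M); intros c [<-|Hc]; [apply Rmax_l|].
  eapply Rle_trans; [apply H, Hc|apply Rmax_r].
Qed.

Lemma pow2_unbounded a : exists n, a < 2 ^ n.
Proof.
  destruct (Pow_x_infinity 2 ltac:(rewrite Rabs_pos_eq; lra) (a + 1)) as (n & Hn).
  exists n; specialize (Hn n ltac:(lia)); rewrite Rabs_pos_eq in Hn by (apply pow_le; lra); lra.
Qed.

Lemma div_le_iff x y z : 0 < z -> x <= y * z -> x / z <= y.
Proof.
  intros Hz H; apply Rmult_le_reg_r with z; auto.
  unfold Rdiv; rewrite Rmult_assoc, Rinv_l; lra.
Qed.

(** Both point boxes have product [4 * eta], which [eta] makes small against [N ^ 8]; the line box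
    is made small by [eps]. All remaining conditions of the measure lemmas hold for large [S]. The
    constant is 112 + 112 + 160. *)
Lemma exceptional_measure f f1 l r k K m j0 j1 N C1 eps eta :
  convex_arc f f1 l r k K m -> l <= j0 -> j0 < j1 -> j1 < r ->
  100 <= N -> 12 * (K / k) <= N -> 1 <= C1 -> 0 < eps <= 1 ->
  1000 * C1 ^ 3 * N ^ 6 * eps <= 1 -> 0 < eta <= 1 -> 4 * eta * N ^ 8 <= 1 ->
  exists S0, forall S, S0 <= S ->
    fcov (fun t =>
      (near_point f f1 (eps * S ^ 2) (4 / (eps * S)) (eta / S) t \/
       near_point f f1 (eta * eps * S ^ 2) (4 / (eps * S)) (1 / S) t \/
       near_line f f1 (2 * C1 * eps * S) (2 * C1 * eps * S) (8 * C1 / (eps * S ^ 2)) t)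
      /\ j0 <= t <= j1) (384 * (K / k) / N * (j1 - j0)).
Proof.
  intros H Hl Hj Hr HN HNk HC Heps HCe Heta HeN.
  destruct (arc_consts _ _ _ _ _ _ _ H) as (Hk & HK & _).
  set (d := Rmin (Rmin 1 (j1 - j0)) (r - j1)).
  assert (Hd : 0 < d <= 1 /\ d <= j1 - j0 /\ j1 + d <= r).
  { unfold d, Rmin; repeat destruct Rle_dec; lra. }
  destruct Hd as (Hd & Hd1 & Hd2).
  assert (Hd2p : 0 < d ^ 2) by (apply pow_lt; lra).
  assert (HNp : forall i, 0 < N ^ i) by (intros; apply pow_lt; lra).
  assert (HCp : forall i, 0 < C1 ^ i) by (intros; apply pow_lt; lra).
  assert (Hep : 0 < eps ^ 2) by (apply pow_lt; lra).
  destruct (list_bounded [2; 64 * K * N ^ 4 / (eps ^ 2 * eta); 4 * N / (eps * d);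
    24 * N ^ 3 / (eps * d ^ 2); 4 * N ^ 2 * K / eps ^ 2; 8 * N ^ 2 * C1 / (eps * d ^ 2);
    256 * N ^ 2 * C1 ^ 2 + 1; 1024 * K * N ^ 6 * C1 ^ 2; 768 * N ^ 4 * C1 ^ 2 / d]) as (S0 & HS0).
  exists S0; intros S HS.
  assert (HSc : forall c, In c [2; 64 * K * N ^ 4 / (eps ^ 2 * eta); 4 * N / (eps * d);
    24 * N ^ 3 / (eps * d ^ 2); 4 * N ^ 2 * K / eps ^ 2; 8 * N ^ 2 * C1 / (eps * d ^ 2);
    256 * N ^ 2 * C1 ^ 2 + 1; 1024 * K * N ^ 6 * C1 ^ 2; 768 * N ^ 4 * C1 ^ 2 / d] -> c <= S).
  { intros c Hc; specialize (HS0 c Hc); lra. }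
  clear HS0 HS S0.
  assert (L1 := HSc 2 ltac:(simpl; tauto)).
  assert (L2 := HSc (64 * K * N ^ 4 / (eps ^ 2 * eta)) ltac:(simpl; tauto)).
  assert (L3 := HSc (4 * N / (eps * d)) ltac:(simpl; tauto)).
  assert (L4 := HSc (24 * N ^ 3 / (eps * d ^ 2)) ltac:(simpl; tauto)).
  assert (L5 := HSc (4 * N ^ 2 * K / eps ^ 2) ltac:(simpl; tauto)).
  assert (L6 := HSc (8 * N ^ 2 * C1 / (eps * d ^ 2)) ltac:(simpl; tauto)).
  assert (L7 := HSc (256 * N ^ 2 * C1 ^ 2 + 1) ltac:(simpl; tauto)).
  assert (L8 := HSc (1024 * K * N ^ 6 * C1 ^ 2) ltac:(simpl; tauto)).
  assert (L9 := HSc (768 * N ^ 4 * C1 ^ 2 / d) ltac:(simpl; tauto)).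
  clear HSc.
  set (x := 1 / S).
  assert (Hx : 0 < x) by (apply Rdiv_lt_0_compat; lra).
  assert (HSx : S * x = 1) by (unfold x; field; lra).
  assert (Hx1 : x <= 1 / 2) by nra.
  assert (In1 : forall c e, 0 < e -> c / e <= S -> c * x <= e).
  { intros c e He Hc; apply Rmult_le_reg_r with (S / e); [apply Rdiv_lt_0_compat; lra|].
    replace (c * x * (S / e)) with (c / e * (S * x)) by (field; lra).
    replace (e * (S / e)) with S by (field; lra); rewrite HSx; lra. }
  apply In1 in L2; [|apply Rmult_lt_0_compat; lra].
  apply In1 in L3; [|apply Rmult_lt_0_compat; lra].
  apply In1 in L4; [|apply Rmult_lt_0_compat; lra].
  apply In1 in L5; [|lra].
  apply In1 in L6; [|apply Rmult_lt_0_compat; lra].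
  apply In1 in L9; [|lra].
  assert (L7' : 256 * N ^ 2 * C1 ^ 2 * x < 1).
  { rewrite <- HSx; apply Rmult_lt_compat_r; lra. }
  assert (L8' : 1024 * K * N ^ 6 * C1 ^ 2 * x <= 1).
  { rewrite <- HSx; apply Rmult_le_compat_r; lra. }
  clear L7 L8.
  set (z := / eps).
  assert (Hz : eps * z = 1) by (unfold z; field; lra).
  assert (Hz0 : 0 < z) by (apply Rinv_0_lt_compat; lra).
  replace (4 / (eps * S)) with (4 * z * x) by (unfold z, x; field; lra).
  replace (eta / S) with (eta * x) by (unfold x; field; lra).
  replace (8 * C1 / (eps * S ^ 2)) with (8 * C1 * z * x ^ 2) by (unfold z, x; field; lra).
  clearbody x z.
  assert (B1 : 64 * K * N ^ 4 * z ^ 2 * x <= eta).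
  { apply Rmult_le_reg_l with (eps ^ 2); auto.
    replace (eps ^ 2 * (64 * K * N ^ 4 * z ^ 2 * x)) with (64 * K * N ^ 4 * x * (eps * z) ^ 2) by ring.
    rewrite Hz; lra. }
  assert (B2 : 4 * N * z * x <= d).
  { apply Rmult_le_reg_l with eps; [lra|].
    replace (eps * (4 * N * z * x)) with (4 * N * x * (eps * z)) by ring; rewrite Hz; lra. }
  assert (B3 : 24 * N ^ 3 * z * x <= d ^ 2).
  { apply Rmult_le_reg_l with eps; [lra|].
    replace (eps * (24 * N ^ 3 * z * x)) with (24 * N ^ 3 * x * (eps * z)) by ring; rewrite Hz; lra. }
  assert (B4 : 4 * N ^ 2 * K * z ^ 2 * x <= 1).
  { apply Rmult_le_reg_l with (eps ^ 2); auto.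
    replace (eps ^ 2 * (4 * N ^ 2 * K * z ^ 2 * x)) with (4 * N ^ 2 * K * x * (eps * z) ^ 2) by ring.
    rewrite Hz; lra. }
  assert (B5 : 8 * N ^ 2 * C1 * z * x <= d ^ 2).
  { apply Rmult_le_reg_l with eps; [lra|].
    replace (eps * (8 * N ^ 2 * C1 * z * x)) with (8 * N ^ 2 * C1 * x * (eps * z)) by ring; rewrite Hz; lra. }
  assert (Hzx : 0 < z * x) by (apply Rmult_lt_0_compat; auto).
  assert (Hex : eta * x <= 1 * x) by (apply Rmult_le_compat_r; lra).
  assert (Hex0 : 0 < eta * x) by (apply Rmult_lt_0_compat; lra).
  assert (HS2 : 0 < S ^ 2) by (apply pow_lt; lra).
  assert (V : forall a c, 0 < a -> 0 < c <= x -> a * (4 * z * x) * c * N ^ 8 <= 1 -> eta * x <= c ->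
    fcov (fun t => near_point f f1 a (4 * z * x) c t /\ j0 <= t <= j1) (112 * (K / k) / N * (j1 - j0))).
  { intros a c Ha Hc Hv Hc'.
    destruct (pow2_unbounded a) as (n & Hn).
    apply (near_point_measure f f1 l r k K m j0 j1 d H Hl Hd2 Hd1 Hd n); auto; try lra.
    - replace (4 * K * N ^ 4 * (4 * z * x) ^ 2) with (64 * K * N ^ 4 * z ^ 2 * x * x) by ring.
      apply Rle_trans with (eta * x); auto; apply Rmult_le_compat_r; lra.
    - replace (6 * N ^ 3 * (4 * z * x) * c) with (24 * N ^ 3 * z * x * c) by ring.
      rewrite <- (Rmult_1_r (d ^ 2)); apply Rmult_le_compat; try lra.
      replace (24 * N ^ 3 * z * x) with (24 * N ^ 3 * (z * x)) by ring.
      apply Rmult_le_pos; [specialize (HNp 3%nat)|]; lra. }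
  assert (V1 := V (eps * S ^ 2) (eta * x)).
  assert (V2 := V (eta * eps * S ^ 2) x).
  clear V.
  assert (F : fcov (fun t => near_line f f1 (2 * C1 * eps * S) (2 * C1 * eps * S) (8 * C1 * z * x ^ 2) t
      /\ j0 <= t <= j1) (160 * (K / k) / N * (j1 - j0))).
  { set (X := 256 * N ^ 2 * C1 ^ 2 * x) in *.
    assert (HX0 : 0 < X).
    { unfold X; pose proof (HNp 2%nat); pose proof (HCp 2%nat).
      apply Rmult_lt_0_compat; [apply Rmult_lt_0_compat|]; lra. }
    (* The two bounds on the line's slope data are equal, so both small sides of the point box after
       a line step equal [X]. *)
    assert (EX : 16 * N ^ 2 * (2 * C1 * eps * S) * (8 * C1 * z * x ^ 2) = X).
    { replace (16 * N ^ 2 * (2 * C1 * eps * S) * (8 * C1 * z * x ^ 2)) with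
        (X * (eps * z) * (S * x)) by (unfold X; ring); rewrite Hz, HSx; ring. }
    assert (HeS : 0 < 2 * C1 * eps * S) by (repeat apply Rmult_lt_0_compat; lra).
    assert (HzX : 3 * N ^ 2 * X <= d).
    { replace (3 * N ^ 2 * X) with (768 * N ^ 4 * C1 ^ 2 * x) by (unfold X; ring); auto. }
    assert (HNX : N * X <= 3 * N ^ 2 * X) by (apply Rmult_le_compat_r; [lra|simpl; nra]).
    apply (near_line_measure f f1 l r k K m j0 j1 d); auto; try lra; rewrite ?EX; try lra.
    - repeat apply Rmult_lt_0_compat; try lra; apply pow_lt; auto.
    - replace (N ^ 2 * K * (2 * C1 * eps * S) * (8 * C1 * z * x ^ 2)) with
        (16 * N ^ 2 * K * C1 ^ 2 * x * (eps * z) * (S * x)) by ring; rewrite Hz, HSx.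
      replace ((2 * C1 * eps * S) ^ 2) with (4 * C1 ^ 2 * eps ^ 2 * S ^ 2) by ring.
      apply Rle_trans with (4 * C1 ^ 2 * eps ^ 2 * 1).
      + replace (16 * N ^ 2 * K * C1 ^ 2 * x * 1 * 1) with (4 * C1 ^ 2 * (4 * N ^ 2 * K * x)) by ring.
        rewrite Rmult_1_r; apply Rmult_le_compat_l; [specialize (HCp 2%nat); lra|lra].
      + apply Rmult_le_compat_l; [|simpl; nra].
        apply Rmult_le_pos; [specialize (HCp 2%nat); lra|lra].
    - replace (N ^ 2 * (8 * C1 * z * x ^ 2)) with (8 * N ^ 2 * C1 * z * x * x) by ring.
      rewrite <- (Rmult_1_r (d ^ 2)); apply Rmult_le_compat; try lra.
      replace (8 * N ^ 2 * C1 * z * x) with (8 * N ^ 2 * C1 * (z * x)) by ring.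
      apply Rmult_le_pos; [|lra]; specialize (HNp 2%nat); apply Rmult_le_pos; lra.
    (* Here 786432 is [3 * 2 ^ 2 * 256 ^ 2], below [1000 ^ 2]; this is the source of the 1000 in the
       hypothesis on [eps]. *)
    - replace (3 * (2 * C1 * eps * S) * (2 * C1 * eps * S) * X * X * N ^ 8) with
        (786432 * (C1 ^ 3 * N ^ 6 * eps) ^ 2 * (S * x) ^ 2) by (unfold X; ring).
      rewrite HSx.
      assert (0 < C1 ^ 3 * N ^ 6 * eps) by (repeat apply Rmult_lt_0_compat; auto; lra).
      assert (C1 ^ 3 * N ^ 6 * eps <= / 1000) by lra.
      assert ((C1 ^ 3 * N ^ 6 * eps) ^ 2 <= (/ 1000) ^ 2) by (apply pow_incr; lra).
      lra.
    - replace (4 * K * N ^ 4 * X ^ 2) with (4 * K * N ^ 4 * X * X) by ring.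
      apply Rle_trans with (1 * X); [|lra]; apply Rmult_le_compat_r; [lra|].
      replace (4 * K * N ^ 4 * X) with (1024 * K * N ^ 6 * C1 ^ 2 * x) by (unfold X; ring); auto.
    - apply Rle_trans with ((3 * N ^ 2 * X) ^ 2); [|apply pow_incr; split; [apply Rmult_le_pos; [specialize (HNp 2%nat)|]|]; lra].
      replace ((3 * N ^ 2 * X) ^ 2) with (9 * N * (N ^ 3 * X * X)) by ring.
      replace (6 * N ^ 3 * X * X) with (6 * (N ^ 3 * X * X)) by ring.
      apply Rmult_le_compat_r; [|lra]; apply Rmult_le_pos; [apply Rmult_le_pos|]; try lra; apply Rlt_le, HNp. }
  assert (C1' : eps * S ^ 2 * (4 * z * x) * (eta * x) * N ^ 8 <= 1).
  { replace (eps * S ^ 2 * (4 * z * x) * (eta * x) * N ^ 8) with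
      (4 * eta * N ^ 8 * (eps * z) * (S * x) ^ 2) by ring; rewrite Hz, HSx; lra. }
  assert (C2' : eta * eps * S ^ 2 * (4 * z * x) * x * N ^ 8 <= 1).
  { replace (eta * eps * S ^ 2 * (4 * z * x) * x * N ^ 8) with
      (4 * eta * N ^ 8 * (eps * z) * (S * x) ^ 2) by ring; rewrite Hz, HSx; lra. }
  assert (G1 : 0 < eps * S ^ 2) by (apply Rmult_lt_0_compat; lra).
  assert (G2 : 0 < eta * eps * S ^ 2) by (repeat apply Rmult_lt_0_compat; lra).
  specialize (V1 G1 ltac:(lra) C1' ltac:(lra)); specialize (V2 G2 ltac:(lra) C2' ltac:(lra)).
  eapply fcov_mono; [apply (fcov_or _ _ _ _ _ V1 (fcov_or _ _ _ _ _ V2 F))|auto|].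
  apply Req_le; field; lra.
Qed.

Lemma fcov_gap (B : R -> Prop) a b t rho :
  a <= t - rho -> t + rho <= b -> 0 <= rho -> (forall x, Rabs (x - t) <= rho -> ~ B x) ->
  fcov (fun x => B x /\ a <= x <= b) (b - a - 2 * rho).
Proof.
  intros H1 H2 Hr H.
  replace (b - a - 2 * rho) with ((t - rho - a) + (b - (t + rho))) by ring.
  apply (fcov_union (fun x => a <= x <= t - rho) (fun x => t + rho <= x <= b)).
  - apply fcov_interval; auto.
  - apply fcov_interval; auto.
  - intros x (Bx & Hx); destruct (Rle_dec x (t - rho)); [left; lra|].
    destruct (Rle_dec (t + rho) x); [right; lra|].
    exfalso; apply (H x); auto; apply Rabs_le; lra.
Qed.

(** The interval is cut into cells of length proportional to [S ^ (-3)]; every cell with a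
    nonexceptional point in its middle third contains a gap of comparable length. [c0] is fixed
    before [Q0], [j0] and [j1]. *)
Lemma arc_contraction f f1 l r k K m sigma :
  convex_arc f f1 l r k K m -> 0 < sigma < 1 ->
  exists c0, 0 < c0 < 1 /\ forall Q0 j0 j1, l < j0 -> j0 < j1 -> j1 < r ->
    fcov (fun t => (forall Q, Q0 <= Q -> DI_solvable sigma Q t (f t)) /\ j0 <= t <= j1)
      ((1 - c0) * (j1 - j0)).
Proof.
  intros H Hs.
  destruct (arc_consts _ _ _ _ _ _ _ H) as (Hk & HK & Hm).
  remember ((1 - sigma) / 10) as e1 eqn:He1; remember (e1 / m) as e2 eqn:He2.
  remember (e2 / 8) as e3 eqn:He3; remember ((1 - sigma) / 2) as u eqn:Hu.
  remember ((1 + 1 / u) / (sigma * (1 + 2 * e1) * e3)) as kap1 eqn:Hkap1.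
  remember (kap1 + 2 * m / u) as C1 eqn:HC1.
  assert (P1 : 0 < e1 <= 1 / 10) by lra.
  assert (P2 : 0 < e2 <= 1 / 10).
  { rewrite He2; split; [apply Rdiv_lt_0_compat; lra|].
    apply div_le_iff; [lra|]; assert (1 / 10 * 1 <= 1 / 10 * m) by (apply Rmult_le_compat_l; lra); lra. }
  assert (HC : 1 <= C1).
  { assert (0 < kap1).
    { rewrite Hkap1; apply Rdiv_lt_0_compat; [|repeat apply Rmult_lt_0_compat; lra].
      assert (0 < 1 / u) by (apply Rdiv_lt_0_compat; lra); lra. }
    assert (1 <= 2 * m / u); [|lra].
    apply Rmult_le_reg_r with u; [lra|]; replace (2 * m / u * u) with (2 * m) by (field; lra); lra. }
  set (kap := K / k).
  assert (Hkap : 1 <= kap).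
  { unfold kap; apply Rmult_le_reg_r with k; [lra|]; unfold Rdiv; rewrite Rmult_assoc, Rinv_l; lra. }
  (* As [3072 = 8 * 384], the exceptional set has relative length at most 1/8. *)
  set (N := 3072 * kap + 100).
  assert (HN : 100 <= N) by (unfold N; lra).
  assert (HCN : 0 < 1000 * C1 ^ 3 * N ^ 6).
  { apply Rmult_lt_0_compat; [apply Rmult_lt_0_compat; [lra|]|]; apply pow_lt; lra. }
  set (eps := Rmin (e2 / 4) (/ (1000 * C1 ^ 3 * N ^ 6))).
  assert (Heps : 0 < eps <= e2 / 4).
  { split; [apply Rmin_glb_lt; [lra|apply Rinv_0_lt_compat; auto]|apply Rmin_l]. }
  assert (HCe : 1000 * C1 ^ 3 * N ^ 6 * eps <= 1).
  { apply Rle_trans with (1000 * C1 ^ 3 * N ^ 6 * / (1000 * C1 ^ 3 * N ^ 6)).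
    - apply Rmult_le_compat_l; [lra|apply Rmin_r].
    - rewrite Rinv_r; lra. }
  assert (HN8 : 1 <= N ^ 8) by (apply pow_R1_Rle; lra).
  set (eta := / (4 * N ^ 8)).
  assert (Heta : 0 < eta <= 1).
  { split; [apply Rinv_0_lt_compat; lra|rewrite <- Rinv_1; apply Rinv_le_contravar; lra]. }
  assert (HeN : 4 * eta * N ^ 8 <= 1) by (unfold eta; apply Req_le; field; lra).
  assert (Hep2 : 0 < eps ^ 2 <= 1) by (split; [apply pow_lt; lra|simpl; nra]).
  assert (Het4 : 0 < eta ^ 4 <= 1) by (split; [apply pow_lt; lra|rewrite <- (pow1 4); apply pow_incr; lra]).
  assert (Het3 : 0 < eta ^ 3 <= 1) by (split; [apply pow_lt; lra|rewrite <- (pow1 3); apply pow_incr; lra]).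
  assert (Hee : 0 < eta * eps ^ 2 <= 1).
  { split; [apply Rmult_lt_0_compat; lra|].
    apply Rle_trans with (1 * 1); [apply Rmult_le_compat|]; lra. }
  clearbody eta eps.
  exists (e1 * eta ^ 4 * eps ^ 2 / 2560); split.
  { assert (0 < e1 * eta ^ 4) by (apply Rmult_lt_0_compat; lra).
    assert (0 < e1 * eta ^ 4 * eps ^ 2) by (apply Rmult_lt_0_compat; lra).
    assert (e1 * eta ^ 4 * eps ^ 2 <= 1 * 1 * 1) by (apply Rmult_le_compat; try lra; apply Rmult_le_compat; lra).
    lra. }
  intros Q0 j0 j1 Hl Hj Hr.
  destruct (exceptional_measure f f1 l r k K m j0 j1 N C1 eps eta H) as (S0 & HExc); auto; try lra.
  { unfold N; fold kap; lra. }
  destruct (list_bounded [S0; 4 / eps + 1; 64 * K / (eps ^ 2 * eta); (4 / eps + 2) / (j0 - l) + 1;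
    (4 / eps + 2) / (r - j1) + 1; Q0; 4; 60 / (eta * eps ^ 2 * (j1 - j0))]) as (S & HS).
  specialize (HExc S ltac:(apply HS; simpl; tauto)).
  assert (L1 := HS (4 / eps + 1) ltac:(simpl; tauto)).
  assert (L2 := HS (64 * K / (eps ^ 2 * eta)) ltac:(simpl; tauto)).
  assert (L3 := HS ((4 / eps + 2) / (j0 - l) + 1) ltac:(simpl; tauto)).
  assert (L4 := HS ((4 / eps + 2) / (r - j1) + 1) ltac:(simpl; tauto)).
  assert (L5 := HS Q0 ltac:(simpl; tauto)).
  assert (L6 := HS 4 ltac:(simpl; tauto)).
  assert (L7 := HS (60 / (eta * eps ^ 2 * (j1 - j0))) ltac:(simpl; tauto)).
  clear HS S0.
  assert (Marg : forall g, 0 < g -> (4 / eps + 2) / g + 1 <= S -> (4 / eps + 2) / S < g).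
  { intros g Hg HgS; apply Rmult_lt_reg_r with (S / g); [apply Rdiv_lt_0_compat; lra|].
    replace ((4 / eps + 2) / S * (S / g)) with ((4 / eps + 2) / g) by (field; lra).
    replace (g * (S / g)) with S by (field; lra); lra. }
  apply Marg in L3; [|lra]; apply Marg in L4; [|lra]; clear Marg.
  set (L := j1 - j0) in *.
  assert (HL : 0 < L) by (unfold L; lra).
  assert (HS3 : S <= S ^ 3).
  { replace (S ^ 3) with (S * S ^ 2) by ring; rewrite <- (Rmult_1_r S) at 1.
    apply Rmult_le_compat_l; [lra|apply pow_R1_Rle; lra]. }
  set (P := / (eta * eps ^ 2 * S ^ 3)).
  assert (HP : 0 < P) by (apply Rinv_0_lt_compat, Rmult_lt_0_compat; lra).
  (* The centre of the gap is within [5 * P] of [s] and its radius [rho] is at most [P]. Cells of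
     length at least [10 * D] have margins wider than [D] around the middle third, so the gap stays
     inside. *)
  set (D := 6 * P).
  set (rho := e1 * eta ^ 3 / (16 * S ^ 3)).
  assert (HD : 10 * D <= L).
  { unfold D, P; apply Rmult_le_reg_r with (S ^ 3 / L); [apply Rdiv_lt_0_compat; lra|].
    replace (10 * (6 * / (eta * eps ^ 2 * S ^ 3)) * (S ^ 3 / L)) with (60 / (eta * eps ^ 2 * L)) by (field; lra).
    replace (L * (S ^ 3 / L)) with (S ^ 3) by (field; lra); lra. }
  assert (Erho : rho = e1 * eta ^ 4 * eps ^ 2 / 16 * P) by (unfold rho, P; field; lra).
  assert (Hc : 0 < e1 * eta ^ 4 * eps ^ 2 <= 1).
  { assert (0 < e1 * eta ^ 4) by (apply Rmult_lt_0_compat; lra).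
    assert (0 < e1 * eta ^ 4 * eps ^ 2) by (apply Rmult_lt_0_compat; lra).
    assert (e1 * eta ^ 4 * eps ^ 2 <= 1 * 1 * 1) by (apply Rmult_le_compat; try lra; apply Rmult_le_compat; lra).
    lra. }
  assert (Hrho : 0 < rho <= P).
  { rewrite Erho; split; [apply Rmult_lt_0_compat; lra|].
    apply Rle_trans with (1 * P); [apply Rmult_le_compat_r|]; lra. }
  set (n := nfloor (L / (10 * D))).
  assert (Hn1 : 1 <= L / (10 * D)).
  { apply Rmult_le_reg_r with (10 * D); [unfold D; lra|].
    replace (L / (10 * D) * (10 * D)) with L by (field; unfold D; lra); lra. }
  destruct (nfloor_spec (L / (10 * D))) as (Hn2 & Hn3); [lra|]; fold n in Hn2, Hn3.
  assert (Hn4 : (1 <= n)%nat).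
  { destruct n; [simpl in Hn3; lra|lia]. }
  apply le_INR in Hn4; simpl in Hn4.
  set (lam := L / INR n).
  assert (Enl : INR n * lam = L) by (unfold lam; field; lra).
  assert (ED : L / (10 * D) * (10 * D) = L) by (field; unfold D; lra).
  assert (Hlam : 10 * D <= lam <= 20 * D).
  { assert (0 < 10 * D) by (unfold D; lra).
    split; apply Rmult_le_reg_l with (INR n); try lra; rewrite Enl.
    - apply Rle_trans with (L / (10 * D) * (10 * D)); [apply Rmult_le_compat_r; lra|lra].
    - apply Rle_trans with (L / (10 * D) * (10 * D)); [lra|].
      replace (INR n * (20 * D)) with (2 * INR n * (10 * D)) by ring; apply Rmult_le_compat_r; lra. }
  set (B := fun t => forall Q, Q0 <= Q -> DI_solvable sigma Q t (f t)).
  pose proof (fcov_cells B _ _ j0 lam (2 * rho) n ltac:(unfold D in Hlam; lra)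
    ltac:(unfold D in Hlam; lra) HExc) as Cells.
  rewrite Enl in Cells; replace (j0 + L) with j1 in Cells by (unfold L; ring).
  eapply fcov_mono; [apply Cells|auto|].
  - clear Cells; intros x s Hx Hx2 Hs1 Ns.
    assert (Hsj : j0 <= s <= j1) by lra.
    destruct (gap_near f f1 l r k K m sigma e1 e2 e3 u kap1 C1 eps eta S s H) as (t1 & y & Hy & Ht1 & Gap); auto; try lra.
    { intros V; apply Ns; split; auto. }
    { intros V; apply Ns; split; auto. }
    replace (5 / (eta * eps ^ 2 * S ^ 3)) with (5 * P) in Ht1 by (unfold P; field; lra).
    apply Rabs_bound in Ht1.
    replace (lam - 2 * rho) with (x + lam - x - 2 * rho) by ring.
    apply (fcov_gap B x (x + lam) t1 rho); try (unfold D in *; lra).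
    intros t Ht Bt.
    assert (HeS : 0 < eta / (2 * S)) by (apply Rdiv_lt_0_compat; lra).
    apply (Gap t).
    + eapply Rle_trans; [apply Ht|].
      replace rho with (e1 * (eta / (2 * S)) ^ 3 / 2) by (unfold rho; field; lra).
      assert ((eta / (2 * S)) ^ 3 <= y ^ 3) by (apply pow_incr; lra).
      assert (e1 * (eta / (2 * S)) ^ 3 <= e1 * y ^ 3) by (apply Rmult_le_compat_l; lra); lra.
    (* From [y <= 2 / S] and [S >= 4] the chosen [Q] is at least [S ^ 2 / 4 >= S >= Q0]. *)
    + apply Bt; apply Rle_trans with S; auto.
      apply Rle_trans with (/ (2 / S) ^ 2).
      * replace (/ (2 / S) ^ 2) with (S * (S / 4)) by (field; lra).
        rewrite <- (Rmult_1_r S) at 1; apply Rmult_le_compat_l; lra.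
      * apply Rinv_le_contravar; [apply pow_lt; lra|apply pow_incr; lra].
  - assert (Hkn : 384 * kap / N <= / 8).
    { apply div_le_iff; unfold N; lra. }
    replace (INR n) with (L / lam) by (rewrite <- Enl; field; unfold D in Hlam; lra).
    fold kap; set (w := rho / lam).
    assert (Hw0 : 0 < w) by (apply Rdiv_lt_0_compat; unfold D in Hlam; lra).
    replace (L / lam * (lam - 2 * rho) + 3 * (2 * rho) / lam * (384 * kap / N * L)) with
      (L * (1 - w * (2 - 6 * (384 * kap / N)))) by (unfold w; field; unfold D in Hlam; lra).
    rewrite (Rmult_comm _ L); apply Rmult_le_compat_l; [lra|].
    assert (Hw : e1 * eta ^ 4 * eps ^ 2 / 1920 <= w).
    { apply Rmult_le_reg_r with lam; [unfold D in Hlam; lra|].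
      replace (w * lam) with rho by (unfold w; field; unfold D in Hlam; lra).
      rewrite Erho.
      apply Rle_trans with (e1 * eta ^ 4 * eps ^ 2 / 1920 * (20 * D)); [apply Rmult_le_compat_l; lra|].
      apply Req_le; unfold D; field. }
    assert (w * (5 / 4) <= w * (2 - 6 * (384 * kap / N))) by (apply Rmult_le_compat_l; lra).
    lra.
Qed.

Lemma arc_negligible f f1 l r k K m sigma Q0 j0 j1 eps :
  convex_arc f f1 l r k K m -> 0 < sigma < 1 -> l < j0 -> j0 <= j1 -> j1 < r -> 0 < eps ->
  fcov (fun t => (forall Q, Q0 <= Q -> DI_solvable sigma Q t (f t)) /\ j0 <= t <= j1) eps.
Proof.
  intros H Hs Hl Hj Hr Heps.
  destruct (arc_contraction f f1 l r k K m sigma H Hs) as (c0 & Hc0 & C).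
  apply (fcov_contract _ j0 j1 (1 - c0)); auto; [lra|].
  intros a b Ha Hab Hb; apply C; lra.
Qed.

(** * Charts of a nondegenerate curve *)

Record C2_curve (phi1 phi2 d1 d2 e1 e2 : R -> R) : Prop := C2Curve {
  c2_phi1 : has_deriv_on01 phi1 d1; c2_d1 : has_deriv_on01 d1 e1; c2_e1 : continuous_on01 e1;
  c2_phi2 : has_deriv_on01 phi2 d2; c2_d2 : has_deriv_on01 d2 e2; c2_e2 : continuous_on01 e2 }.

Definition wronskian (d1 d2 e1 e2 : R -> R) (s : R) : R := d1 s * e2 s - d2 s * e1 s.

Lemma has_deriv_interior f f' x : has_deriv_on01 f f' -> 0 < x < 1 -> derivable_pt_lim f x (f' x).
Proof.
  intros H Hx eps Heps.
  destruct (H x ltac:(unfold I01; lra) eps Heps) as (delta & Hd & P).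
  assert (Hm : 0 < Rmin delta (Rmin x (1 - x))) by (repeat apply Rmin_glb_lt; lra).
  exists (mkposreal _ Hm); intros h Hh Hh2; simpl in Hh2.
  pose proof (Rmin_l delta (Rmin x (1 - x))); pose proof (Rmin_r delta (Rmin x (1 - x))).
  pose proof (Rmin_l x (1 - x)); pose proof (Rmin_r x (1 - x)).
  assert (Hb : Rabs h <= Rmin x (1 - x)) by lra; apply Rabs_bound in Hb.
  specialize (P (x + h)); replace (x + h - x) with h in P by ring.
  apply P; [unfold I01; lra|split; [apply Rabs_pos_lt; auto|lra]].
Qed.

Lemma continuous_interior f x : continuous_on01 f -> 0 < x < 1 -> continuity_pt f x.
Proof.
  intros H Hx eps Heps.
  destruct (H x ltac:(unfold I01; lra) eps Heps) as (delta & Hd & P).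
  exists (Rmin delta (Rmin x (1 - x))); split; [repeat apply Rmin_glb_lt; lra|].
  intros y (_ & Hy); simpl in *; unfold Rdist in *.
  pose proof (Rmin_l delta (Rmin x (1 - x))); pose proof (Rmin_r delta (Rmin x (1 - x))).
  pose proof (Rmin_l x (1 - x)); pose proof (Rmin_r x (1 - x)).
  assert (Hb : Rabs (y - x) <= Rmin x (1 - x)) by lra; apply Rabs_bound in Hb.
  apply P; [unfold I01; lra|lra].
Qed.

Lemma derivable_lim_continuity f x l : derivable_pt_lim f x l -> continuity_pt f x.
Proof. intros H; apply derivable_continuous_pt; exists l; exact H. Qed.

Lemma positive_near f x : continuity_pt f x -> 0 < f x ->
  exists rho, 0 < rho /\ forall y, Rabs (y - x) <= rho -> f x / 2 <= f y <= 2 * f x.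
Proof.
  intros H Hx; destruct (H (f x / 2) ltac:(lra)) as (rho & Hr & P).
  exists (rho / 2); split; [lra|]; intros y Hy.
  destruct (Req_dec y x) as [->|N]; [lra|].
  assert (X : Rabs (f y - f x) <= f x / 2).
  { apply Rlt_le, (P y); split; [split; [exact I|auto]|]; simpl; unfold Rdist; lra. }
  apply Rabs_bound in X; lra.
Qed.

Lemma mean_value f f' a b : a <= b ->
  (forall c, a <= c <= b -> derivable_pt_lim f c (f' c)) ->
  exists c, a <= c <= b /\ f b - f a = f' c * (b - a).
Proof.
  intros Hab H; destruct (Req_dec a b) as [->|N].
  - exists b; split; [lra|ring].
  - destruct (MVT_cor2 f f' a b ltac:(lra) H) as (c & E & Hc); exists c; split; [lra|auto].
Qed.

(** With [phi1] as coordinate the curve is a graph of slope [mu = d2 / d1], whose derivative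
    [W / d1 ^ 2] is positive and bounded near [s0]; this gives the curvature constants. Covers are
    pulled back along [phi1], which expands by at least [del / 2]. *)
Lemma positive_chart phi1 phi2 d1 d2 e1 e2 s0 :
  C2_curve phi1 phi2 d1 d2 e1 e2 -> 0 < s0 < 1 -> 0 < d1 s0 -> 0 < wronskian d1 d2 e1 e2 s0 ->
  exists rho, 0 < rho /\ forall sigma Q0 eps, 0 < sigma < 1 -> 0 < eps ->
    fcov (fun s => (forall Q, Q0 <= Q -> DI_solvable sigma Q (phi1 s) (phi2 s)) /\ Rabs (s - s0) <= rho) eps.
Proof.
  intros H Hs0 Hd HW.
  set (W := wronskian d1 d2 e1 e2) in *.
  assert (D1 : forall s, 0 < s < 1 -> derivable_pt_lim phi1 s (d1 s)) by (intros; apply has_deriv_interior; auto; apply H).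
  assert (D2 : forall s, 0 < s < 1 -> derivable_pt_lim phi2 s (d2 s)) by (intros; apply has_deriv_interior; auto; apply H).
  assert (D11 : forall s, 0 < s < 1 -> derivable_pt_lim d1 s (e1 s)) by (intros; apply has_deriv_interior; auto; apply H).
  assert (D22 : forall s, 0 < s < 1 -> derivable_pt_lim d2 s (e2 s)) by (intros; apply has_deriv_interior; auto; apply H).
  assert (CW : continuity_pt W s0).
  { apply (continuity_pt_minus (fun s => d1 s * e2 s) (fun s => d2 s * e1 s)).
    - apply (continuity_pt_mult d1 e2);
        [apply (derivable_lim_continuity d1 s0 (e1 s0)); auto|apply continuous_interior; auto; apply H].
    - apply (continuity_pt_mult d2 e1);
        [apply (derivable_lim_continuity d2 s0 (e2 s0)); auto|apply continuous_interior; auto; apply H]. }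
  destruct (positive_near d1 s0) as (r1 & Hr1 & N1); auto.
  { apply (derivable_lim_continuity d1 s0 (e1 s0)); auto. }
  destruct (positive_near W s0 CW HW) as (r2 & Hr2 & N2).
  set (del := d1 s0) in *; set (om := W s0) in *.
  set (rho := Rmin (Rmin r1 r2) (Rmin s0 (1 - s0) / 2)).
  assert (Hrho : 0 < rho /\ rho <= r1 /\ rho <= r2 /\ rho < s0 /\ rho < 1 - s0).
  { unfold rho, Rmin; repeat destruct Rle_dec; lra. }
  destruct Hrho as (Hrho & Hrr1 & Hrr2 & Hrs & Hrs').
  set (a := s0 - rho); set (b := s0 + rho).
  assert (Hab : forall s, a <= s <= b -> 0 < s < 1 /\ del / 2 <= d1 s <= 2 * del /\ om / 2 <= W s <= 2 * om).
  { intros s Hs; unfold a, b in Hs; split; [lra|split; [apply N1|apply N2]]; apply Rabs_le; lra. }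
  set (mu := fun s => d2 s / d1 s).
  assert (Dmu : forall s, a <= s <= b -> derivable_pt_lim mu s (W s / (d1 s) ^ 2)).
  { intros s Hs; destruct (Hab s Hs) as (Hs1 & Hs2 & _).
    replace (W s / d1 s ^ 2) with ((e2 s * d1 s - e1 s * d2 s) / Rsqr (d1 s)).
    - apply (derivable_pt_lim_div d2 d1); auto; lra.
    - unfold W, wronskian, Rsqr; field; lra. }
  assert (Dmu2 : forall s, a <= s <= b -> om / (8 * del ^ 2) <= W s / d1 s ^ 2 <= 8 * om / del ^ 2).
  { intros s Hs; destruct (Hab s Hs) as (_ & Hs2 & Hs3).
    assert (del ^ 2 / 4 <= d1 s ^ 2 <= 4 * del ^ 2).
    { split; [replace (del ^ 2 / 4) with ((del / 2) ^ 2) by field|replace (4 * del ^ 2) with ((2 * del) ^ 2) by ring];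
        apply pow_incr; lra. }
    assert (0 < del ^ 2) by (apply pow_lt; auto).
    split.
    - replace (om / (8 * del ^ 2)) with (om / 2 * / (4 * del ^ 2)) by (field; lra).
      apply Rmult_le_compat; try lra; [apply Rlt_le, Rinv_0_lt_compat|apply Rinv_le_contravar]; lra.
    - replace (8 * om / del ^ 2) with (2 * om * / (del ^ 2 / 4)) by (field; lra).
      apply Rmult_le_compat; try lra; [apply Rlt_le, Rinv_0_lt_compat|apply Rinv_le_contravar]; lra. }
  assert (Hphi : forall s t, a <= s -> s <= t -> t <= b -> del / 2 * (t - s) <= phi1 t - phi1 s <= 2 * del * (t - s)).
  { intros s t Hs Hst Ht.
    destruct (mean_value phi1 d1 s t Hst) as (c & Hc & E); [intros; apply D1, Hab; lra|].
    destruct (Hab c ltac:(lra)) as (_ & Hc2 & _); rewrite E; split; apply Rmult_le_compat_r; lra. }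
  assert (Hmu : forall s t, a <= s -> s <= t -> t <= b ->
     om / (8 * del ^ 2) * (t - s) <= mu t - mu s <= 8 * om / del ^ 2 * (t - s)).
  { intros s t Hs Hst Ht.
    destruct (mean_value mu (fun s => W s / d1 s ^ 2) s t Hst) as (c & Hc & E); [intros; apply Dmu; lra|].
    destruct (Dmu2 c ltac:(lra)); rewrite E; split; apply Rmult_le_compat_r; lra. }
  assert (Hdel2 : 0 < del ^ 2) by (apply pow_lt; auto).
  assert (Hk0 : 0 < om / (8 * del ^ 2)) by (apply Rdiv_lt_0_compat; lra).
  (* Mean value theorem for [phi2 - mu z * phi1] with [z] an endpoint; monotonicity of [mu] fixes
     the sign. *)
  assert (Htan : forall s t, a <= s -> s <= t -> t <= b ->
     mu s * (phi1 t - phi1 s) <= phi2 t - phi2 s <= mu t * (phi1 t - phi1 s)).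
  { intros s t Hs Hst Ht.
    assert (X : forall z, a <= z <= b -> exists c, s <= c <= t /\
       phi2 t - phi2 s - mu z * (phi1 t - phi1 s) = d1 c * (mu c - mu z) * (t - s)).
    { intros z Hz.
      destruct (mean_value (fun s => phi2 s - mu z * phi1 s) (fun s => d2 s - mu z * d1 s) s t Hst) as (c & Hc & E).
      - intros c Hc; destruct (Hab c ltac:(lra)) as (Hc1 & _).
        apply (derivable_pt_lim_minus phi2 (fun s => mu z * phi1 s)); auto.
        apply (derivable_pt_lim_scal phi1); auto.
      - exists c; split; auto.
        destruct (Hab c ltac:(lra)) as (_ & Hc2 & _).
        replace (d1 c * (mu c - mu z)) with (d2 c - mu z * d1 c) by (unfold mu at 2; field; lra).
        rewrite <- E; ring. }
    split.
    - destruct (X s ltac:(lra)) as (c & Hc & E).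
      destruct (Hab c ltac:(lra)) as (_ & Hc2 & _).
      destruct (Hmu s c Hs ltac:(lra) ltac:(lra)) as (Hm & _).
      assert (0 <= om / (8 * del ^ 2) * (c - s)) by (apply Rmult_le_pos; lra).
      assert (0 <= d1 c * (mu c - mu s) * (t - s)) by (apply Rmult_le_pos; [apply Rmult_le_pos|]; lra).
      lra.
    - destruct (X t ltac:(lra)) as (c & Hc & E).
      destruct (Hab c ltac:(lra)) as (_ & Hc2 & _).
      destruct (Hmu c t ltac:(lra) ltac:(lra) Ht) as (Hm & _).
      assert (0 <= om / (8 * del ^ 2) * (t - c)) by (apply Rmult_le_pos; lra).
      assert (0 <= d1 c * (mu t - mu c) * (t - s)) by (apply Rmult_le_pos; [apply Rmult_le_pos|]; lra).
      lra. }
  assert (Inv : forall x, phi1 a <= x <= phi1 b -> exists s, a <= s <= b /\ phi1 s = x).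
  { intros x Hx.
    destruct (Req_dec x (phi1 a)) as [->|Na]; [exists a; split; [unfold a, b|]; lra|].
    destruct (Req_dec x (phi1 b)) as [->|Nb]; [exists b; split; [unfold a, b|]; lra|].
    destruct (IVT_interv (fun s => phi1 s - x) a b) as (s & Hs & E).
    - intros c Hc; apply (continuity_pt_minus phi1 (fct_cte x)).
      + apply (derivable_lim_continuity phi1 c (d1 c)), D1, Hab; auto.
      + apply continuity_pt_const; intros ? ?; auto.
    - unfold a, b; lra.
    - lra.
    - lra.
    - exists s; split; [auto|lra]. }
  (* The inverse of [phi1] is merely chosen: monotonicity and the difference bounds are all that
     [convex_arc] needs. *)
  set (g := fun x => epsilon (inhabits 0) (fun s => a <= s <= b /\ phi1 s = x)).
  assert (Hg : forall x, phi1 a <= x <= phi1 b -> a <= g x <= b /\ phi1 (g x) = x).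
  { intros x Hx; unfold g; apply epsilon_spec, Inv, Hx. }
  assert (Hgm : forall x x', phi1 a <= x -> x <= x' -> x' <= phi1 b -> g x <= g x').
  { intros x x' Hx Hxx Hx'; destruct (Hg x ltac:(lra)) as (G1 & G2); destruct (Hg x' ltac:(lra)) as (G3 & G4).
    destruct (Rle_dec (g x) (g x')); auto.
    destruct (Hphi (g x') (g x)) as (P & _); try lra.
    assert (0 < del / 2 * (g x - g x')) by (apply Rmult_lt_0_compat; lra); lra. }
  set (om' := om / del ^ 3).
  assert (Hdel3 : 0 < del ^ 3) by (apply pow_lt; auto).
  assert (Hom' : 0 < om') by (apply Rdiv_lt_0_compat; auto).
  assert (Arc : convex_arc (fun x => phi2 (g x)) (fun x => mu (g x)) (phi1 a) (phi1 b)
     (om' / 16) (1 + 16 * om') (1 + Rabs (mu s0) + 8 * om / del ^ 2 * rho)).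
  { assert (Hr8 : 0 < 8 * om / del ^ 2 * rho) by (apply Rmult_lt_0_compat; auto; apply Rdiv_lt_0_compat; lra).
    split.
    - pose proof (Rabs_pos (mu s0)); lra.
    - intros x x' Hx Hxx Hx'.
      destruct (Hg x ltac:(lra)) as (G1 & G2); destruct (Hg x' ltac:(lra)) as (G3 & G4).
      pose proof (Htan (g x) (g x') ltac:(lra) (Hgm x x' Hx Hxx Hx') ltac:(lra)) as T.
      rewrite G2, G4 in T; exact T.
    - intros x x' Hx Hxx Hx'.
      destruct (Hg x ltac:(lra)) as (G1 & G2); destruct (Hg x' ltac:(lra)) as (G3 & G4).
      pose proof (Hmu (g x) (g x') ltac:(lra) (Hgm x x' Hx Hxx Hx') ltac:(lra)) as (T1 & T2).
      pose proof (Hphi (g x) (g x') ltac:(lra) (Hgm x x' Hx Hxx Hx') ltac:(lra)) as (T3 & T4).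
      rewrite G2, G4 in T3, T4; split.
      + apply Rle_trans with (om / (8 * del ^ 2) * (g x' - g x)); auto.
        replace (om / (8 * del ^ 2) * (g x' - g x)) with (om' / 16 * (2 * del * (g x' - g x)))
          by (unfold om'; field; lra).
        apply Rmult_le_compat_l; lra.
      + apply Rle_trans with (8 * om / del ^ 2 * (g x' - g x)); auto.
        replace (8 * om / del ^ 2 * (g x' - g x)) with (16 * om' * (del / 2 * (g x' - g x)))
          by (unfold om'; field; lra).
        apply Rle_trans with (16 * om' * (x' - x)); [apply Rmult_le_compat_l|apply Rmult_le_compat_r]; lra.
    - intros x Hx; destruct (Hg x Hx) as (G1 & G2); set (s := g x) in *.
      replace (mu s) with (mu s0 + (mu s - mu s0)) by ring.
      eapply Rle_trans; [apply Rabs_triang|].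
      assert (Rabs (mu s - mu s0) <= 8 * om / del ^ 2 * rho); [|lra].
      assert (H8 : 0 < 8 * om / del ^ 2) by (apply Rdiv_lt_0_compat; lra).
      destruct (Rle_dec s0 s).
      + pose proof (Hmu s0 s ltac:(unfold a; lra) ltac:(lra) ltac:(lra)) as (T1 & T2).
        assert (0 <= om / (8 * del ^ 2) * (s - s0)) by (apply Rmult_le_pos; lra).
        assert (8 * om / del ^ 2 * (s - s0) <= 8 * om / del ^ 2 * rho) by (apply Rmult_le_compat_l; unfold b in G1; lra).
        apply Rabs_le; lra.
      + pose proof (Hmu s s0 ltac:(lra) ltac:(lra) ltac:(unfold b; lra)) as (T1 & T2).
        assert (0 <= om / (8 * del ^ 2) * (s0 - s)) by (apply Rmult_le_pos; lra).
        assert (8 * om / del ^ 2 * (s0 - s) <= 8 * om / del ^ 2 * rho) by (apply Rmult_le_compat_l; unfold a in G1; lra).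
        apply Rabs_le; lra. }
  (* Half the radius, because [arc_negligible] needs room inside the arc on both sides. *)
  exists (rho / 2); split; [lra|]; intros sigma Q0 eps Hsig Heps.
  assert (Hinc : forall s t, a <= s -> s < t -> t <= b -> phi1 s < phi1 t).
  { intros s t Hs Hst Ht; destruct (Hphi s t Hs ltac:(lra) Ht) as (P & _).
    assert (0 < del / 2 * (t - s)) by (apply Rmult_lt_0_compat; lra); lra. }
  pose proof (Hinc a (s0 - rho / 2) ltac:(unfold a; lra) ltac:(unfold a; lra) ltac:(unfold b; lra)) as I1.
  pose proof (Hinc (s0 - rho / 2) (s0 + rho / 2) ltac:(unfold a; lra) ltac:(lra) ltac:(unfold b; lra)) as I2.
  pose proof (Hinc (s0 + rho / 2) b ltac:(unfold a; lra) ltac:(unfold b; lra) ltac:(unfold b; lra)) as I3.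
  (* The factor [del / 4] offsets the pull-back: [2 / del] from the expansion of [phi1] and 2 from
     [fcov_diam]. *)
  destruct (arc_negligible _ _ _ _ _ _ _ sigma Q0 (phi1 (s0 - rho / 2)) (phi1 (s0 + rho / 2)) (eps * (del / 4))
     Arc Hsig I1 ltac:(lra) I3 ltac:(apply Rmult_lt_0_compat; lra)) as (l & Wl & Cl & Tl).
  eapply fcov_mono; [apply (fcov_pieces l (fun p s => Rabs (s - s0) <= rho / 2 /\ fst p <= phi1 s <= snd p) (4 / del))| |].
  - intros p Hp; specialize (Wl p Hp).
    replace (4 / del * (snd p - fst p)) with (2 * (2 / del * (snd p - fst p))) by (field; lra).
    apply fcov_diam.
    + apply Rmult_le_pos; [apply Rlt_le, Rdiv_lt_0_compat|]; lra.
    + intros x y (Hx & Px) (Hy & Py) Hxy; apply Rabs_bound in Hx, Hy.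
      destruct (Hphi x y ltac:(unfold a; lra) Hxy ltac:(unfold b; lra)) as (P & _).
      apply Rmult_le_reg_l with (del / 2); [lra|].
      replace (del / 2 * (2 / del * (snd p - fst p))) with (snd p - fst p) by (field; lra); lra.
  - intros s (Hs & Hss0); pose proof Hss0 as Hss; apply Rabs_bound in Hss.
    assert (Hsx : phi1 (s0 - rho / 2) <= phi1 s <= phi1 (s0 + rho / 2)).
    { split.
      - destruct (Req_dec s (s0 - rho / 2)) as [->|N]; [lra|].
        apply Rlt_le, Hinc; unfold a, b; lra.
      - destruct (Req_dec s (s0 + rho / 2)) as [->|N]; [lra|].
        apply Rlt_le, Hinc; unfold a, b; lra. }
    assert (Gs : g (phi1 s) = s).
    { destruct (Hg (phi1 s) ltac:(lra)) as (G1 & G2).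
      destruct (Rtotal_order (g (phi1 s)) s) as [L|[L|L]]; auto; exfalso.
      - pose proof (Hinc (g (phi1 s)) s ltac:(lra) L ltac:(unfold b; lra)); lra.
      - pose proof (Hinc s (g (phi1 s)) ltac:(unfold a; lra) L ltac:(lra)); lra. }
    destruct (Cl (phi1 s)) as (p & Hp & Hps).
    { split; auto; intros Q HQ; rewrite Gs; apply Hs, HQ. }
    exists p; split; [auto|split; auto].
  - apply Rle_trans with (4 / del * (eps * (del / 4))); [|apply Req_le; field; lra].
    apply Rmult_le_compat_l; [apply Rlt_le, Rdiv_lt_0_compat|]; lra.
Qed.

(** * Reflections and exchange of the coordinates *)

Lemma has_deriv_opp f f' : has_deriv_on01 f f' -> has_deriv_on01 (fun s => - f s) (fun s => - f' s).
Proof.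
  intros H x Hx eps Heps; destruct (H x Hx eps Heps) as (delta & Hd & P).
  exists delta; split; auto; intros y Hy Hxy; specialize (P y Hy Hxy).
  assert (y - x <> 0) by (intros E; rewrite E, Rabs_R0 in Hxy; lra).
  replace ((- f y - - f x) / (y - x) - - f' x) with (- ((f y - f x) / (y - x) - f' x)) by (field; auto).
  rewrite Rabs_Ropp; auto.
Qed.

Lemma continuous_opp f : continuous_on01 f -> continuous_on01 (fun s => - f s).
Proof.
  intros H x Hx eps Heps; destruct (H x Hx eps Heps) as (delta & Hd & P).
  exists delta; split; auto; intros y Hy Hxy; specialize (P y Hy Hxy).
  replace (- f y - - f x) with (- (f y - f x)) by ring; rewrite Rabs_Ropp; auto.
Qed.

Lemma C2_curve_opp1 phi1 phi2 d1 d2 e1 e2 : C2_curve phi1 phi2 d1 d2 e1 e2 ->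
  C2_curve (fun s => - phi1 s) phi2 (fun s => - d1 s) d2 (fun s => - e1 s) e2.
Proof. intros []; split; auto using has_deriv_opp, continuous_opp. Qed.

Lemma C2_curve_swap phi1 phi2 d1 d2 e1 e2 : C2_curve phi1 phi2 d1 d2 e1 e2 ->
  C2_curve phi2 phi1 d2 d1 e2 e1.
Proof. intros []; split; auto. Qed.

Lemma DI_solvable_swap sigma Q v1 v2 : DI_solvable sigma Q v1 v2 -> DI_solvable sigma Q v2 v1.
Proof.
  intros (q & p1 & p2 & Hq & Hn & Hs); exists q, p2, p1; split; [auto|split; auto].
  unfold supnorm2 in *; rewrite Rmax_comm; auto.
Qed.

Lemma DI_solvable_opp1 sigma Q v1 v2 : DI_solvable sigma Q v1 v2 -> DI_solvable sigma Q (- v1) v2.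
Proof.
  intros (q & p1 & p2 & Hq & Hn & Hs); exists q, (- p1)%Z, p2; split; [auto|split; auto].
  unfold supnorm2 in *; rewrite opp_IZR.
  replace (INR q * - v1 - - IZR p1) with (- (INR q * v1 - IZR p1)) by ring; rewrite Rabs_Ropp; auto.
Qed.

Definition locally_negligible (phi1 phi2 : R -> R) (s0 : R) : Prop :=
  exists rho, 0 < rho /\ forall sigma Q0 eps, 0 < sigma < 1 -> 0 < eps ->
    fcov (fun s => (forall Q, Q0 <= Q -> DI_solvable sigma Q (phi1 s) (phi2 s)) /\ Rabs (s - s0) <= rho) eps.

Lemma locally_negligible_swap phi1 phi2 s0 :
  locally_negligible phi2 phi1 s0 -> locally_negligible phi1 phi2 s0.
Proof.
  intros (rho & Hr & H); exists rho; split; auto; intros sigma Q0 eps Hs He.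
  eapply fcov_mono; [apply (H sigma Q0 eps Hs He)| |lra].
  intros s (B & Hs0); split; auto; intros; apply DI_solvable_swap; auto.
Qed.

Lemma locally_negligible_opp1 phi1 phi2 s0 :
  locally_negligible (fun s => - phi1 s) phi2 s0 -> locally_negligible phi1 phi2 s0.
Proof.
  intros (rho & Hr & H); exists rho; split; auto; intros sigma Q0 eps Hs He.
  eapply fcov_mono; [apply (H sigma Q0 eps Hs He)| |lra].
  intros s (B & Hs0); split; auto; intros; apply DI_solvable_opp1; auto.
Qed.

(** Reflections make [d1] and the Wronskian positive, and an exchange of coordinates handles
    [d1 s0 = 0], where [d2 s0] cannot vanish too. Solvability is invariant under all of these. *)
Lemma nondegenerate_chart phi1 phi2 d1 d2 e1 e2 s0 :
  C2_curve phi1 phi2 d1 d2 e1 e2 -> 0 < s0 < 1 -> wronskian d1 d2 e1 e2 s0 <> 0 ->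
  locally_negligible phi1 phi2 s0.
Proof.
  intros H Hs0 HW.
  assert (P : forall phi1 phi2 d1 d2 e1 e2, C2_curve phi1 phi2 d1 d2 e1 e2 ->
    0 < d1 s0 -> wronskian d1 d2 e1 e2 s0 <> 0 -> locally_negligible phi1 phi2 s0).
  { clear - Hs0; intros phi1 phi2 d1 d2 e1 e2 H Hd HW.
    destruct (Rdichotomy _ _ HW) as [L|L].
    - apply locally_negligible_swap, locally_negligible_opp1, locally_negligible_swap.
      apply (positive_chart phi1 (fun s => - phi2 s) d1 (fun s => - d2 s) e1 (fun s => - e2 s)); auto.
      + apply C2_curve_swap, C2_curve_opp1, C2_curve_swap; auto.
      + unfold wronskian in *; lra.
    - apply (positive_chart phi1 phi2 d1 d2 e1 e2); auto. }
  assert (P' : forall phi1 phi2 d1 d2 e1 e2, C2_curve phi1 phi2 d1 d2 e1 e2 ->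
    d1 s0 <> 0 -> wronskian d1 d2 e1 e2 s0 <> 0 -> locally_negligible phi1 phi2 s0).
  { clear - P; intros phi1 phi2 d1 d2 e1 e2 H Hd HW.
    destruct (Rdichotomy _ _ Hd) as [L|L].
    - apply locally_negligible_opp1.
      apply (P _ _ _ _ _ _ (C2_curve_opp1 _ _ _ _ _ _ H)); [lra|].
      intros E; apply HW; unfold wronskian in *; lra.
    - apply (P _ _ _ _ _ _ H); auto. }
  destruct (Req_dec (d1 s0) 0) as [Z|Z]; [|apply (P' _ _ _ _ _ _ H); auto].
  apply locally_negligible_swap, (P' _ _ _ _ _ _ (C2_curve_swap _ _ _ _ _ _ H)).
  - intros Z2; apply HW; unfold wronskian; rewrite Z, Z2; ring.
  - intros E; apply HW; unfold wronskian in *; lra.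
Qed.

(** If the determinant vanishes, [(v2, - u2)] and [(v1, - u1)] are relations; they force [u = 0],
    and then [(1, 0)] is one. *)
Lemma lin_indep2_det u1 u2 v1 v2 : lin_indep2 u1 u2 v1 v2 -> u1 * v2 - u2 * v1 <> 0.
Proof.
  intros H E.
  destruct (H v2 (- u2)) as (_ & A); [lra|ring|].
  destruct (H v1 (- u1)) as (_ & B); [ring|lra|].
  destruct (H 1 0) as (C & _); lra.
Qed.

(** * Null sets *)

Lemma null_mono (E E' : R -> Prop) : null_set E -> (forall x, E' x -> E x) -> null_set E'.
Proof.
  intros H HE eps Heps; destruct (H eps Heps) as (a & b & H1 & H2 & H3).
  exists a, b; split; auto.
Qed.

Lemma sum_geometric c N : sum_f_R0 (fun n => c * (1 / 2) ^ n) N = 2 * c - c * (1 / 2) ^ N.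
Proof. induction N as [|N IH]; simpl; [field|simpl in IH; rewrite IH; field]. Qed.

Lemma sum_nth_total l : intervals l -> forall N,
  sum_f_R0 (fun n => snd (nth n l (0, 0)) - fst (nth n l (0, 0))) N <= total_length l.
Proof.
  induction l as [|p l IH]; intros W N.
  - simpl total_length; apply Req_le.
    rewrite (sum_eq _ (fun _ => 0)); [apply sum_eq_R0; auto|].
    intros i _; destruct i; simpl; ring.
  - assert (W' : intervals l) by (intros r Hr; apply W; right; auto).
    simpl total_length; destruct N as [|N].
    + simpl; pose proof (total_length_ge0 l W'); lra.
    + rewrite decomp_sum by lia; simpl pred; specialize (IH W' N).
      change (nth 0 (p :: l) (0, 0)) with p.
      apply Rplus_le_compat_l; exact IH.
Qed.

(** The list is continued by the degenerate default [(0, 0)], and the n-th interval is opened by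
    [w n] on each side; the widenings sum to less than [eps / 2]. *)
Lemma null_of_fcov (E : R -> Prop) : (forall eps, 0 < eps -> fcov E eps) -> null_set E.
Proof.
  intros H eps Heps; destruct (H (eps / 2) ltac:(lra)) as (l & W & C & T).
  set (w := fun n : nat => eps / 8 * (1 / 2) ^ n).
  assert (Hw : forall n, 0 < w n).
  { intros n; apply Rmult_lt_0_compat; [lra|apply pow_lt; lra]. }
  exists (fun n => fst (nth n l (0, 0)) - w n), (fun n => snd (nth n l (0, 0)) + w n).
  split; [|split].
  - intros n; specialize (Hw n).
    assert (fst (nth n l (0, 0)) <= snd (nth n l (0, 0))); [|lra].
    destruct (nth_in_or_default n l (0, 0)) as [I|I]; [apply W, I|rewrite I; simpl; lra].
  - intros x Hx; destruct (C x Hx) as (p & Hp & Hxp).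
    destruct (In_nth l p (0, 0) Hp) as (n & _ & En); exists n; rewrite En; specialize (Hw n); lra.
  - intros N.
    rewrite (sum_eq _ (fun n => snd (nth n l (0, 0)) - fst (nth n l (0, 0)) + 2 * w n)) by (intros; ring).
    rewrite sum_plus.
    rewrite (sum_eq (fun n => 2 * w n) (fun n => eps / 4 * (1 / 2) ^ n)) by (intros; unfold w; field).
    rewrite sum_geometric; pose proof (sum_nth_total l W N).
    assert (0 < (1 / 2) ^ N) by (apply pow_lt; lra); nra.
Qed.

(** * Countable unions of null sets *)

Fixpoint lsum {A} (g : A -> R) (l : list A) : R :=
  match l with [] => 0 | x :: l => g x + lsum g l end.

Lemma lsum_app {A} (g : A -> R) l l' : lsum g (l ++ l') = lsum g l + lsum g l'.
Proof. induction l; simpl; lra. Qed.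

Lemma lsum_ge0 {A} (g : A -> R) l : (forall x, 0 <= g x) -> 0 <= lsum g l.
Proof. intros H; induction l as [|x l IH]; simpl; [lra|specialize (H x); lra]. Qed.

Lemma lsum_incl {A} (g : A -> R) l l' : (forall x, 0 <= g x) -> NoDup l -> incl l l' ->
  lsum g l <= lsum g l'.
Proof.
  intros Hg; revert l'; induction l as [|x l IH]; intros l' ND I; simpl; [apply lsum_ge0; auto|].
  inversion ND as [|? ? Nx ND']; subst.
  destruct (in_split x l' (I x (or_introl eq_refl))) as (l1 & l2 & ->).
  rewrite lsum_app; simpl.
  assert (lsum g l <= lsum g (l1 ++ l2)); [|rewrite lsum_app in *; lra].
  apply IH; auto; intros y Hy.
  specialize (I y (or_intror Hy)); apply in_app_or in I as [I|[->|I]]; apply in_or_app; auto.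
  contradiction.
Qed.

Lemma lsum_map {A B} (g : B -> R) (h : A -> B) l : lsum g (map h l) = lsum (fun x => g (h x)) l.
Proof. induction l; simpl; lra. Qed.

Lemma lsum_seq g N : lsum g (seq 0 (S N)) = sum_f_R0 g N.
Proof.
  induction N as [|N IH]; [simpl; ring|].
  rewrite seq_S, lsum_app, IH; simpl; ring.
Qed.

Lemma lsum_list_prod {A B} (g : A * B -> R) l l' :
  lsum g (list_prod l l') = lsum (fun x => lsum (fun y => g (x, y)) l') l.
Proof. induction l as [|x l IH]; simpl; [auto|rewrite lsum_app, lsum_map, IH; auto]. Qed.

Lemma lsum_le {A} (g h : A -> R) l : (forall x, g x <= h x) -> lsum g l <= lsum h l.
Proof. intros H; induction l as [|x l IH]; simpl; [lra|specialize (H x); lra]. Qed.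

Lemma null_union (E : nat -> R -> Prop) : (forall n, null_set (E n)) -> null_set (fun x => exists n, E n x).
Proof.
  intros H eps Heps.
  assert (C : forall n, exists ab : (nat -> R) * (nat -> R),
    (forall i, fst ab i <= snd ab i) /\ (forall x, E n x -> exists i, fst ab i < x < snd ab i) /\
    (forall N, sum_f_R0 (fun i => snd ab i - fst ab i) N <= eps / 2 * (1 / 2) ^ n)).
  { intros n; destruct (H n (eps / 2 * (1 / 2) ^ n)) as (a & b & Hab).
    - apply Rmult_lt_0_compat; [lra|apply pow_lt; lra].
    - exists (a, b); exact Hab. }
  set (ab := fun n => proj1_sig (constructive_indefinite_description _ (C n))).
  assert (Hab : forall n, (forall i, fst (ab n) i <= snd (ab n) i) /\
    (forall x, E n x -> exists i, fst (ab n) i < x < snd (ab n) i) /\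
    (forall N, sum_f_R0 (fun i => snd (ab n) i - fst (ab n) i) N <= eps / 2 * (1 / 2) ^ n)).
  { intros n; exact (proj2_sig (constructive_indefinite_description _ (C n))). }
  clearbody ab; clear C.
  set (len := fun p : nat * nat => snd (ab (fst p)) (snd p) - fst (ab (fst p)) (snd p)).
  assert (Hlen : forall p, 0 <= len p).
  { intros (n & i); unfold len; simpl; destruct (Hab n) as (H1 & _); specialize (H1 i); lra. }
  exists (fun m => fst (ab (fst (Cantor.of_nat m))) (snd (Cantor.of_nat m))),
         (fun m => snd (ab (fst (Cantor.of_nat m))) (snd (Cantor.of_nat m))).
  split; [|split].
  - intros m; apply Hab.
  - intros x (n & Hx); destruct (Hab n) as (_ & H2 & _); destruct (H2 x Hx) as (i & Hi).
    exists (Cantor.to_nat (n, i)); rewrite Cantor.cancel_of_to; exact Hi.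
  - intros M.
    change (sum_f_R0 (fun m => len (Cantor.of_nat m)) M <= eps).
    rewrite <- lsum_seq, <- (lsum_map len Cantor.of_nat).
    (* Cantor's code dominates both components, so the first [S M] codes lie in this square, which
       is summed by rows. *)
    apply Rle_trans with (lsum len (list_prod (seq 0 (S M)) (seq 0 (S M)))).
    + apply lsum_incl; auto.
      * apply NoDup_map_NoDup_ForallPairs; [|apply seq_NoDup].
        intros i j _ _ E'; rewrite <- (Cantor.cancel_to_of i), E', Cantor.cancel_to_of; auto.
      * intros (n & i) Hp; apply in_map_iff in Hp as (m & Em & Hm); apply in_seq in Hm.
        pose proof (Cantor.to_nat_non_decreasing n i) as Hle.
        rewrite <- Em, Cantor.cancel_to_of in Hle.
        apply in_prod; apply in_seq; lia.
    + rewrite lsum_list_prod.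
      apply Rle_trans with (lsum (fun n => eps / 2 * (1 / 2) ^ n) (seq 0 (S M))).
      * apply lsum_le; intros n; rewrite lsum_seq; exact (proj2 (proj2 (Hab n)) M).
      * rewrite lsum_seq, sum_geometric.
        assert (0 < (1 / 2) ^ M) by (apply pow_lt; lra); nra.
Qed.

Lemma null_or (E1 E2 : R -> Prop) : null_set E1 -> null_set E2 -> null_set (fun x => E1 x \/ E2 x).
Proof.
  intros H1 H2.
  apply (null_mono (fun x => exists n : nat, match n with O => E1 x | _ => E2 x end)).
  - apply null_union; intros [|n]; auto.
  - intros x [Hx|Hx]; [exists 0%nat|exists 1%nat]; auto.
Qed.

Lemma null_point p : null_set (fun x => x = p).
Proof.
  apply null_of_fcov; intros eps Heps; apply fcov_mono with (E := fun x => x = p) (L := 2 * 0); auto; [|lra].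
  apply fcov_diam; [lra|]; intros x y -> ->; lra.
Qed.

Lemma DI_solvable_mono sigma sigma' Q v1 v2 : 0 < sigma <= sigma' ->
  DI_solvable sigma Q v1 v2 -> DI_solvable sigma' Q v1 v2.
Proof.
  intros Hs (q & p1 & p2 & Hq & Hn & Hl); exists q, p1, p2; split; [auto|split].
  - eapply Rlt_le_trans; [apply Hn|apply Rmult_le_compat_r; [apply Rlt_le, exp_pos|lra]].
  - apply le_INR in Hq; simpl in Hq.
    assert (0 < Q).
    { apply Rmult_lt_reg_l with sigma; [lra|]; rewrite Rmult_0_r; lra. }
    apply Rlt_le_trans with (sigma * Q); [auto|apply Rmult_le_compat_r; lra].
Qed.

Theorem theorem1p2 (phi1 phi2 : R -> R) :
  nondegenerate phi1 phi2 ->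
  null_set (fun s => I01 s /\ ~ no_DI_improvement (phi1 s) (phi2 s)).
Proof.
  intros (d1 & d2 & e1 & e2 & H1 & H2 & H3 & H4 & H5 & H6 & HN).
  assert (HC : C2_curve phi1 phi2 d1 d2 e1 e2) by (split; auto).
  (* Countably many pieces: rational centres and radii, [sigma] tending to 1 and integer thresholds
     for [Q]. *)
  set (S := fun (n i k j : nat) s =>
    (forall Q, INR j <= Q -> DI_solvable (1 - / (INR k + 2)) Q (phi1 s) (phi2 s)) /\
    Rabs (s - INR i / (INR n + 1)) <= 1 / (INR n + 1)).
  (* Only null pieces are kept, so that their union is null without a choice of charts or
     compactness; it remains to put each bad [s] into one of them. *)
  set (G := fun n i k j s => null_set (S n i k j) /\ S n i k j s).
  assert (HG : null_set (fun s => exists n i k j, G n i k j s)).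
  { do 4 (apply null_union; intros ?).
    match goal with |- null_set ?X => destruct (classic (exists s, X s)) as [(s & (Hs & _))|Ns] end.
    - apply (null_mono _ _ Hs); intros x (_ & Hx); exact Hx.
    - eapply null_mono; [apply (null_point 0)|].
      intros x Hx; exfalso; apply Ns; exists x; exact Hx. }
  apply (null_mono (fun s => (I01 s /\ ~ lin_indep2 (d1 s) (d2 s) (e1 s) (e2 s)) \/
     ((s = 0 \/ s = 1) \/ exists n i k j, G n i k j s))).
  { apply null_or; [exact HN|apply null_or; [apply null_or; apply null_point|exact HG]]. }
  intros s (Is & Hs).
  destruct (classic (lin_indep2 (d1 s) (d2 s) (e1 s) (e2 s))) as [Li|Li]; [right|left; auto].
  destruct (Req_dec s 0) as [Z|Z]; [auto|]; destruct (Req_dec s 1) as [Z1|Z1]; [auto|].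
  right; unfold I01 in Is.
  destruct (nondegenerate_chart phi1 phi2 d1 d2 e1 e2 s HC ltac:(lra)) as (rho & Hr & Hcov).
  { apply lin_indep2_det in Li; exact Li. }
  apply NNPP in Hs as (sigma & Hsig & (Q0 & HQ)).
  destruct (INR_unbounded (2 / rho)) as (n & Hn).
  pose proof (pos_INR n) as Hn0.
  (* The centre [i / (n + 1)] is within [1 / (n + 1)] of [s], so its ball of that radius lies in the
     chart of radius [rho] about [s]. *)
  destruct (nfloor_spec (s * (INR n + 1))) as (F1 & F2); [apply Rmult_le_pos; lra|].
  set (i := nfloor (s * (INR n + 1))) in *.
  destruct (INR_unbounded (/ (1 - sigma))) as (k & Hk).
  destruct (INR_unbounded Q0) as (j & Hj).
  pose proof (pos_INR k) as Hk0.
  assert (Hin : 0 <= s - INR i / (INR n + 1) <= 1 / (INR n + 1)).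
  { replace (s - INR i / (INR n + 1)) with ((s * (INR n + 1) - INR i) / (INR n + 1)) by (field; lra).
    split; [apply Rle_mult_inv_pos; lra|].
    apply Rmult_le_compat_r; [apply Rlt_le, Rinv_0_lt_compat|]; lra. }
  assert (Hrn : 2 * (1 / (INR n + 1)) <= rho).
  { apply Rmult_le_reg_r with ((INR n + 1) / rho); [apply Rdiv_lt_0_compat; lra|].
    replace (2 * (1 / (INR n + 1)) * ((INR n + 1) / rho)) with (2 / rho) by (field; lra).
    replace (rho * ((INR n + 1) / rho)) with (INR n + 1) by (field; lra); lra. }
  assert (Hk1 : 0 < / (INR k + 2) <= 1 - sigma).
  { split; [apply Rinv_0_lt_compat; lra|].
    rewrite <- (Rinv_inv (1 - sigma)); apply Rinv_le_contravar; [apply Rinv_0_lt_compat|]; lra. }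
  assert (Hk2 : / (INR k + 2) < 1) by (rewrite <- Rinv_1; apply Rinv_lt_contravar; lra).
  exists n, i, k, j; split; [|split].
  - apply null_of_fcov; intros eps Heps.
    eapply fcov_mono; [apply (Hcov (1 - / (INR k + 2)) (INR j) eps); lra| |lra].
    intros t (Ht1 & Ht2); split; auto.
    apply Rabs_bound in Ht2; apply Rabs_le; lra.
  - intros Q HjQ; apply (DI_solvable_mono sigma); [lra|]; apply HQ; lra.
  - rewrite Rabs_pos_eq; lra.
Qed.
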